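(* Let $p\in\mathbb{N}$, let $A_j=A_j^*\in\mathbb{C}^{p\times p}$ and let $B_j\in\mathbb{C}^{p\times p}$ be invertible for $j\ge 0$. Let $\mathbf{J}$ be the associated block Jacobi matrix, with preminimal, minimal and maximal operators $T$, $T_{\min}=\overline{T}$, $T_{\max}=T_{\min}^*$ in $l^2_p$. Assume that $T$ is non-negative and that the deficiency indices of $T_{\min}$ are $n_\pm(T_{\min})=p$. Let $\Pi=\{\mathbb{C}^p,\Gamma_0,\Gamma_1\}$ be the boundary triplet for $T_{\max}$ given by $$\Gamma_1u=\sum_{j=0}^\infty Q_j(0)^*(T_{\max}u)_j-u_0,\qquad \Gamma_0u=\sum_{j=0}^\infty P_j(0)^*(T_{\max}u)_j,\qquad u\in\operatorname{dom}(T_{\max}),$$ where $(P_j)$, $(Q_j)$ are the matrix polynomials of the first and second kind. Let $M(\cdot)$ be the corresponding Weyl function and let $T_0:=T_{\max}\upharpoonright\ker(\Gamma_0)$. Then the following assertions hold. (i) The Krein extension $T_K$ of $T_{\min}$ coincides with $T_0$, i.e. $$\operatorname{dom}(T_K)=\Big\{u\in\operatorname{dom}(T_{\max}):\ \sum_{j=0}^\infty P_j(0)^*(T_{\max}u)_j=0\Big\}.$$ (ii) A self-adjoint extension $T_\Theta$ of $T_{\min}$ is non-negative if and only if it admits a representation $$T_\Theta=T_{C,D}=T_{\max}\upharpoonright\ker(D\Gamma_1-C\Gamma_0),$$ where $C,D\in\mathbb{C}^{p\times p}$ satisfy $$CD^*=DC^*,\qquad 0\in\rho(CC^*+DD^*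 ),\qquad CD^*-DM(-\infty)D^*\le 0.$$ (iii) The number of negative eigenvalues of a self-adjoint extension $T_{C,D}=T_{C,D}^*$, where $T_{C,D}:=T_{\max}\upharpoonright\ker(D\Gamma_1-C\Gamma_0)$ with $C,D\in\mathbb{C}^{p\times p}$, coincides with the number of positive eigenvalues of the linear relation $CD^*-DM(-\infty)D^*$, i.e. $$\kappa_-(T_{C,D})=\kappa_+\big(CD^*-DM(-\infty)D^*\big).$$
   Context: $l^2_p$ is the Hilbert space of sequences $u=(u_j)_{j\ge0}$, $u_j\in\mathbb{C}^p$, with inner product $(u,v)=\sum_{j\ge0}v_j^*u_j$. With $B_{-1}:=O_p$ (the zero matrix), set $(\mathbf{J}u)_j=B_ju_{j+1}+A_ju_j+B_{j-1}^*u_{j-1}$ for $j\ge0$. The maximal operator is $T_{\max}u=\mathbf{J}u$ on $\operatorname{dom}(T_{\max})=\{u\in l^2_p:\mathbf{J}u\in l^2_p\}$. The preminimal operator $T$ is the restriction of $T_{\max}$ to finitely supported sequences, and $T_{\min}$ is the closure of $T$. One has $T_{\min}^*=T_{\max}$ and $T_{\max}^*=T_{\min}$. The deficiency indices are $n_\pm(T_{\min})=\dim\ker(T_{\max}\pm iI)$. $(P_j(z))_{j\ge0}$ is the $\mathbb{C}^{p\times p}$-valued solution of $(\mathbf{J}U)_j=zU_j$, $j\ge0$, with $P_0(z)=I_p$, $P_1(z)=B_0^{-1}(zI_p-A_0)$. $(Q_j(z))_{j\ge0}$ is the $\mathbb{C}^{p\times p}$-valued solution of $(\mathbf{J}U)_j=zU_j$,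 $j\ge1$, with $Q_0(z)=O_p$, $Q_1(z)=B_0^{-1}$. Under the assumption $n_\pm(T_{\min})=p$ the series $\sum_j\|P_j(z)\|^2$ and $\sum_j\|Q_j(z)\|^2$ converge for every $z\in\mathbb{C}$, so $\Gamma_0,\Gamma_1$ are well defined. Boundary triplet: for a closed densely defined symmetric operator $A$ in a Hilbert space, a triplet $\{\mathcal H,\Gamma_0,\Gamma_1\}$ with $\mathcal H$ a Hilbert space and $\Gamma_0,\Gamma_1:\operatorname{dom}(A^* )\to\mathcal H$ linear is a boundary triplet for $A^*$ if $(A^*f,g)-(f,A^*g)=(\Gamma_1f,\Gamma_0g)-(\Gamma_0f,\Gamma_1g)$ for all $f,g\in\operatorname{dom}(A^* )$ and $(\Gamma_0,\Gamma_1):\operatorname{dom}(A^* )\to\mathcal H\oplus\mathcal H$ is surjective. With $A_0:=A^*\upharpoonright\ker\Gamma_0$ (self-adjoint), the Weyl function $M:\rho(A_0)\to\mathcal B(\mathcal H)$ is defined by $\Gamma_1f=M(z)\Gamma_0f$ for all $f\in\ker(A^*-zI)$, $z\in\rho(A_0)$. A closed linear relation in $\mathbb{C}^p$ is a subspace $\Theta$ of $\mathbb{C}^p\oplus\mathbb{C}^p$. $T_\Theta$ denotes the restriction of $T_{\max}$ to $\{u\in\operatorname{dom}(T_{\max}):\{\Gamma_0u,\Gamma_1u\}\in\Theta\}$; every closed proper extension of $T_{\min}$ (in particular, every self-adjoint one) is of this form. Krein extension of a densely defined non-negative symmetric $A$: $A_K$ is the restriction of $A^*$ to the set of $u\in\operatorname{dom}(A^*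 )$ for which there are $u_k\in\operatorname{dom}(A)$ with $\|A^*u-Au_k\|\to0$ as $k\to\infty$ and $(u_j-u_k,A(u_j-u_k))\to0$ as $j,k\to\infty$. It is a non-negative self-adjoint extension of $A$. $M(-\infty)$ is the strong resolvent limit of $M(x)$ as $x\downarrow-\infty$. It is a self-adjoint linear relation in $\mathbb{C}^p$ (possibly with a nontrivial multivalued part), associated with the quadratic form $\mathrm t_{-\infty}[f]=\lim_{x\downarrow-\infty}(M(x)f,f)$ on the set of those $f$ for which this limit is finite. $CD^*-DM(-\infty)D^*$ is the linear relation $\{\{k,\,CD^*k-Dg\}:\ \{D^*k,g\}\in M(-\infty)\}$ in $\mathbb{C}^p$ (the usual sum and product of linear relations); it is the usual Hermitian matrix when $M(-\infty)$ is a matrix. $\le 0$ is non-positivity. $\kappa_-(S)$ and $\kappa_+(S)$ denote the numbers of negative and of positive eigenvalues of $S$, counted with multiplicity.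
   Formalization: If CD*-DM(-∞)D* has a multivalued part, its dimension is added to κ_+ (as eigenvalue +∞), and ''≤ 0'' also requires the relation to be defined on all of C^p; otherwise (ii), (iii) fail, e.g. for p=1 when T has lower bound exactly 0. *)

(* Defs.v *)
From HB Require Import structures.
From mathcomp Require Export all_boot all_order all_algebra spectral.
From mathcomp Require Export all_classical all_reals all_analysis.
From mathcomp.real_closed Require Export complex.
Set Implicit Arguments.
Unset Strict Implicit.
Unset Printing Implicit Defensive.
Export Order.TTheory GRing.Theory Num.Theory numFieldNormedType.Exports.

#[export] Set Warnings "-notation-overridden,-ambiguous-paths".
Global Open Scope classical_set_scope.
Global Open Scope ring_scope.
Global Open Scope sesquilinear_scope.
Global Open Scope complex_scope.

(* Operators and linear relations are represented by their graphs
   S : set (V * V).  The ambient inner product space is given by a subset H of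
   V together with ip : V -> V -> C, linear in the first argument: all of 'cV_p
   for C^p, the square-summable sequences for l^2_p. *)
Section Relations.
Variables (C : numClosedFieldType) (V : lmodType C).
Implicit Types (S : set (V * V)) (H : set V) (ip : V -> V -> C).

Definition linear_relation S : Prop :=
  S 0 /\ forall (a : C) x y, S x -> S y -> S (a *: x + y).

Definition dom S : set V := [set u | exists w, S (u, w)].

Definition mulpart S : set V := [set w | S (0, w)].

(* ker (S - z) *)
Definition ker_sub S (z : C) : set V := [set u | S (u, z *: u)].

Definition adjoint H ip S : set (V * V) :=
  [set x | [/\ H x.1, H x.2 & forall y, S y -> ip y.2 x.1 = ip y.1 x.2]].

Definition selfadjoint H ip S : Prop := S = adjoint H ip S.

Definition nonneg ip S : Prop := forall x, S x -> 0 <= ip x.2 x.1.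

End Relations.

Section Counting.
Variables (R : realType) (V : lmodType R[i]).
Implicit Types (W : set V) (S : set (V * V)).

Definition lin_indep n (v : 'I_n -> V) : Prop :=
  forall c : 'I_n -> R[i], \sum_i c i *: v i = 0 -> forall i, c i = 0.

(* Dimension of a subspace, +oo if it is infinite-dimensional. *)
Definition dimension W : \bar R :=
  ereal_sup [set (n%:R)%:E | n in
    [set n : nat | exists v : 'I_n -> V, (forall i, W (v i)) /\ lin_indep v]].

(* In R[i], z < 0 and 0 < z entail that z is real. *)
Definition kappa_neg S : \bar R :=
  \esum_(z in [set z : R[i] | z < 0]) dimension (ker_sub S z).

(* The relations to which kappa_pos and nonpos_rel are applied are
   strong resolvent limits of increasing families of Hermitian matrices.  As
   usual for self-adjoint relations bounded below, their form is +oo outside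
   dom S: the multivalued part is the eigenspace of the eigenvalue +oo, which
   is a positive eigenvalue of multiplicity dim (mulpart S).  For matrices
   mulpart S = 0 and this is the usual count. *)
Definition kappa_pos S : \bar R :=
  (\esum_(z in [set z : R[i] | (0 < z)%R]) dimension (ker_sub S z)
   + dimension (mulpart S))%E.

End Counting.

Section FiniteDimensional.
Variables (C : numClosedFieldType) (p : nat).
Implicit Types (u v : 'cV[C]_p) (S : set ('cV[C]_p * 'cV[C]_p)).

Definition cdot u v : C := (v^t* *m u) 0 0.

Definition selfadjoint_rel S : Prop := selfadjoint setT cdot S.

(* S <= 0 in the order of self-adjoint relations bounded below
   (S <= S' iff dom s' is contained in dom s and s <= s' on dom s', for the
   associated forms s, s'); dom S = setT excludes the eigenvalue +oo, so that a
   self-adjoint S is non-positive iff it has no positive eigenvalue. *)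
Definition nonpos_rel S : Prop :=
  dom S = setT /\ forall x, S x -> cdot x.2 x.1 <= 0.

(* K D^* - D N D^* for matrices K, D and a linear relation N. *)
Definition CDN (K D : 'M[C]_p) (N : set ('cV[C]_p * 'cV[C]_p)) :
    set ('cV[C]_p * 'cV[C]_p) :=
  [set x | exists2 g, N (D^t* *m x.1, g) &
                      x.2 = K *m D^t* *m x.1 - D *m g].

End FiniteDimensional.

Section StrongResolventLimit.
Variables (R : realType) (C : numClosedFieldType) (p : nat).

(* N is the strong resolvent limit of X x as x tends to -oo.  For (f, g) in N
   one has f = (N - z)^-1 (g - z f), and the vectors g - z f exhaust C^p when N
   is self-adjoint and z is not real. *)
Definition strong_resolvent_limit (X : R -> 'M[C]_p)
    (N : set ('cV[C]_p * 'cV[C]_p)) : Prop :=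
  selfadjoint_rel N /\
  forall z : C, 'Im z != 0 -> forall f g, N (f, g) ->
    invmx (X x - z%:M) *m (g - z *: f) @[x --> -oo] --> f.

End StrongResolventLimit.

Section L2.
Variables (C : numClosedFieldType) (p : nat).
Notation seqV := (nat -> 'cV[C]_p).
Implicit Types (u v w : seqV) (S : set (seqV * seqV)).

Definition l2 : set seqV := [set u | cvgn (series (fun j => cdot (u j) (u j)))].

Definition inner u v : C := limn (series (fun j => cdot (u j) (v j))).

Definition l2norm u : C := sqrtC (inner u u).

Definition op_closure S : set (seqV * seqV) :=
  [set x | [/\ l2 x.1, l2 x.2 & exists y : nat -> seqV * seqV,
     [/\ forall k, S (y k),
         l2norm (x.1 - (y k).1) @[k --> \oo] --> 0 &
         l2norm (x.2 - (y k).2) @[k --> \oo] --> 0]]].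

(* Bounded invertibility of S - z on l^2_p. *)
Definition resolvent_set S : set C :=
  [set z | (forall w, l2 w -> exists! u, S (u, w + z *: u)) /\
           exists c : C, forall x, S x ->
             l2norm x.1 <= c * l2norm (x.2 - z *: x.1)].

Definition krein S : set (seqV * seqV) :=
  [set x | adjoint l2 inner S x /\ exists y : nat -> seqV * seqV,
     [/\ forall k, S (y k),
         l2norm (x.2 - (y k).2) @[k --> \oo] --> 0 &
         inner ((y jk.1).1 - (y jk.2).1) ((y jk.1).2 - (y jk.2).2)
           @[jk --> (\oo, \oo)] --> 0]].

End L2.
Arguments l2 {C p}.

Section Jacobi.
Variables (C : numClosedFieldType) (p : nat) (A B : nat -> 'M[C]_p).
Notation seqV := (nat -> 'cV[C]_p).
Implicit Types (u : seqV) (z : C).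

Definition jacobi q (U : nat -> 'M[C]_(p, q)) (j : nat) : 'M[C]_(p, q) :=
  B j *m U j.+1 + A j *m U j + (if j is k.+1 then (B k)^t* *m U k else 0).

Definition Tpre : set (seqV * seqV) :=
  [set x | (exists N, forall j, (N <= j)%N -> x.1 j = 0) /\ x.2 = jacobi x.1].

Definition Tmin : set (seqV * seqV) := op_closure Tpre.

Definition Tmax : set (seqV * seqV) :=
  [set x | [/\ l2 x.1, l2 x.2 & x.2 = jacobi x.1]].

Definition Tmax_restr (K : set seqV) : set (seqV * seqV) :=
  [set x | Tmax x /\ K x.1].

Definition selfadjoint_ext (S : set (seqV * seqV)) : Prop :=
  Tmin `<=` S /\ selfadjoint l2 (@inner C p) S.

(* The solution of (J U)_j = z U_j, j >= 1, with U_0 and U_1 prescribed. *)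
Fixpoint jacobi_sol z (U0 U1 : 'M[C]_p) (n : nat) : 'M[C]_p :=
  match n with
  | 0 => U0
  | 1 => U1
  | (k.+1 as m).+1 => invmx (B m) *m
      (z *: jacobi_sol z U0 U1 m - A m *m jacobi_sol z U0 U1 m
       - (B k)^t* *m jacobi_sol z U0 U1 k)
  end.

Definition Ppoly z : nat -> 'M[C]_p :=
  jacobi_sol z 1%:M (invmx (B 0) *m (z%:M - A 0)).

Definition Qpoly z : nat -> 'M[C]_p := jacobi_sol z 0 (invmx (B 0)).

Lemma jacobi_solE z U0 U1 j : B j.+1 \in unitmx ->
  jacobi (jacobi_sol z U0 U1) j.+1 = z *: jacobi_sol z U0 U1 j.+1.
Proof.
move=> uB; rewrite /jacobi.
have -> : jacobi_sol z U0 U1 j.+2 = invmx (B j.+1) *m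
      (z *: jacobi_sol z U0 U1 j.+1 - A j.+1 *m jacobi_sol z U0 U1 j.+1
       - (B j)^t* *m jacobi_sol z U0 U1 j) by [].
by rewrite mulKVmx// addrAC subrK subrK.
Qed.

Lemma Ppoly_sol z : (forall j, B j \in unitmx) ->
  forall j, jacobi (Ppoly z) j = z *: Ppoly z j.
Proof.
move=> uB [|j]; last exact: jacobi_solE.
by rewrite /jacobi /Ppoly /= mulKVmx// mulmx1 addr0 subrK scalemx1.
Qed.

Lemma Qpoly_sol z : (forall j, B j \in unitmx) ->
  forall j, jacobi (Qpoly z) j.+1 = z *: Qpoly z j.+1.
Proof. by move=> uB j; apply: jacobi_solE. Qed.

Definition Gamma0 u : 'cV[C]_p :=
  limn (series (fun j => (Ppoly 0 j)^t* *m jacobi u j)).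

Definition Gamma1 u : 'cV[C]_p :=
  limn (series (fun j => (Qpoly 0 j)^t* *m jacobi u j)) - u 0%N.

Definition T0 : set (seqV * seqV) := Tmax_restr [set u | Gamma0 u = 0].

Definition TTheta (Theta : set ('cV[C]_p * 'cV[C]_p)) : set (seqV * seqV) :=
  Tmax_restr [set u | Theta (Gamma0 u, Gamma1 u)].

Definition TCD (K D : 'M[C]_p) : set (seqV * seqV) :=
  Tmax_restr [set u | D *m Gamma1 u - K *m Gamma0 u = 0].

Definition weyl_function (M : C -> 'M[C]_p) : Prop :=
  forall z, resolvent_set T0 z -> forall u, ker_sub Tmax z u ->
    Gamma1 u = M z *m Gamma0 u.

End Jacobi.

(* Main.v *)
(* Constancy of the Wronskian represents every sequence u through P(z), Q(z) and
   f = (J - z)u.  Deficiency indices p put P(+-i) and, by comparison with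
   truncated problems, Q(+-i) into l^2, and a Gronwall argument extends this to
   all z.  The summation-by-parts identity then becomes Green's formula for
   Gamma_0, Gamma_1, and the Krein extension is reached with constant
   approximating sequences because u + P(0) Gamma_1 u is annihilated by Gamma_1.

   For x < 0 the Weyl function has the variational description
   (M(x)a, a) <= (Jv, v) + (Gamma_0 v, Gamma_1 v) + |x|^-1 |Jv|^2, Gamma_0 v = a,
   with equality when Jv = xv.  This gives monotonicity, continuity and blow-up
   of M at 0-, and compares the form of T_(C,D) at u, where
   (Gamma_0 u, Gamma_1 u) = (D^*k, C^*k), with the form of
   H(x) = CD^* - D M(x) D^* at k.  As x decreases to -oo, H(x) increases in the
   strong resolvent sense to CD^* - D M(-oo) D^*; hence (ii), and the negative
   eigenvectors of T_(C,D) inject into the positive part of the limit relation.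
   Conversely, H(x) is non-positive near 0 and has, for x near -oo, as many
   positive eigenvalues as the limit relation, and each of them that crosses 0 at
   some s < 0 contributes an eigenvector of T_(C,D) with eigenvalue s, namely the
   solution of Ju = su with Gamma_0 u = D^*k for k in ker H(s). *)

(* [M] enters only through the identity [Gamma1 u = M x *m Gamma0 u] for solutions of Ju = xu with x
   < 0; no holomorphy and no integral representation is invoked. Their place is taken by
   non-negativity on ker Gamma_0: there (Jd, d) - x^-1 |Jd|^2 >= 0, and d is taken to be a
   difference of two vectors with the same Gamma_0. The obstacle lies at -oo. M(x) may diverge in
   some directions, so H(x) need not have a matrix limit. That the limit relation dominates every
   H(x) follows from monotonicity. The converse, that one single H(x) is already positive on the
   whole positive subspace of the limit, eigenvalue +oo included, needs a lower bound of H(x) that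
   does converge; it comes from completing the square around resolvent vectors. No eigenvalue
   branches are followed. The number of positive eigenvalues is expressed by families of vectors on
   whose nonzero combinations the form is positive, and only the spectral gap of one matrix H(s) is
   used at a time. *)
Require Import Defs.
From mathcomp Require Import ring lra zify.
Set Implicit Arguments.
Unset Strict Implicit.
Unset Printing Implicit Defensive.

(* [R[i]] with the head constant under which its topology is found. *)
Local Notation complexC R := (Num.ClosedField.sort (complex_complex__canonical__Num_ClosedField R)).

(** * Limits in C and l^2 *)

Section ComplexLimits.
Variable R : realType.
Local Notation C := (complexC R).
Local Notation Re := (@complex.Re R).
Local Notation Im := (@complex.Im R).

Lemma Re_conjC (z : C) : Re z^*%R = Re z.
Proof. by case: z. Qed.
Lemma Im_conjC (z : C) : Im z^*%R = - Im z.
Proof. by case: z. Qed.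
Lemma ReD (y z : C) : Re (y + z) = Re y + Re z. Proof. by case: y; case: z. Qed.
Lemma ImD (y z : C) : Im (y + z) = Im y + Im z. Proof. by case: y; case: z. Qed.
Lemma ReN (z : C) : Re (- z) = - Re z. Proof. by case: z. Qed.
Lemma ImN (z : C) : Im (- z) = - Im z. Proof. by case: z. Qed.
Lemma ReM (y z : C) : Re (y * z) = Re y * Re z - Im y * Im z.
Proof. by case: y; case: z. Qed.
Lemma ImM (y z : C) : Im (y * z) = Re y * Im z + Im y * Re z.
Proof. by case: y; case: z. Qed.
Lemma complexP (y z : C) : Re y = Re z -> Im y = Im z -> y = z.
Proof. by case: y => a b; case: z => c d /= -> ->. Qed.
Lemma Re_sum (I : Type) (r : seq I) (P : pred I) (F : I -> C) :
  Re (\sum_(i <- r | P i) F i) = \sum_(i <- r | P i) Re (F i).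
Proof. by elim/big_rec2: _ => // i y x _ <-; rewrite ReD. Qed.
Lemma Im_sum (I : Type) (r : seq I) (P : pred I) (F : I -> C) :
  Im (\sum_(i <- r | P i) F i) = \sum_(i <- r | P i) Im (F i).
Proof. by elim/big_rec2: _ => // i y x _ <-; rewrite ImD. Qed.

Lemma norm_Re_le (z : C) : (`|Re z|)%:C <= `|z|.
Proof. exact: normc_ge_Re. Qed.
Lemma norm_Im_le (z : C) : (`|Im z|)%:C <= `|z|.
Proof.
have := normc_ge_Re ('i%C * z); rewrite ReM /= mul0r mul1r sub0r normrN.
by rewrite normrM (_ : `|'i%C| = 1 :> C) ?mul1r// normc_def/= expr0n expr1n add0r sqrtr1.
Qed.
Lemma norm_le_ReIm (z : C) : `|z| <= (`|Re z| + `|Im z|)%:C.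
Proof.
rewrite [X in `|X|]complexE (le_trans (ler_normD _ _))// normrM rmorphD/=.
rewrite (_ : `|'i%C| = 1 :> C) ?mul1r; last first.
  by rewrite normc_def/= expr0n expr1n add0r sqrtr1.
by rewrite !normc_def/= !expr0n/= !addr0 !sqrtr_sqr.
Qed.

Lemma cvgC_ReIm (T : Type) (F : set_system T) (FF : Filter F) (f : T -> C) (l : C) :
  (fun t => Re (f t)) @ F --> Re l -> (fun t => Im (f t)) @ F --> Im l ->
  f @ F --> l.
Proof.
move=> /cvgrPdist_lt hr /cvgrPdist_lt hi; apply/cvgrPdist_lt => e e0.
have [er ei] : 0 < Re e /\ Im e = 0 by move: e0; rewrite ltcE/= => /andP[/eqP -> ->].
have e2 : 0 < Re e / 2 by rewrite divr_gt0.
near=> t.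
have -> : e = (Re e / 2 + Re e / 2)%:C.
  by apply: complexP; rewrite //= -splitr.
rewrite (le_lt_trans (norm_le_ReIm _))// ltcR ltrD//.
- by rewrite ReD ReN; near: t; exact: hr.
- by rewrite ImD ImN; near: t; exact: hi.
Unshelve. all: by end_near. Qed.

Lemma cvgC_Re (T : Type) (F : set_system T) (FF : Filter F) (f : T -> C) (l : C) :
  f @ F --> l -> (fun t => Re (f t)) @ F --> Re l.
Proof.
move=> /cvgrPdist_lt h; apply/cvgrPdist_lt => e e0.
have eC : 0 < e%:C :> C by rewrite ltcR.
apply: filterS (h _ eC) => t; rewrite -ReN -ReD -ltcR; exact/le_lt_trans/norm_Re_le.
Qed.

Lemma cvgC_Im (T : Type) (F : set_system T) (FF : Filter F) (f : T -> C) (l : C) :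
  f @ F --> l -> (fun t => Im (f t)) @ F --> Im l.
Proof.
move=> /cvgrPdist_lt h; apply/cvgrPdist_lt => e e0.
have eC : 0 < e%:C :> C by rewrite ltcR.
apply: filterS (h _ eC) => t; rewrite -ImN -ImD -ltcR; exact/le_lt_trans/norm_Im_le.
Qed.

Lemma cvg_conjC (T : Type) (F : set_system T) (FF : Filter F) (f : T -> C) (l : C) :
  f @ F --> l -> (fun t => (f t)^*%R) @ F --> l^*%R.
Proof.
move=> h; apply: cvgC_ReIm.
  rewrite Re_conjC; under eq_fun do rewrite Re_conjC; exact: cvgC_Re.
rewrite Im_conjC; under eq_fun do rewrite Im_conjC; apply: cvgN; exact: cvgC_Im.
Qed.

Lemma cvg_mx (T : Type) (F : set_system T) (FF : Filter F) m n
    (f : T -> 'M[C]_(m, n)) (l : 'M[C]_(m, n)) :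
  f @ F --> l <-> forall i j, (fun t => f t i j) @ F --> l i j.
Proof.
split=> [h i j|h].
  apply/(@cvg_entourageP C _ _ _) => A eA.
  have hn : F (fun t => forall i j, (l i j, f t i j) \in A) :=
    iffLR (@cvg_mx_entourageP C m n _ (fmap_filter f FF) l) h A eA.
  change (F (fun t => A (l i j, f t i j))).
  by apply: filterS hn => t ht; apply/set_mem/ht.
apply: (iffRL (@cvg_mx_entourageP C m n _ (fmap_filter f FF) l)) => A eA.
change (F (fun t => forall i j, (l i j, f t i j) \in A)).
apply: (@filterS T F FF (fun t => forall i j, A (l i j, f t i j))).
  by move=> t ht i j; apply/mem_set.
apply: filter_forall => i; apply: filter_forall => j.
exact: (iffLR (@cvg_entourageP C _ _ _) (h i j)).
Qed.

Definition absbounded (a : nat -> C) :=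
  exists b : R, forall n, \sum_(j < n) `|a j| <= b%:C.


(** Both parts of [a j] are bounded by its modulus, so the two real series converge absolutely, and
    the complex limit is assembled from theirs. *)
Lemma absbounded_cvg (a : nat -> C) : absbounded a -> cvgn (series a).
Proof.
move=> [b hb].
have hR (f : C -> R) : (forall z, (`|f z|)%:C <= `|z|) ->
    cvgn (series (fun j => f (a j))).
  move=> hf; apply: normed_cvg.
  apply: nondecreasing_is_cvgn; first by apply: nondecreasing_series => k _ _; exact: normr_ge0.
  exists b => _ [n _ <-].
  rewrite -lecR (le_trans _ (hb n))// /series/= rmorph_sum big_mkord/=.
  exact: ler_sum.
have [hr hi] := (hR Re (@norm_Re_le), hR Im (@norm_Im_le)).
apply/cvg_ex; exists (limn (series (Re \o a)) +i* limn (series (Im \o a))).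
apply: cvgC_ReIm => /=.
  rewrite (_ : (fun _ => _) = series (Re \o a)) //.
  by apply/funext => n; rewrite /series/= Re_sum.
rewrite (_ : (fun _ => _) = series (Im \o a)) //.
by apply/funext => n; rewrite /series/= Im_sum.
Qed.

End ComplexLimits.

(** * The inner product of C^p *)

Section Cdot.
Variable R : realType.
Local Notation C := (complexC R).
Local Notation Re := (@complex.Re R).
Local Notation Im := (@complex.Im R).

Definition nsqC (z : C) : R := Re z ^+ 2 + Im z ^+ 2.

Lemma nsqC_ge0 z : 0 <= nsqC z.
Proof. by rewrite addr_ge0 ?sqr_ge0. Qed.

Lemma nsqCE z : (nsqC z)%:C = z^*%R * z.
Proof. by apply: complexP; rewrite (ReM, ImM) Re_conjC Im_conjC /= /nsqC; ring. Qed.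

Lemma nsqC_eq0 z : nsqC z = 0 -> z = 0.
Proof.
move/eqP; rewrite paddr_eq0 ?sqr_ge0// !sqrf_eq0 => /andP[/eqP a /eqP b].
exact: complexP.
Qed.

Lemma nsqCM y z : nsqC (y * z) = nsqC y * nsqC z.
Proof. by rewrite /nsqC ReM ImM; ring. Qed.

Lemma normC_le (z : C) (b : R) : 0 <= b -> nsqC z <= b ^+ 2 -> `|z| <= b%:C.
Proof.
move=> b0 h; rewrite normc_def lecR -(ger0_norm b0) -sqrtr_sqr ler_sqrt//.
exact: sqr_ge0.
Qed.

(** Discriminant argument along real multiples of the conjugate of [c]. Stated for abstract [a],
    [b], [c], so that it serves finite sums and l^2 alike. *)
Lemma cs_ineq (a b : R) (c : C) : 0 <= b ->
  (forall t : C, 0 <= a + 2 * Re (t * c) + nsqC t * b) -> nsqC c <= a * b.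
Proof.
move=> b0 h; set n := nsqC c; have n0 : 0 <= n by exact: nsqC_ge0.
have {}h (s : R) : 0 <= a + 2 * s * n + s ^+ 2 * n * b.
  have := h (s%:C * c^*%R); rewrite !(ReM, ImM) Re_conjC Im_conjC /nsqC !(ReM, ImM).
  rewrite Re_conjC Im_conjC /=; set g := (X in 0 <= X -> _).
  by rewrite (_ : g = a + 2 * s * n + s ^+ 2 * n * b)// /g /n /nsqC; ring.
have a0 : 0 <= a by have := h 0; set g := (X in 0 <= X -> _);
  rewrite (_ : g = a)//; rewrite /g; ring.
have [b_0|bn0] := eqVneq b 0.
  rewrite b_0 mulr0 leNgt; apply/negP => n1.
  (* For [b = 0] the expression is affine in [s]; this [s] makes it equal to -1. *)
  have := h (- (a + 1) / (2 * n)); rewrite leNgt => /negP; apply.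
  have nn0 : n != 0 by rewrite gt_eqF.
  rewrite b_0 (_ : a + _ + _ = -1) ?ltrN10//.
  by field.
have b1 : 0 < b by rewrite lt_neqAle eq_sym bn0.
have := h (- b^-1).
rewrite (_ : _ + _ = (a * b - n) / b); last by field.
by rewrite pmulr_lge0 ?invr_gt0// subr_ge0.
Qed.

Variable p : nat.
Implicit Types (u v w : 'cV[C]_p).

Lemma cdotE u v : cdot u v = \sum_i (v i 0)^*%R * u i 0.
Proof. by rewrite /cdot mxE; apply: eq_bigr => i _; rewrite !mxE. Qed.

Lemma cdotDl u v w : cdot (u + v) w = cdot u w + cdot v w.
Proof. by rewrite /cdot mulmxDr mxE. Qed.
Lemma cdotZl a u w : cdot (a *: u) w = a * cdot u w.
Proof. by rewrite /cdot -scalemxAr mxE. Qed.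
Lemma cdotNl u w : cdot (- u) w = - cdot u w.
Proof. by rewrite -scaleN1r cdotZl mulN1r. Qed.
Lemma cdotBl u v w : cdot (u - v) w = cdot u w - cdot v w.
Proof. by rewrite cdotDl cdotNl. Qed.
Lemma cdotC u v : (cdot u v)^*%R = cdot v u.
Proof.
rewrite !cdotE rmorph_sum; apply: eq_bigr => i _.
by rewrite rmorphM /= conjCK mulrC.
Qed.
Lemma cdotDr u v w : cdot u (v + w) = cdot u v + cdot u w.
Proof. by rewrite -cdotC cdotDl rmorphD /= !cdotC. Qed.
Lemma cdotZr a u w : cdot u (a *: w) = a^*%R * cdot u w.
Proof. by rewrite -cdotC cdotZl rmorphM /= !cdotC. Qed.
Lemma cdotNr u w : cdot u (- w) = - cdot u w.
Proof. by rewrite -cdotC cdotNl rmorphN /= cdotC. Qed.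
Lemma cdotBr u v w : cdot u (v - w) = cdot u v - cdot u w.
Proof. by rewrite cdotDr cdotNr. Qed.
Lemma cdot0l w : cdot 0 w = 0.
Proof. by rewrite -(scale0r w) cdotZl mul0r. Qed.
Lemma cdot0r w : cdot w 0 = 0.
Proof. by rewrite -cdotC cdot0l rmorph0. Qed.
Lemma cdot_suml (I : Type) (r : seq I) (P : pred I) (F : I -> 'cV[C]_p) w :
  cdot (\sum_(i <- r | P i) F i) w = \sum_(i <- r | P i) cdot (F i) w.
Proof. by elim/big_rec2: _ => [|i y x _ <-]; rewrite ?cdot0l// cdotDl. Qed.
Lemma cdot_sumr (I : Type) (r : seq I) (P : pred I) (F : I -> 'cV[C]_p) w :
  cdot w (\sum_(i <- r | P i) F i) = \sum_(i <- r | P i) cdot w (F i).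
Proof. by elim/big_rec2: _ => [|i y x _ <-]; rewrite ?cdot0r// cdotDr. Qed.

(** Norms are kept squared and real-valued, so that estimates become polynomial inequalities over
    [R] without square roots. *)
Definition nn u : R := Re (cdot u u).

Lemma nnE u : nn u = \sum_i nsqC (u i 0).
Proof.
rewrite /nn cdotE Re_sum; apply: eq_bigr => i _.
by rewrite -nsqCE.
Qed.
Lemma nn_ge0 u : 0 <= nn u.
Proof. by rewrite nnE sumr_ge0// => i _; exact: nsqC_ge0. Qed.
Lemma cdot_nn u : cdot u u = (nn u)%:C.
Proof.
rewrite nnE cdotE rmorph_sum; apply: eq_bigr => i _ /=.
by rewrite nsqCE.
Qed.
Lemma nn_eq0 u : nn u = 0 -> u = 0.
Proof.
rewrite nnE => /eqP; rewrite psumr_eq0; last by move=> i _; exact: nsqC_ge0.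
move=> /allP h; apply/matrixP => i j; rewrite (ord1 j) mxE.
by apply: nsqC_eq0; apply/eqP/h/mem_index_enum.
Qed.
Lemma nn0 : nn 0 = 0. Proof. by rewrite /nn cdot0l. Qed.
Lemma nnZ a u : nn (a *: u) = nsqC a * nn u.
Proof. by rewrite !nnE mulr_sumr; apply: eq_bigr => i _; rewrite mxE nsqCM. Qed.
Lemma nnN u : nn (- u) = nn u.
Proof. by rewrite /nn cdotNl cdotNr opprK. Qed.
Lemma nnDZ u v t : nn (u + t *: v) = nn u + 2 * Re (t * cdot v u) + nsqC t * nn v.
Proof.
rewrite {1}/nn cdotDl !cdotDr cdotZl !cdotZr cdotZl.
rewrite -[in RHS]nnZ /nn cdotZl cdotZr -(cdotC v u) !(ReD, ReM, ImM, Re_conjC, Im_conjC).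
move: (cdot u u) (cdot v u) (cdot v v) => a b c.
move: (Re a) (Re b) (Im b) (Re c) (Im c) (Re t) (Im t) => ? ? ? ? ? ? ?; ring.
Qed.
Lemma nnD u v : nn (u + v) = nn u + 2 * Re (cdot v u) + nn v.
Proof.
by have := nnDZ u v 1; rewrite scale1r mul1r => ->; rewrite /nsqC expr1n expr0n addr0 mul1r.
Qed.
Lemma nnD_le u v : nn (u + v) <= 2 * nn u + 2 * nn v.
Proof.
have := nn_ge0 (u - v); rewrite nnD cdotNl nnN nnD ReN.
move: (nn u) (nn v) (Re _) => ? ? ?; lra.
Qed.
Lemma nnB_le u v : nn (u - v) <= 2 * nn u + 2 * nn v.
Proof. by rewrite (le_trans (nnD_le _ _))// nnN. Qed.

Lemma sum_cs (I : Type) (r : seq I) (u v : I -> 'cV[C]_p) :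
  nsqC (\sum_(j <- r) cdot (u j) (v j)) <=
  (\sum_(j <- r) nn (u j)) * (\sum_(j <- r) nn (v j)).
Proof.
rewrite mulrC; apply: cs_ineq; first by apply: sumr_ge0 => i _; exact: nn_ge0.
move=> t; rewrite mulr_sumr Re_sum !mulr_sumr -!big_split sumr_ge0//= => i _.
by rewrite -nnDZ nn_ge0.
Qed.

Lemma cdot_cs u v : nsqC (cdot u v) <= nn u * nn v.
Proof. by have := sum_cs [:: tt] (fun=> u) (fun=> v); rewrite !big_seq1. Qed.

Lemma cdot_norm_le u v : `|cdot u v| <= (nn u + nn v)%:C.
Proof.
have [u0 v0] := (nn_ge0 u, nn_ge0 v).
apply: normC_le; first by rewrite addr_ge0.
apply: (le_trans (cdot_cs _ _)); move: (nn u) (nn v) u0 v0 => a b ? ?; nra.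
Qed.

(** The squared Hilbert-Schmidt norm, in place of the operator norm: it bounds [nn (A *m u)] and
    splits into columns, so that summability of a matrix sequence can be tested column by column. *)
Definition nnM m n (A : 'M[C]_(m, n)) : R := \sum_i \sum_j nsqC (A i j).

Lemma nnM_ge0 m n (A : 'M[C]_(m, n)) : 0 <= nnM A.
Proof. by rewrite !sumr_ge0// => i _; rewrite sumr_ge0// => j _; exact: nsqC_ge0. Qed.

End Cdot.

Section Cdot2.
Variable R : realType.
Local Notation C := (complexC R).

Lemma mulmxtC m n q (A : 'M[C]_(m, n)) (B : 'M[C]_(n, q)) :
  (A *m B)^t* = B^t* *m A^t*.
Proof. by rewrite trmx_mul map_mxM. Qed.

Lemma tCD m n (A B : 'M[C]_(m, n)) : (A + B)^t* = A^t* + B^t*.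
Proof. by apply/matrixP => i j; rewrite !mxE rmorphD. Qed.
Lemma tCN m n (A : 'M[C]_(m, n)) : (- A)^t* = - A^t*.
Proof. by apply/matrixP => i j; rewrite !mxE rmorphN. Qed.
Lemma tCB m n (A B : 'M[C]_(m, n)) : (A - B)^t* = A^t* - B^t*.
Proof. by rewrite tCD tCN. Qed.
Lemma tCZ m n a (A : 'M[C]_(m, n)) : (a *: A)^t* = a^*%R *: A^t*.
Proof. by apply/matrixP => i j; rewrite !mxE rmorphM. Qed.
Lemma tC0 m n : (0 : 'M[C]_(m, n))^t* = 0.
Proof. by apply/matrixP => i j; rewrite !mxE rmorph0. Qed.
Lemma tC1 n : (1%:M : 'M[C]_n)^t* = 1%:M.
Proof. by rewrite trmx1 map_mx1. Qed.


Lemma cdotMl m n (A : 'M[C]_(m, n)) (u : 'cV[C]_n) (v : 'cV[C]_m) :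
  cdot (A *m u) v = cdot u (A^t* *m v).
Proof. by rewrite /cdot mulmxtC trmxCK mulmxA. Qed.
Lemma cdotMr m n (A : 'M[C]_(m, n)) (u : 'cV[C]_m) (v : 'cV[C]_n) :
  cdot u (A *m v) = cdot (A^t* *m u) v.
Proof. by rewrite cdotMl trmxCK. Qed.

Lemma nn_mulmx_le m n (A : 'M[C]_(m, n)) (u : 'cV[C]_n) :
  nn (A *m u) <= nnM A * nn u.
Proof.
rewrite nnE mulr_suml; apply: ler_sum => i _.
rewrite (_ : (A *m u) i 0 = cdot u ((row i A)^t*)); last first.
  by rewrite /cdot trmxCK !mxE; apply: eq_bigr => j _; rewrite mxE.
rewrite (le_trans (cdot_cs _ _))// mulrC ler_wpM2r ?nn_ge0//.
rewrite nnE; apply: ler_sum => j _; rewrite !mxE.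
by rewrite /nsqC Re_conjC Im_conjC sqrrN.
Qed.


Lemma nnM_cols m n (A : 'M[C]_(m, n)) : nnM A = \sum_j nn (col j A).
Proof.
rewrite /nnM exchange_big; apply: eq_bigr => j _; rewrite nnE.
by apply: eq_bigr => i _; rewrite mxE.
Qed.

Lemma cdot_delta n (u : 'cV[C]_n) i : cdot u (delta_mx i 0) = u i 0.
Proof.
rewrite cdotE (bigD1 i)//= mxE !eqxx rmorph1 mul1r big1 ?addr0// => j ji.
by rewrite mxE (negbTE ji) rmorph0 mul0r.
Qed.

Lemma cdot_ext n (u v : 'cV[C]_n) : (forall w, cdot u w = cdot v w) -> u = v.
Proof.
move=> h; apply/matrixP => i j; rewrite (ord1 j).
by have := h (delta_mx i 0); rewrite !cdot_delta.
Qed.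

End Cdot2.

Lemma sum_ord_cat (V : nmodType) (f : nat -> V) a b : (a <= b)%N ->
  \sum_(j < b) f j = \sum_(j < a) f j + \sum_(a <= j < b) f j.
Proof. by move=> ab; rewrite -!(big_mkord xpredT f) -big_cat_nat. Qed.

Lemma ler_sum_ord (R : numDomainType) (f : nat -> R) a b :
  (forall j, 0 <= f j) -> (a <= b)%N -> \sum_(j < a) f j <= \sum_(j < b) f j.
Proof. by move=> f0 ab; rewrite (sum_ord_cat _ ab) lerDl sumr_ge0. Qed.

(** * The space l^2_p *)

Section L2space.
Variable R : realType.
Local Notation C := (complexC R).
Local Notation Re := (@complex.Re R).
Local Notation Im := (@complex.Im R).
Variable p : nat.
Implicit Types u v w : nat -> 'cV[C]_p.

Lemma l2P u : l2 u <-> exists b : R, forall n, \sum_(j < n) nn (u j) <= b.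
Proof.
split=> [h|[b hb]].
  have /cvgC_Re hr := h.
  exists (Re (limn (series (fun j => cdot (u j) (u j))))) => n.
  have ser m : Re (series (fun j => cdot (u j) (u j)) m) = \sum_(j < m) nn (u j).
    by rewrite /series/= big_mkord Re_sum.
  have nd : nondecreasing_seq (fun m => Re (series (fun j => cdot (u j) (u j)) m)).
    move=> a b ab; rewrite !ser; apply: (@ler_sum_ord R (fun j => nn (u j))) => // j; exact: nn_ge0.
  have := nondecreasing_cvgn_le nd (cvgP _ hr) n.
  by rewrite (cvg_lim _ hr)//= ser.
apply: absbounded_cvg; exists b => n.
rewrite (_ : \sum_(j < n) _ = (\sum_(j < n) nn (u j))%:C) ?lecR//.
rewrite rmorph_sum; apply: eq_bigr => j _ /=.
by rewrite cdot_nn ger0_norm// lecR nn_ge0.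
Qed.

Lemma l2_comb (a : C) u v : l2 u -> l2 v -> l2 (a *: u + v).
Proof.
move=> /l2P[b hb] /l2P[c hc]; apply/l2P.
exists (2 * (nsqC a * b) + 2 * c) => n.
apply: (@le_trans _ _ (\sum_(j < n) (2 * (nsqC a * nn (u j)) + 2 * nn (v j)))).
  by apply: ler_sum => j _; rewrite (le_trans (nnD_le _ _))// nnZ.
rewrite big_split/= -!mulr_sumr; apply: lerD; rewrite ler_wpM2l//.
  by apply: ler_wpM2l; [exact: nsqC_ge0|exact: hb].
exact: hc.
Qed.

Lemma l2_fin u N : (forall j, (N <= j)%N -> u j = 0) -> l2 u.
Proof.
move=> hu; apply/l2P; exists (\sum_(j < N) nn (u j)) => n.
have [nN|/ltnW Nn] := leqP n N.
  by apply: (@ler_sum_ord R (fun j => nn (u j))) => // j; exact: nn_ge0.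
rewrite (@sum_ord_cat _ (fun j => nn (u j)) _ _ Nn) gerDl big_nat_cond big1//.
by move=> i /andP[/andP[Ni _] _]; rewrite hu// nn0.
Qed.

Lemma l2_0 : l2 (0 : nat -> 'cV[C]_p).
Proof. exact: (@l2_fin _ 0). Qed.
Lemma l2D u v : l2 u -> l2 v -> l2 (u + v).
Proof. by move=> hu hv; have := @l2_comb 1 u v hu hv; rewrite scale1r. Qed.
Lemma l2Z a u (hu : l2 u) : l2 (a *: u).
Proof. by have := @l2_comb a u 0 hu l2_0; rewrite addr0. Qed.
Arguments l2Z a [u] hu.
Lemma l2N u : l2 u -> l2 (- u).
Proof. by rewrite -scaleN1r; exact: l2Z. Qed.
Lemma l2B u v : l2 u -> l2 v -> l2 (u - v).
Proof. by move=> hu /l2N; exact: l2D. Qed.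

Lemma cvg_inner u v : l2 u -> l2 v ->
  series (fun j => cdot (u j) (v j)) @ \oo --> inner u v.
Proof.
move=> /l2P[b hb] /l2P[c hc]; apply: absbounded_cvg.
exists (b + c) => n; rewrite (@le_trans _ _ ((\sum_(j < n) nn (u j) + \sum_(j < n) nn (v j))%:C))//.
  rewrite rmorphD !rmorph_sum -big_split; apply: ler_sum => j _ /=.
  by rewrite -rmorphD; exact: cdot_norm_le.
by rewrite lecR lerD.
Qed.

Lemma inner_unique u v l : series (fun j => cdot (u j) (v j)) @ \oo --> l ->
  inner u v = l.
Proof. by move=> h; apply: cvg_lim. Qed.

Lemma innerC u v : l2 u -> l2 v -> (inner u v)^*%R = inner v u.
Proof.
move=> hu hv; apply/esym/inner_unique.
rewrite (_ : series _ = fun n => (series (fun j => cdot (u j) (v j)) n)^*%R).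
  by apply: cvg_conjC; exact: cvg_inner.
by apply/funext => n; rewrite /series/= rmorph_sum; apply: eq_bigr => i _; exact: esym (cdotC _ _).
Qed.

Lemma innerDl u v w : l2 u -> l2 v -> l2 w -> inner (u + v) w = inner u w + inner v w.
Proof.
move=> hu hv hw; apply: inner_unique.
rewrite (_ : series _ = series (fun j => cdot (u j) (w j)) \+ series (fun j => cdot (v j) (w j))).
  by apply: cvgD; exact: cvg_inner.
by apply/funext => n; rewrite /series/= -big_split; apply: eq_bigr => i _; rewrite cdotDl.
Qed.

Lemma innerZl a u w : l2 u -> l2 w -> inner (a *: u) w = a * inner u w.
Proof.
move=> hu hw; apply: inner_unique.
rewrite (_ : series _ = cst a \* series (fun j => cdot (u j) (w j))).
  by apply: cvgM; [exact: cvg_cst|exact: cvg_inner].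
by apply/funext => n; rewrite /series/= mulr_sumr; apply: eq_bigr => i _; rewrite cdotZl.
Qed.
Lemma innerNl u w : l2 u -> l2 w -> inner (- u) w = - inner u w.
Proof. by move=> hu hw; rewrite -scaleN1r (innerZl _ hu hw) mulN1r. Qed.
Lemma innerBl u v w : l2 u -> l2 v -> l2 w -> inner (u - v) w = inner u w - inner v w.
Proof. by move=> hu hv hw; rewrite (innerDl hu (l2N hv) hw) (innerNl hv hw). Qed.
Lemma innerDr u v w : l2 u -> l2 v -> l2 w -> inner w (u + v) = inner w u + inner w v.
Proof.
move=> hu hv hw; rewrite -(innerC (l2D hu hv) hw) (innerDl hu hv hw) rmorphD.
by congr (_ + _); apply: innerC.
Qed.
Lemma innerZr a u w : l2 u -> l2 w -> inner w (a *: u) = a^*%R * inner w u.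
Proof.
move=> hu hw; rewrite -(innerC (l2Z a hu) hw) (innerZl a hu hw) rmorphM.
by congr (_ * _); apply: innerC.
Qed.
Lemma innerNr u w : l2 u -> l2 w -> inner w (- u) = - inner w u.
Proof. by move=> hu hw; rewrite -scaleN1r (innerZr _ hu hw) rmorphN1 mulN1r. Qed.
Lemma innerBr u v w : l2 u -> l2 v -> l2 w -> inner w (u - v) = inner w u - inner w v.
Proof. by move=> hu hv hw; rewrite (innerDr hu (l2N hv) hw) (innerNr hv hw). Qed.

Lemma innerBB u v u' v' : l2 u -> l2 v -> l2 u' -> l2 v' ->
  inner (u - v) (u' - v') = inner u u' - inner u v' - (inner v u' - inner v v').
Proof.
move=> hu hv hu' hv'.
by rewrite (innerBl hu hv (l2B hu' hv')) (innerBr hu' hv' hu) (innerBr hu' hv' hv).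
Qed.

Definition nnl u : R := Re (inner u u).

Lemma nnl_cvg u : l2 u -> (fun n => \sum_(j < n) nn (u j)) @ \oo --> nnl u.
Proof.
move=> hu; rewrite (_ : (fun n => \sum_(j < n) nn (u j)) =
  fun n => Re (series (fun j => cdot (u j) (u j)) n)).
  by apply: cvgC_Re; exact: cvg_inner.
by apply/funext => n; rewrite /series/= Re_sum big_mkord.
Qed.

Lemma inner_nnl u : l2 u -> inner u u = (nnl u)%:C.
Proof.
move=> hu; apply: complexP => //=.
by have := congr1 Im (innerC hu hu); rewrite Im_conjC; lra.
Qed.

Lemma nnl_sum_le u n : l2 u -> \sum_(j < n) nn (u j) <= nnl u.
Proof.
move=> hu; have h := nnl_cvg hu.
rewrite -(cvg_lim _ h)//.
apply: (@nondecreasing_cvgn_le _ (fun n => \sum_(j < n) nn (u j))); last exact: cvgP h.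
by move=> a b ab; apply: (@ler_sum_ord R (fun j => nn (u j))) => // j; exact: nn_ge0.
Qed.

Lemma nnl_le u b : (forall n, \sum_(j < n) nn (u j) <= b) -> l2 u /\ nnl u <= b.
Proof.
move=> hb; have hu : l2 u by apply/l2P; exists b.
split=> //; have h := nnl_cvg hu; rewrite -(cvg_lim _ h)//.
by apply: limr_le; [exact: cvgP h | near=> n; exact: hb].
Unshelve. all: by end_near. Qed.

Lemma nnl_ge0 u : l2 u -> 0 <= nnl u.
Proof. by move=> /(@nnl_sum_le u 0); rewrite big_ord0. Qed.

Lemma nn_le_nnl u j : l2 u -> nn (u j) <= nnl u.
Proof.
move=> /(@nnl_sum_le u j.+1); apply: le_trans; rewrite big_ord_recr/= lerDr.
by rewrite sumr_ge0// => i _; exact: nn_ge0.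
Qed.

Lemma nnl_eq0 u : l2 u -> nnl u = 0 -> u = 0.
Proof.
move=> hu h; apply/funext => j; apply: nn_eq0; apply/eqP.
by rewrite eq_le nn_ge0 andbT -h nn_le_nnl.
Qed.

Lemma l2normE u : l2 u -> l2norm u = (Num.sqrt (nnl u))%:C.
Proof.
move=> hu; rewrite /l2norm inner_nnl//.
apply/eqP; rewrite -(eqrXn2 (n := 2))//.
- by rewrite sqrtCK -rmorphXn/= sqr_sqrtr// nnl_ge0.
- by rewrite sqrtC_ge0 lecR nnl_ge0.
- by rewrite lecR sqrtr_ge0.
Qed.

Lemma nnlZ a u : l2 u -> nnl (a *: u) = nsqC a * nnl u.
Proof.
move=> hu; rewrite /nnl (innerZl a hu (l2Z a hu)) (innerZr a hu hu).
by rewrite mulrA [a * _]mulrC -nsqCE (inner_nnl hu) -rmorphM.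
Qed.
Lemma nnlN u : l2 u -> nnl (- u) = nnl u.
Proof.
by move=> hu; rewrite /nnl (innerNl hu (l2N hu)) (innerNr hu hu) opprK.
Qed.

Lemma nnlD u v : l2 u -> l2 v -> nnl (u + v) = nnl u + 2 * Re (inner v u) + nnl v.
Proof.
move=> hu hv; rewrite /nnl (innerDl hu hv (l2D hu hv)).
rewrite (innerDr hu hv hu) (innerDr hu hv hv).
have E : Re (inner u v) = Re (inner v u) by rewrite -(innerC hv hu) Re_conjC.
move: E; move: (inner u u) (inner u v) (inner v u) (inner v v) => a b c d E.
by rewrite !ReD E; move: (Re a) (Re c) (Re d) => ? ? ?; ring.
Qed.
Lemma nnlD_le u v : l2 u -> l2 v -> nnl (u + v) <= 2 * nnl u + 2 * nnl v.
Proof.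
move=> hu hv; have := nnl_ge0 (l2B hu hv); have hv' := l2N hv.
rewrite (nnlD hu hv') (nnlD hu hv) (innerNl hv hu) (nnlN hv) ReN.
by move: (nnl u) (nnl v) (Re _) => ? ? ?; lra.
Qed.
Lemma inner_cs u v : l2 u -> l2 v -> nsqC (inner u v) <= nnl u * nnl v.
Proof.
move=> hu hv; rewrite mulrC; apply: cs_ineq; first exact: nnl_ge0.
move=> t; have ht := l2Z t hu; rewrite -(nnlZ t hu) -(innerZl t hu hv) -(nnlD hv ht).
by apply: nnl_ge0; exact: l2D.
Qed.

Lemma inner0l u : inner 0 u = 0.
Proof.
apply: inner_unique; rewrite (_ : series _ = cst 0); first exact: cvg_cst.
by apply/funext => n; rewrite /series/= big1// => i _; rewrite cdot0l.
Qed.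
Lemma inner0r u : inner u 0 = 0.
Proof.
apply: inner_unique; rewrite (_ : series _ = cst 0); first exact: cvg_cst.
by apply/funext => n; rewrite /series/= big1// => i _; rewrite cdot0r.
Qed.

Lemma inner_fin u v N : (forall j, (N <= j)%N -> u j = 0) ->
  inner u v = \sum_(j < N) cdot (u j) (v j).
Proof.
move=> hu; apply: inner_unique.
apply: cvg_near_cst; near=> n.
have Nn : (N <= n)%N by near: n; exact: nbhs_infty_ge.
rewrite /series/= big_mkord (@sum_ord_cat _ (fun j => cdot (u j) (v j)) _ _ Nn).
rewrite big_nat_cond [X in _ + X]big1 ?addr0// => i /andP[/andP[Ni _] _].
by rewrite hu// cdot0l.
Unshelve. all: by end_near. Qed.

End L2space.

(** * Solutions of the Jacobi recurrence *)

Ltac mx_abel :=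
  repeat match goal with |- context [?X *m ?Y] => move: (X *m Y) => ? end;
  apply/matrixP => ? ?; rewrite !mxE; ring.

(** The recurrence acts from the left, the coefficients [r], [s] from the right. Used with matrices
    [r], [s] for the kernel [wron], and with vectors for the representation of a sequence [u]. *)
Lemma mul_pair_rec (K : comNzRingType) n
    (b x y q2 q1 q0 p2 p1 p0 : 'M[K]_n) m (r s : 'M[K]_(n, m)) :
  b *m q2 = x *m q1 - y *m q0 -> b *m p2 = x *m p1 - y *m p0 ->
  b *m (q2 *m r - p2 *m s) =
  x *m (q1 *m r - p1 *m s) - y *m (q0 *m r - p0 *m s).
Proof.
move=> hq hp; rewrite mulmxBr !mulmxA hq hp !mulmxBl !mulmxBr !mulmxA.
mx_abel.
Qed.

Ltac gen_cdot :=
  repeat match goal with |- context [cdot ?a ?b] => move: (cdot a b) => ? end.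

(** One step of summation by parts: [au], [bu], [av], [bv] are accumulated boundary data, [f] and
    [g] the new source terms. The terms linear in [f] or [g] give the increment; the term containing
    both carries the vanishing Wronskian. *)
Lemma green_step (R : realType) n
    (P Q P' Q' : 'M[complexC R]_n)
    (au bu av bv f g u v : 'cV[complexC R]_n) :
  u = Q *m au - P *m bu -> v = Q' *m av - P' *m bv ->
  Q *m P'^t* - P *m Q'^t* = 0 ->
  cdot (bu + Q'^t* *m f) (av + P^t* *m g) - cdot (au + P'^t* *m f) (bv + Q^t* *m g)
  = cdot bu av - cdot au bv + (cdot f v - cdot u g).
Proof.
move=> -> ->.
have hP a b : cdot (P'^t* *m a) b = cdot a (P' *m b) by rewrite cdotMl trmxCK.
have hQ a b : cdot (Q'^t* *m a) b = cdot a (Q' *m b) by rewrite cdotMl trmxCK.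
have hP' a b : cdot a (P^t* *m b) = cdot (P *m a) b by rewrite cdotMr trmxCK.
have hQ' a b : cdot a (Q^t* *m b) = cdot (Q *m a) b by rewrite cdotMr trmxCK.
move: (P'^t*) (Q'^t*) (P^t*) (Q^t*) hP hQ hP' hQ' => Ps Qs Pt Qt hP hQ hP' hQ' hw.
rewrite !cdotDl !cdotDr !cdotNl !cdotNr !hP' !hQ' !hP !hQ.
have : cdot ((Q *m Ps - P *m Qs) *m f) g = 0 by rewrite hw mul0mx cdot0l.
rewrite mulmxBl cdotBl -!mulmxA => /eqP; rewrite subr_eq0 => /eqP.
gen_cdot; move=> ->; ring.
Qed.

Section Symplectic.
Variable R : realType.
Local Notation C := (complexC R).
Variables (p : nat) (A B : nat -> 'M[C]_p) (P Q : C -> nat -> 'M[C]_p) (cj : C -> C).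
Hypothesis hA : forall j, (A j)^t* = A j.
Hypothesis hB : forall j, B j \in unitmx.
Hypothesis cjK : involutive cj.
Hypothesis tC_shift : forall z j, (z%:M - A j)^t* = (cj z)%:M - A j.
Hypothesis P_0 : forall z, P z 0 = 1%:M.
Hypothesis Q_0 : forall z, Q z 0 = 0.
Hypothesis P_1 : forall z, P z 1 = invmx (B 0) *m (z%:M - A 0).
Hypothesis Q_1 : forall z, Q z 1 = invmx (B 0).
Hypothesis P_rec : forall z n,
  B n.+1 *m P z n.+2 = (z%:M - A n.+1) *m P z n.+1 - (B n)^t* *m P z n.
Hypothesis Q_rec : forall z n,
  B n.+1 *m Q z n.+2 = (z%:M - A n.+1) *m Q z n.+1 - (B n)^t* *m Q z n.

(** The variation-of-constants kernel: a source [f n] contributes [wron z m n *m f n] to the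
    solution at a later site [m]. The second factors are taken at the conjugate parameter so that
    adjunction exchanges [m] and [n]. *)
Definition wron z m n : 'M[C]_p :=
  Q z m *m (P (cj z) n)^t* - P z m *m (Q (cj z) n)^t*.

Lemma wron_tC z m n : (wron z m n)^t* = - wron (cj z) n m.
Proof. by rewrite /wron tCB !mulmxtC !trmxCK cjK opprB. Qed.

Lemma wron_rec z n k :
  B n.+1 *m wron z n.+2 k = (z%:M - A n.+1) *m wron z n.+1 k - (B n)^t* *m wron z n k.
Proof.
exact: mul_pair_rec.
Qed.

Lemma tC_inv (M : 'M[C]_p) : (invmx M)^t* = invmx (M^t*).
Proof. by rewrite trmx_inv map_invmx. Qed.

Lemma unit_tC (M : 'M[C]_p) : M \in unitmx -> M^t* \in unitmx.
Proof. by rewrite map_unitmx unitmx_tr. Qed.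

(** The recurrence moves the first index only. Adjunction moves the second one but replaces [z] by
    [cj z], whence the quantification over [z] inside the induction. *)
Lemma wron_spec n : forall z,
  [/\ wron z n n = 0, wron z n.+1 n.+1 = 0 & wron z n.+1 n = invmx (B n)].
Proof.
elim: n => [|n IH] z.
  split; rewrite /wron ?P_0 ?Q_0 ?P_1 ?Q_1.
  - by rewrite mul0mx tC0 mulmx0 subrr.
  - by rewrite mulmxtC tC_shift cjK mulmxA subrr.
  - by rewrite tC0 mulmx0 subr0 tC1 mulmx1.
have [a0 a1 b0] := IH z.
have c0 w : wron w n n.+1 = - (invmx (B n))^t*.
  have [_ _ <-] := IH (cj w); by rewrite wron_tC cjK opprK.
have G w : wron w n.+2 n.+1 = invmx (B n.+1).
  have [_ w1 _] := IH w.
  apply: (can_inj (mulKmx (hB n.+1))); rewrite mulmxV// wron_rec w1 c0.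
  by rewrite mulmx0 sub0r mulmxN opprK tC_inv mulmxV// unit_tC.
split; [exact: a1| |exact: G].
have E k m : wron z k m = - (wron (cj z) m k)^t* by rewrite wron_tC cjK opprK.
have H : wron (cj z) n.+2 n =
    invmx (B n.+1) *m (((cj z)%:M - A n.+1) *m invmx (B n)).
  have [w0 _ w1] := IH (cj z).
  apply: (can_inj (mulKmx (hB n.+1))); rewrite mulKVmx// wron_rec w0 w1.
  by rewrite mulmx0 subr0.
apply: (can_inj (mulKmx (hB n.+1))); rewrite mulmx0 wron_rec.
rewrite (E n) H (E n.+1) (G (cj z)) !mulmxtC tC_shift cjK.
rewrite !mulmxN opprK !tC_inv !mulmxA mulmxV ?unit_tC// mul1mx.
by rewrite addNr.
Qed.

Lemma wron_diag z n : wron z n n = 0.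
Proof. by have [] := wron_spec n z. Qed.

Lemma wron_super z n : wron z n n.+1 = - invmx ((B n)^t*).
Proof.
have [_ _ h] := wron_spec n (cj z).
by rewrite -tC_inv -h wron_tC cjK opprK.
Qed.

Section Representation.
Variables (z : C) (u f : nat -> 'cV[C]_p).
Hypothesis u_rec0 : B 0 *m u 1%N = f 0%N + (z%:M - A 0) *m u 0%N.
Hypothesis u_rec : forall n,
  B n.+1 *m u n.+2 = f n.+1 + (z%:M - A n.+1) *m u n.+1 - (B n)^t* *m u n.

Definition alphaz n : 'cV[C]_p := \sum_(k < n) (P (cj z) k)^t* *m f k.
Definition betaz n : 'cV[C]_p := \sum_(k < n) (Q (cj z) k)^t* *m f k - u 0%N.

Lemma alphaS n : alphaz n.+1 = alphaz n + (P (cj z) n)^t* *m f n.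
Proof. by rewrite /alphaz big_ord_recr. Qed.
Lemma betaS n : betaz n.+1 = betaz n + (Q (cj z) n)^t* *m f n.
Proof. by rewrite /betaz big_ord_recr/= addrAC. Qed.

Lemma repr_step m n : Q z m *m alphaz n.+1 - P z m *m betaz n.+1 =
  Q z m *m alphaz n - P z m *m betaz n + wron z m n *m f n.
Proof.
rewrite alphaS betaS /wron; move: (_^t*) (_^t*) (Q z m) (P z m) => a b c d.
rewrite !mulmxDr mulmxBl !mulmxA opprD; mx_abel.
Qed.

Lemma three_term_repr n : u n = Q z n *m alphaz n - P z n *m betaz n.
Proof.
suff : u n = Q z n *m alphaz n - P z n *m betaz n /\
       u n.+1 = Q z n.+1 *m alphaz n.+1 - P z n.+1 *m betaz n.+1 by case.
elim: n => [|n [IH0 IH1]].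
  have e0 : u 0%N = Q z 0 *m alphaz 0 - P z 0 *m betaz 0.
    by rewrite /alphaz /betaz !big_ord0 mulmx0 sub0r P_0 mul1mx sub0r opprK.
  split; first exact: e0.
  rewrite repr_step.
  have [_ _ ->] := wron_spec 0 z.
  rewrite /alphaz /betaz !big_ord0 mulmx0 sub0r sub0r mulmxN opprK P_1.
  apply: (can_inj (mulKmx (hB 0))); rewrite mulmxDr !mulmxA mulmxV// !mul1mx.
  by rewrite addrC u_rec0.
split; first exact: IH1.
apply: (can_inj (mulKmx (hB n.+1))); rewrite u_rec.
rewrite (mul_pair_rec _ _ (Q_rec z n) (P_rec z n)).
(* Advancing the accumulators from [n] to [n.+1] adds [wron z m n *m f n] at site [m]. This vanishes
   on the diagonal; the one superdiagonal term, multiplied by the adjoint of [B n], returns the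
   source [f n.+1]. *)
have r1 : Q z n.+1 *m alphaz n.+2 - P z n.+1 *m betaz n.+2 = u n.+1.
  by rewrite repr_step wron_diag mul0mx addr0; exact/esym/IH1.
have r0 : Q z n *m alphaz n.+1 - P z n *m betaz n.+1 = u n.
  by rewrite repr_step wron_diag mul0mx addr0; exact/esym/IH0.
rewrite r1 repr_step r0 wron_super.
rewrite mulNmx mulmxBr mulmxA mulmxV ?unit_tC// mul1mx opprB.
mx_abel.
Qed.

End Representation.

(** Exact at every truncation [n]; Green's formula for the boundary triplet is its limit, and only
    the convergence of the individual sums remains to be shown. *)
Lemma green_sum z (u f v g : nat -> 'cV[C]_p) n :
  B 0 *m u 1%N = f 0%N + (z%:M - A 0) *m u 0%N ->
  (forall n, B n.+1 *m u n.+2 = f n.+1 + (z%:M - A n.+1) *m u n.+1 - (B n)^t* *m u n) ->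
  B 0 *m v 1%N = g 0%N + ((cj z)%:M - A 0) *m v 0%N ->
  (forall n, B n.+1 *m v n.+2 = g n.+1 + ((cj z)%:M - A n.+1) *m v n.+1 - (B n)^t* *m v n) ->
  \sum_(j < n) (cdot (f j) (v j) - cdot (u j) (g j)) =
  cdot (betaz z u f n) (alphaz (cj z) g n) - cdot (alphaz z f n) (betaz (cj z) v g n).
Proof.
move=> u0 u1 v0 v1; elim: n => [|n IH].
  by rewrite big_ord0 /alphaz !big_ord0 cdot0r cdot0l subrr.
rewrite big_ord_recr /= IH !alphaS !betaS cjK; apply/esym/green_step.
- exact: three_term_repr.
- exact: three_term_repr.
- exact: wron_diag.
Qed.

End Symplectic.

Section JacobiAlgebra.
Variable R : realType.
Local Notation C := (complexC R).
Variables (p : nat) (A B : nat -> 'M[C]_p).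
Hypothesis hA : forall j, (A j)^t* = A j.
Hypothesis hB : forall j, B j \in unitmx.
Implicit Types (u v : nat -> 'cV[C]_p) (z : C).
Local Notation J := (jacobi A B).
Local Notation P := (Ppoly A B).
Local Notation Q := (Qpoly A B).

Lemma P_0 z : P z 0 = 1%:M. Proof. by []. Qed.
Lemma Q_0 z : Q z 0 = 0. Proof. by []. Qed.
Lemma P_1 z : P z 1 = invmx (B 0) *m (z%:M - A 0). Proof. by []. Qed.
Lemma Q_1 z : Q z 1 = invmx (B 0). Proof. by []. Qed.

Lemma P_rec z n :
  B n.+1 *m P z n.+2 = (z%:M - A n.+1) *m P z n.+1 - (B n)^t* *m P z n.
Proof.
have := Ppoly_sol A z hB n.+1; rewrite /jacobi mulmxBl mul_scalar_mx => <-.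
by rewrite addrAC addrK addrK.
Qed.

Lemma Q_rec z n :
  B n.+1 *m Q z n.+2 = (z%:M - A n.+1) *m Q z n.+1 - (B n)^t* *m Q z n.
Proof.
have := Qpoly_sol A z hB n; rewrite /jacobi mulmxBl mul_scalar_mx => <-.
by rewrite addrAC addrK addrK.
Qed.

Lemma jacobi_is_linear (q : nat) (a : C) (U V : nat -> 'M[C]_(p, q)) :
  J (a *: U + V) = a *: J U + J V.
Proof.
have scaleE (W : nat -> 'M[C]_(p, q)) k : (a *: W) k = a *: W k by [].
have addE (W W' : nat -> 'M[C]_(p, q)) k : (W + W') k = W k + W' k by [].
apply/funext => -[|j]; rewrite addE scaleE /jacobi !addE !scaleE !mulmxDr -!scalemxAr
  !scalerDr ?scaler0 ?addr0.
  mx_abel.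
mx_abel.
Qed.

Lemma tC_shift z j : (z%:M - A j)^t* = (z^*%R)%:M - A j.
Proof. by rewrite tCB hA -scalemx1 tCZ tC1 scalemx1. Qed.

Lemma jacobi_rec0 z u : B 0 *m u 1%N = (J u 0%N - z *: u 0%N) + (z%:M - A 0) *m u 0%N.
Proof. by rewrite /jacobi mulmxBl mul_scalar_mx addr0; mx_abel. Qed.

Lemma jacobi_recS z u n :
  B n.+1 *m u n.+2 = (J u n.+1 - z *: u n.+1) + (z%:M - A n.+1) *m u n.+1 - (B n)^t* *m u n.
Proof. by rewrite /jacobi mulmxBl mul_scalar_mx; mx_abel. Qed.

Definition alpha z (f : nat -> 'cV[C]_p) n := \sum_(k < n) (P z k)^t* *m f k.
Definition beta z (f : nat -> 'cV[C]_p) n := \sum_(k < n) (Q z k)^t* *m f k.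

Lemma jacobi_repr z u f n : (forall j, J u j - z *: u j = f j) ->
  u n = Q z n *m alpha (z^*%R) f n - P z n *m (beta (z^*%R) f n - u 0%N).
Proof.
move=> hf; apply: (@three_term_repr _ _ A B P Q (@Num.conj C) hB
  conjCK tC_shift P_0 Q_0 P_1 Q_1 P_rec Q_rec z u f).
- by rewrite -hf; exact: jacobi_rec0.
- by move=> k; rewrite -hf; exact: jacobi_recS.
Qed.

Lemma jacobi_green u v n :
  \sum_(j < n) (cdot (J u j) (v j) - cdot (u j) (J v j)) =
  cdot (beta 0 (J u) n - u 0%N) (alpha 0 (J v) n) -
  cdot (alpha 0 (J u) n) (beta 0 (J v) n - v 0%N).
Proof.
have z0 : (@Num.conj C) (0 : C) = 0 by rewrite rmorph0.
have r0 (w : nat -> 'cV[C]_p) : B 0 *m w 1%N = J w 0%N + ((0 : C)%:M - A 0) *m w 0%N.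
  by have := @jacobi_rec0 0 w; rewrite scale0r subr0.
have r1 (w : nat -> 'cV[C]_p) k : B k.+1 *m w k.+2 =
    J w k.+1 + ((0 : C)%:M - A k.+1) *m w k.+1 - (B k)^t* *m w k.
  have e : J w k.+1 - 0 *: w k.+1 = J w k.+1 by rewrite scale0r subr0.
  by rewrite -[in RHS]e; exact: jacobi_recS.
have := @green_sum _ _ A B P Q (@Num.conj C) hB
  conjCK tC_shift P_0 Q_0 P_1 Q_1 P_rec Q_rec 0 u (J u) v (J v) n.
rewrite z0 => /(_ (r0 u) (r1 u) (r0 v) (r1 v)) ->.
by rewrite /alphaz /betaz /alpha /beta z0.
Qed.

Fixpoint jsol z (f : nat -> 'cV[C]_p) (a0 : 'cV[C]_p) n : 'cV[C]_p :=
  match n with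
  | 0 => a0
  | 1 => invmx (B 0) *m (f 0%N + (z%:M - A 0) *m a0)
  | (k.+1 as m).+1 => invmx (B m) *m
      (f m + (z%:M - A m) *m jsol z f a0 m - (B k)^t* *m jsol z f a0 k)
  end.

Lemma jsolP z f a0 j : J (jsol z f a0) j = f j + z *: jsol z f a0 j.
Proof.
case: j => [|j].
  have e : jsol z f a0 1 = invmx (B 0) *m (f 0%N + (z%:M - A 0) *m a0) by [].
  rewrite /jacobi e mulKVmx// mulmxBl mul_scalar_mx addr0.
  have -> : jsol z f a0 0 = a0 by [].
  mx_abel.
have e : jsol z f a0 j.+2 = invmx (B j.+1) *m (f j.+1 +
   (z%:M - A j.+1) *m jsol z f a0 j.+1 - (B j)^t* *m jsol z f a0 j) by [].
rewrite /jacobi e mulKVmx//; move: (jsol z f a0 j) (jsol z f a0 j.+1) => a b.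
rewrite mulmxBl mul_scalar_mx; mx_abel.
Qed.

(** The sum of [jacobi_green] again, now with its boundary term at the right end; suited to
    sequences that vanish there. *)
Lemma jacobi_lagrange u v n :
  \sum_(j < n.+1) (cdot (J u j) (v j) - cdot (u j) (J v j)) =
  cdot (B n *m u n.+1) (v n) - cdot (u n) (B n *m v n.+1).
Proof.
have hAs j a b : cdot (A j *m a) b = cdot a (A j *m b) by rewrite cdotMl hA.
elim: n => [|n IH].
  rewrite big_ord_recr big_ord0/= add0r /jacobi !addr0 cdotDl cdotDr hAs.
  gen_cdot; ring.
rewrite big_ord_recr/= IH /jacobi !cdotDl !cdotDr hAs.
rewrite [cdot ((B n)^t* *m _) _]cdotMl [cdot _ ((B n)^t* *m _)]cdotMr trmxCK.
gen_cdot; ring.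
Qed.

End JacobiAlgebra.

(** * Square-summable matrix sequences and a discrete Gronwall inequality *)

Section Bounds.
Variable R : realType.
Local Notation C := (complexC R).
Variable p : nat.
Implicit Types (M : nat -> 'M[C]_p) (f : nat -> 'cV[C]_p).

Lemma vec_cs n M f :
  nn (\sum_(k < n) (M k)^t* *m f k) <= (\sum_(k < n) nnM (M k)) * (\sum_(k < n) nn (f k)).
Proof.
rewrite nnE.
rewrite (eq_bigr (fun k : 'I_n => \sum_j nn (col j (M k)))); last by move=> k _; rewrite nnM_cols.
rewrite exchange_big/= mulr_suml; apply: ler_sum => i _.
have -> : (\sum_(k < n) (M k)^t* *m f k) i 0 = \sum_(k < n) cdot (f k) (col i (M k)).
  rewrite summxE; apply: eq_bigr => k _.
  by rewrite -cdot_delta cdotMl trmxCK colE.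
by rewrite mulrC; exact: sum_cs.
Qed.

Definition bddM M := exists b : R, forall n, \sum_(k < n) nnM (M k) <= b.

Lemma bddM_cols M : (forall c, l2 (fun k => M k *m c)) -> bddM M.
Proof.
move=> h.
have h' j : exists b : R, forall n, \sum_(k < n) nn (M k *m delta_mx j 0) <= b.
  by have /l2P := h (delta_mx j 0).
have [b hb] := choice h'; exists (\sum_j b j) => n.
rewrite (eq_bigr (fun k : 'I_n => \sum_j nn (col j (M k)))); last by move=> k _; rewrite nnM_cols.
rewrite exchange_big/=; apply: ler_sum => j _; apply: le_trans (hb j n).
by apply: ler_sum => k _; rewrite colE.
Qed.

Lemma bddM_l2 M c : bddM M -> l2 (fun k => M k *m c).
Proof.
move=> [b hb]; apply/l2P; exists (b * nn c) => n.
rewrite (@le_trans _ _ ((\sum_(k < n) nnM (M k)) * nn c))//; last first.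
  by rewrite ler_wpM2r ?nn_ge0.
by rewrite mulr_suml; apply: ler_sum => k _; exact: nn_mulmx_le.
Qed.

(** At each step [1 + S n] grows at most by the factor [1 + s n], which is at most [expR (s n)]. *)
Lemma discrete_gronwall (s S : nat -> R) (b : R) :
  (forall n, 0 <= s n) -> (forall n, \sum_(k < n) s k <= b) ->
  (forall n, 0 <= S n) -> (forall n, S n.+1 <= S n + s n * (1 + S n)) ->
  forall n, 1 + S n <= (1 + S 0%N) * expR b.
Proof.
move=> s0 sb S0 hS n.
apply: (@le_trans _ _ ((1 + S 0%N) * expR (\sum_(k < n) s k))).
  elim: n => [|n IH]; first by rewrite big_ord0 expR0 mulr1.
  rewrite big_ord_recr/= expRD mulrA.
  apply: (@le_trans _ _ ((1 + S n) * (1 + s n))).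
    by have := hS n; move: (S n.+1) (S n) (s n) => x y z ?; lra.
  have := expR_ge1Dx (s n); have := s0 n; have := S0 n.
  move: IH; move: (S n) (s n) (expR _ ) (_ * _) => x y z w *.
  apply: (@le_trans _ _ (w * (1 + y))); first by rewrite ler_wpM2r; lra.
  by rewrite ler_wpM2l; lra.
have S00 := S0 0%N.
by rewrite ler_wpM2l ?ler_expR//; lra.
Qed.

End Bounds.

Section LimitCircle.
Variable R : realType.
Local Notation C := (complexC R).
Local Notation Re := (@complex.Re R).
Local Notation Im := (@complex.Im R).
Variables (p : nat) (A B : nat -> 'M[C]_p).
Hypothesis hp : (0 < p)%N.
Hypothesis hA : forall j, (A j)^t* = A j.
Hypothesis hB : forall j, B j \in unitmx.
Implicit Types (u v f : nat -> 'cV[C]_p) (z : C).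
Local Notation J := (@jacobi _ p A B 1).
Local Notation P := (Ppoly A B).
Local Notation Q := (Qpoly A B).

Lemma jacobi_sol_ker z u n : J u = z *: u -> u n = P z n *m u 0%N.
Proof.
move=> hu; rewrite (@jacobi_repr _ _ A B hA hB z u 0 n); last first.
  by move=> j; rewrite hu; exact: subrr.
have e m : \sum_(k < n) (m k)^t* *m (0 : nat -> 'cV[C]_p) k = 0 :> 'cV[C]_p.
  by rewrite big1// => k _; exact: mulmx0.
have ea : alpha A B z^*%R 0 n = 0 by exact: e.
have eb : beta A B z^*%R 0 n = 0 by exact: e.
by rewrite ea eb mulmx0 sub0r sub0r mulmxN opprK.
Qed.

Lemma J_mulP z c : J (fun k => P z k *m c) = z *: (fun k => P z k *m c).
Proof.
apply/funext => k; have := Ppoly_sol A z hB k => /(congr1 (fun X => X *m c)).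
rewrite -scalemxAl => e; apply: etrans e.
by rewrite /jacobi; case: k => [|k]; rewrite !mulmxDl !mulmxA ?mul0mx.
Qed.

Definition dlt0 (d : 'cV[C]_p) : nat -> 'cV[C]_p := fun k => if k is 0 then d else 0.

Lemma J_mulQ z c : J (fun k => Q z k *m c) =
  z *: (fun k => Q z k *m c) + dlt0 c.
Proof.
have addE (W W' : nat -> 'cV[C]_p) k : (W + W') k = W k + W' k by [].
have scaleE a (W : nat -> 'cV[C]_p) k : (a *: W) k = a *: W k by [].
apply/funext => -[|k]; rewrite addE scaleE.
  have q0 : Q z 0 = 0 by [].
  have q1 : Q z 1 = invmx (B 0) by [].
  by rewrite /jacobi q0 q1 !mul0mx scaler0 mulmx0 mulKVmx// add0r !addr0.
have := Qpoly_sol A z hB k => /(congr1 (fun X => X *m c)).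
rewrite -scalemxAl => e; rewrite addr0; apply: etrans e.
by rewrite /jacobi !mulmxDl !mulmxA.
Qed.

(** A solution is determined by its initial value through [P z], so [p] independent solutions in l^2
    have initial values that span C^p. *)
Lemma ker_dim_l2 z c : dimension (ker_sub (Tmax A B) z) = (p%:R)%:E ->
  l2 (fun n => P z n *m c).
Proof.
move=> hdim.
(* [dimension] is a supremum: if all independent families had fewer than [p] members it would be at
   most [p.-1], which is below [p] since [0 < p]. *)
have [n pn [v [hv iv]]] : exists2 n, (p <= n)%N &
    exists v : 'I_n -> nat -> 'cV[C]_p,
      (forall i, ker_sub (Tmax A B) z (v i)) /\ lin_indep v.
  apply: contrapT => h.
  have : (dimension (ker_sub (Tmax A B) z) <= (p.-1%:R)%:E)%E.
    apply: ge_ereal_sup => _ [n hn <-]; rewrite lee_fin ler_nat.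
    rewrite -ltnS prednK// ltnNge; apply/negP => pn; apply: h; exists n => //.
  by rewrite hdim lee_fin ler_nat -ltnS prednK// ltnn.
have vP i k : v i k = P z k *m v i 0%N.
  by apply: jacobi_sol_ker; have [_ _ /= <-] := hv i.
pose X : 'M[C]_(n, p) := \matrix_(j, i) v j 0%N i 0.
have sumE (a : 'I_n -> C) k : (\sum_i a i *: v i) k = \sum_i a i *: v i k.
  by elim/big_rec2: _ => // i y x _ <-.
have Xa (a : 'rV[C]_n) : (a *m X)^T = \sum_i a 0 i *: v i 0%N.
  apply/matrixP => i j; rewrite (ord1 j) !mxE summxE.
  by apply: eq_bigr => k _; rewrite !mxE.
have rX : \rank X = n.
  apply/eqP; rewrite -[_ == _]/(row_free X) -kermx_eq0.
  apply/rowV0P => a /sub_kermxP aX.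
  have hs : \sum_i a 0 i *: v i = 0.
    apply/funext => k; rewrite sumE.
    rewrite (eq_bigr (fun i => P z k *m (a 0 i *: v i 0%N))); last first.
      by move=> i _; rewrite vP scalemxAr.
    by rewrite -mulmx_sumr -Xa aX trmx0 mulmx0.
  by apply/rowP => i; rewrite mxE; exact: iv hs i.
have fX : row_full X by rewrite /row_full eqn_leq rank_leq_col rX pn.
have /submxP [d hd] : (c^T <= X)%MS by exact: submx_full.
have -> : (fun k => P z k *m c) = \sum_i d 0 i *: v i.
  apply/funext => k; rewrite sumE -[c]trmxK hd Xa mulmx_sumr.
  by apply: eq_bigr => i _; rewrite -scalemxAr -vP.
elim/big_rec: _ => [|i y _ hy]; first exact: l2_0.
by have [h1 _ _] := hv i; exact: (@l2_comb R p (d 0 i) _ _ h1 hy).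
Qed.

(* At nonreal z, the solution of the truncated problem with right-hand side
   [e_0 c] and zero boundary value at [N] has norm at most [|c|]; it is a
   combination of [P z] and [Q z]. *)
Lemma Q_l2_of_P_l2 z c : Re z = 0 -> Im z ^+ 2 = 1 ->
  (forall c, l2 (fun n => P z n *m c)) -> l2 (fun n => Q z n *m c).
Proof.
move=> rez imz hP; have [b hb] := bddM_cols hP.
have b0 : 0 <= b by have := hb 0%N; rewrite big_ord0.
have lagr u N : u N.+1 = 0 ->
    \sum_(j < N.+1) (cdot (J u j) (u j) - cdot (u j) (J u j)) = 0.
  by move=> u0; rewrite jacobi_lagrange// u0 mulmx0 cdot0l cdot0r subrr.
have addE (W W' : nat -> 'cV[C]_p) k : (W + W') k = W k + W' k by [].
have scaleE a (W : nat -> 'cV[C]_p) k : (a *: W) k = a *: W k by [].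
(* The imaginary part of Lagrange's identity equates, up to sign, [Im z] times the energy with the
   imaginary part of [cdot d (u 0)]. With [Im z ^+ 2 = 1], Cauchy-Schwarz bounds the squared energy
   by [nn (u 0) * nn d], hence by the energy times [nn d]. *)
have energy u d N : J u = z *: u + dlt0 d -> u N.+1 = 0 ->
    \sum_(j < N.+1) nn (u j) <= nn d.
  move=> hu uN; have := lagr u N uN.
  rewrite big_ord_recl/= hu addE scaleE /=.
  rewrite (eq_bigr (fun j : 'I_N => (2 * Im z)*i * (nn (u j.+1))%:C)); last first.
    move=> j _; rewrite addE scaleE /= addr0 cdotZl cdotZr cdot_nn -mulrBl.
    congr (_ * _); apply: complexP; rewrite !(ReD, ImD, ReN, ImN) ?Re_conjC ?Im_conjC//=; ring.
  rewrite -mulr_sumr cdotDl cdotDr cdotZl cdotZr cdot_nn.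
  move=> /(congr1 Im); rewrite ImD ImM/= !mul0r add0r.
  rewrite (_ : Re (\sum_(i < N) (nn (u i.+1))%:C) = \sum_(i < N) nn (u i.+1)); last first.
    by rewrite Re_sum.
  rewrite [\sum_(j < N.+1) _]big_ord_recl/=.
  have [n0 nd] := (nn_ge0 (u 0%N), nn_ge0 d).
  have S0 : 0 <= \sum_(i < N) nn (u i.+1) by apply: sumr_ge0 => i _; exact: nn_ge0.
  have := cdot_cs d (u 0%N).
  rewrite -(cdotC d (u 0%N)); move: (cdot d (u 0%N)) => w.
  rewrite !(ImD, ImN, ImM, Im_conjC, Re_conjC) /= /nsqC.
  move: (Re w) (Im w) S0 n0 nd => wr wi.
  move: imz; rewrite rez; move: (Im z) (nn (u 0%N)) (\sum_(i < N) _) (nn d) => t x s y.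
  move=> t2 s0 x0 y0 hw he.
  have {}he : t * (x + s) + wi = 0 by lra.
  have h2 : (x + s) ^+ 2 = wi ^+ 2.
    have -> : (x + s) ^+ 2 = t ^+ 2 * (x + s) ^+ 2 by rewrite t2 mul1r.
    by rewrite (_ : wi = - (t * (x + s))); [ring|lra].
  have h3 : (x + s) ^+ 2 <= x * y by rewrite h2; have := sqr_ge0 wr; lra.
  have [->|xs0] := eqVneq (x + s) 0; first by [].
  have xs : 0 < x + s by rewrite lt_neqAle eq_sym xs0 addr_ge0.
  rewrite -(ler_pM2l xs) -expr2; apply: (le_trans h3).
  by rewrite ler_wpM2r// lerDl.
have comb a d : J (fun k => P z k *m a + Q z k *m d) =
    z *: (fun k => P z k *m a + Q z k *m d) + dlt0 d.
  have := jacobi_is_linear A B 1 (fun k => P z k *m a) (fun k => Q z k *m d).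
  rewrite !scale1r J_mulP J_mulQ addrA -scalerDr; exact.
(* A kernel vector [a] yields a source-free solution that starts with [a] and vanishes at [N.+1];
   its energy is zero, so [a = 0]. *)
have Punit N : P z N.+1 \in unitmx.
  rewrite -row_full_unit -cokermx_eq0; apply/eqP/matrixP => i j.
  pose a := col j (cokermx (P z N.+1)).
  have ha : P z N.+1 *m a = 0 by rewrite /a colE mulmxA mulmx_coker mul0mx.
  have d0 : dlt0 0 = 0 by apply/funext => -[].
  have hJ : J (fun k => P z k *m a) = z *: (fun k => P z k *m a) + dlt0 0.
    by rewrite J_mulP d0 addr0.
  have := energy _ 0 N hJ ha; rewrite nn0 big_ord_recl/=.
  have S0 : 0 <= \sum_(i < N) nn (P z (lift ord0 i) *m a).
    by apply: sumr_ge0 => k _; exact: nn_ge0.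
  move=> h; have : nn (P z 0 *m a) = 0.
    by apply/eqP; rewrite eq_le nn_ge0 andbT (le_trans _ h)// lerDl.
  move=> /nn_eq0; rewrite mul1mx => /matrixP/(_ i 0); by rewrite !mxE.
apply/l2P; exists (2 * nn c + 2 * (b * nn c)) => n.
apply: (@le_trans _ _ (\sum_(k < n.+1) nn (Q z k *m c))).
  by apply: (@ler_sum_ord R (fun k => nn (Q z k *m c))) => // k; exact: nn_ge0.
pose a : 'cV[C]_p := - invmx (P z n.+1) *m (Q z n.+1 *m c).
have hE : \sum_(j < n.+1) nn (P z j *m a + Q z j *m c) <= nn c.
  apply: (energy (fun k => P z k *m a + Q z k *m c)); first exact: comb.
  rewrite /a; move: (P z n.+1) (Q z n.+1) (Punit n) => X Y hX.
  by rewrite mulNmx mulmxN (mulKVmx hX) addNr.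
have ha : nn a <= nn c.
  apply: le_trans hE; rewrite big_ord_recl/= mul1mx mul0mx addr0 lerDl.
  by apply: sumr_ge0 => k _; exact: nn_ge0.
apply: (@le_trans _ _ (\sum_(k < n.+1) (2 * nn (P z k *m a + Q z k *m c) + 2 * nn (P z k *m a)))).
  by apply: ler_sum => k _; rewrite (le_trans _ (nnB_le _ _))// addrC addKr.
rewrite big_split/= -!mulr_sumr; apply: lerD; first by rewrite ler_wpM2l.
rewrite ler_wpM2l//; apply: (@le_trans _ _ (b * nn a)).
  apply: (@le_trans _ _ ((\sum_(k < n.+1) nnM (P z k)) * nn a)).
    by rewrite mulr_suml; apply: ler_sum => k _; exact: nn_mulmx_le.
  by rewrite ler_wpM2r ?nn_ge0.
by rewrite ler_wpM2l.
Qed.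

End LimitCircle.

(** * The limit-circle property *)

Section CvgVec.
Variable R : realType.
Local Notation C := (complexC R).
Variables (T : Type) (F : set_system T) (FF : Filter F).

Lemma cvg_sumC (I : Type) (r : seq I) (f : I -> T -> C) (l : I -> C) :
  (forall i, f i @ F --> l i) ->
  (fun t => \sum_(i <- r) f i t) @ F --> \sum_(i <- r) l i.
Proof.
move=> h; elim: r => [|i r IH].
  rewrite big_nil (_ : (fun _ => _) = cst 0); first exact: cvg_cst.
  by apply/funext => t; rewrite big_nil.
rewrite big_cons (_ : (fun _ => _) = f i \+ (fun t => \sum_(i <- r) f i t)).
  by apply: cvgD; [exact: h|exact: IH].
by apply/funext => t; rewrite big_cons.
Qed.

Lemma cvg_mulmx m n q (f : T -> 'M[C]_(m, n)) (g : T -> 'M[C]_(n, q))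
    (a : 'M[C]_(m, n)) (b : 'M[C]_(n, q)) :
  f @ F --> a -> g @ F --> b -> (fun t => f t *m g t) @ F --> a *m b.
Proof.
move=> /cvg_mx hf /cvg_mx hg; apply/cvg_mx => i j.
rewrite mxE (_ : (fun _ => _) = (fun t => \sum_k f t i k * g t k j)); last first.
  by apply/funext => t; rewrite mxE.
by apply: cvg_sumC => k; apply: cvgM; [exact: hf|exact: hg].
Qed.

Lemma cvg_tC m n (f : T -> 'M[C]_(m, n)) (a : 'M[C]_(m, n)) :
  f @ F --> a -> (fun t => (f t)^t*) @ F --> a^t*.
Proof.
move=> /cvg_mx hf; apply/cvg_mx => i j.
rewrite 2!mxE (_ : (fun _ => _) = (fun t => (f t j i)^*%R)); last first.
  by apply/funext => t; rewrite 2!mxE.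
exact: cvg_conjC.
Qed.

Lemma cvg_cdot p (f g : T -> 'cV[C]_p) (a b : 'cV[C]_p) :
  f @ F --> a -> g @ F --> b -> (fun t => cdot (f t) (g t)) @ F --> cdot a b.
Proof. by move=> hf hg; have /cvg_mx := cvg_mulmx (cvg_tC hg) hf; apply. Qed.

End CvgVec.

Lemma cvg_lim_mx (R : realType) m n
    (f : nat -> 'M[complexC R]_(m, n))
    (l : 'M[complexC R]_(m, n)) :
  f @ \oo --> l -> limn f = l.
Proof. by move=> h; apply: cvg_lim. Qed.

Section Indeterminate.
Variable R : realType.
Local Notation C := (complexC R).
Local Notation Re := (@complex.Re R).
Local Notation Im := (@complex.Im R).
Variables (p : nat) (A B : nat -> 'M[C]_p).
Hypothesis hp : (0 < p)%N.
Hypothesis hA : forall j, (A j)^t* = A j.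
Hypothesis hB : forall j, B j \in unitmx.
Implicit Types (u v f g : nat -> 'cV[C]_p) (z : C).
Local Notation J := (@jacobi _ p A B 1).
Local Notation P := (Ppoly A B).
Local Notation Q := (Qpoly A B).

Lemma repr_bound_alg (F : realFieldType) (b S x1 x2 x3 x4 y1 y2 y3 y4 : F) : 0 <= b -> 0 <= S ->
  y1 <= x4 * y4 -> y2 <= x3 * y3 -> y3 <= 2 * x1 + 2 * x2 -> y4 <= b * S -> x1 <= b * S ->
  0 <= x2 -> 0 <= x3 -> 0 <= x4 -> 2 * y1 + 2 * y2 <= (x3 + x4) * (4 * b * S + 4 * x2).
Proof.
move=> b0 S0 h1 h2 h3 h4 h5 h6 h7 h8.
have bS : 0 <= b * S by rewrite mulr_ge0.
have h1' : y1 <= x4 * (b * S) by apply: (le_trans h1); rewrite ler_wpM2l.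
have h2' : y2 <= x3 * (2 * (b * S) + 2 * x2).
  by apply: (le_trans h2); rewrite ler_wpM2l//; lra.
have h9 : 0 <= x4 * (b * S) by rewrite mulr_ge0.
have h10 : 0 <= x4 * x2 by rewrite mulr_ge0.
have -> : (x3 + x4) * (4 * b * S + 4 * x2) =
  2 * (x3 * (2 * (b * S) + 2 * x2)) + 4 * (x4 * (b * S)) + 4 * (x4 * x2) by ring.
lra.
Qed.

Lemma repr_bound z b : 0 <= b ->
  (forall n, \sum_(k < n) nnM (P z^*%R k) <= b) ->
  (forall n, \sum_(k < n) nnM (Q z^*%R k) <= b) ->
  forall u f, (forall j, J u j - z *: u j = f j) -> forall n,
  nn (u n) <= (nnM (P z n) + nnM (Q z n)) *
    (4 * b * (\sum_(k < n) nn (f k)) + 4 * nn (u 0%N)).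
Proof.
move=> b0 hP hQ u f hu n; rewrite [in X in X <= _](jacobi_repr hA hB n hu).
have S0 : 0 <= \sum_(k < n) nn (f k) by apply: sumr_ge0 => k _; exact: nn_ge0.
have hal : nn (alpha A B z^*%R f n) <= b * \sum_(k < n) nn (f k).
  by apply: (le_trans (vec_cs _ _ _)); apply: ler_wpM2r.
have hbe : nn (beta A B z^*%R f n) <= b * \sum_(k < n) nn (f k).
  by apply: (le_trans (vec_cs _ _ _)); apply: ler_wpM2r.
apply: (le_trans (nnB_le _ _)).
exact: (repr_bound_alg b0 S0 (nn_mulmx_le _ _) (nn_mulmx_le _ _) (nnB_le _ _) hal hbe
  (nn_ge0 _) (nnM_ge0 _) (nnM_ge0 _)).
Qed.

Definition limit_circle_at z := bddM (P z) /\ bddM (Q z).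

(** [u] solves the equation at [z0] with source [h + (z - z0) u]. The representation at [z0] bounds
    [nn (u n)] by a summable weight times an affine function of the preceding partial sum, which is
    the situation of Gronwall's inequality. The conjugate of [z0] occurs because the representation
    pairs [P z0] with [P] at the conjugate point. *)
Lemma limit_circle_l2 z0 : limit_circle_at z0 -> limit_circle_at z0^*%R ->
  forall z u h, (forall j, J u j - z *: u j = h j) -> l2 h -> l2 u.
Proof.
move=> [[b1 hb1] [b2 hb2]] [[b3 hb3] [b4 hb4]] z u h hu /l2P[c hc].
have b3_0 : 0 <= b3 by have := hb3 0%N; rewrite big_ord0.
have b4_0 : 0 <= b4 by have := hb4 0%N; rewrite big_ord0.
have c0 : 0 <= c by have := hc 0%N; rewrite big_ord0.
pose b := b3 + b4.
have b0 : 0 <= b by rewrite addr_ge0.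
have hf j : J u j - z0 *: u j = h j + (z - z0) *: u j.
  by rewrite -hu scalerBl addrA subrK.
have hb n := repr_bound b0 (fun n => le_trans (hb3 n) (ler_wpDr b4_0 (lexx _)))
   (fun n => le_trans (hb4 n) (ler_wpDl b3_0 (lexx _))) hf n.
pose s n := nnM (P z0 n) + nnM (Q z0 n).
pose S n := \sum_(k < n) nn (u k).
have s0 n : 0 <= s n by rewrite addr_ge0 ?nnM_ge0.
have S0 n : 0 <= S n by apply: sumr_ge0 => k _; exact: nn_ge0.
have d0 : 0 <= nsqC (z - z0) by exact: nsqC_ge0.
(* [K] dominates the constant term and the coefficient of [S n] at once, so that the bound takes the
   shape [s n * K * (1 + S n)]. *)
pose K := 8 * b * c + 8 * b * nsqC (z - z0) + 4 * nn (u 0%N).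
have u00 : 0 <= nn (u 0%N) by exact: nn_ge0.
have bc : 0 <= b * c by rewrite mulr_ge0.
have bd : 0 <= b * nsqC (z - z0) by rewrite mulr_ge0.
have K0 : 0 <= K by rewrite /K -!mulrA; lra.
have step n : nn (u n) <= s n * K * (1 + S n).
  apply: (le_trans (hb n)); rewrite -[s n * K * _]mulrA.
  apply: ler_wpM2l; first exact: s0.
  have hF : \sum_(k < n) nn (h k + (z - z0) *: u k) <= 2 * c + 2 * (nsqC (z - z0) * S n).
    apply: (@le_trans _ _ (\sum_(k < n) (2 * nn (h k) + 2 * (nsqC (z - z0) * nn (u k))))).
      by apply: ler_sum => k _; rewrite -nnZ; exact: nnD_le.
    rewrite big_split/= -!mulr_sumr; apply: lerD; last exact: lexx.
    by apply: ler_wpM2l => //; exact: hc.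
  have hF' : 4 * b * \sum_(k < n) nn (h k + (z - z0) *: u k) <=
      4 * b * (2 * c + 2 * (nsqC (z - z0) * S n)).
    by rewrite ler_wpM2l// mulr_ge0.
  apply: (@le_trans _ _ (4 * b * (2 * c + 2 * (nsqC (z - z0) * S n)) + 4 * nn (u 0%N))).
    by rewrite lerD2r.
  have := S0 n; rewrite /K; move: (S n) (nn (u 0%N)) (nsqC _) u00 bc bd d0 => x y w *.
  have e1 : 0 <= b * c * x by rewrite mulr_ge0.
  have e3 : 0 <= y * x by rewrite mulr_ge0.
  have -> : (8 * b * c + 8 * b * w + 4 * y) * (1 + x) =
    4 * b * (2 * c + 2 * (w * x)) + 4 * y + 8 * (b * c * x) + 8 * (b * w) + 4 * (y * x).
    by ring.
  lra.
have gr := @discrete_gronwall R (fun n => s n * K) S ((b1 + b2) * K).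
apply/l2P; exists ((1 + S 0%N) * expR ((b1 + b2) * K)) => n.
apply: le_trans (gr _ _ _ _ n).
- by rewrite lerDr.
- by move=> k; rewrite mulr_ge0.
- move=> k; rewrite -mulr_suml ler_wpM2r// /s big_split/=.
  by apply: lerD; [exact: hb1|exact: hb2].
- exact: S0.
- by move=> k; rewrite {1}/S big_ord_recr/= lerD2l.
Qed.

Lemma limit_circle_of_P z : Re z = 0 -> Im z ^+ 2 = 1 ->
  dimension (ker_sub (Tmax A B) z) = (p%:R)%:E -> limit_circle_at z.
Proof.
move=> rz iz hd.
have hP c : l2 (fun n => P z n *m c) by exact: ker_dim_l2.
split; [exact: bddM_cols hP | apply: bddM_cols => c].

exact: (@Q_l2_of_P_l2 R p A B hA hB z c rz iz hP).
Qed.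

Lemma limit_circle z : limit_circle_at z -> limit_circle_at z^*%R ->
  forall z', limit_circle_at z'.
Proof.
move=> h1 h2 z'; split; apply: bddM_cols => c.
  apply: (limit_circle_l2 h1 h2 (z := z') (h := 0)); last exact: l2_0.
  by move=> j; rewrite J_mulP//; exact: subrr.
apply: (limit_circle_l2 h1 h2 (z := z') (h := dlt0 c)).
  move=> j; rewrite J_mulQ//.
  have addE (W W' : nat -> 'cV[C]_p) k : (W + W') k = W k + W' k by [].
  by rewrite addE addrC addKr.
by apply: (@l2_fin _ _ _ 1) => -[].
Qed.

End Indeterminate.

(** * The boundary triplet *)

Arguments l2Z {R p} a [u] hu.

Section BoundaryTriplet.
Variable R : realType.
Local Notation C := (complexC R).
Variables (p : nat) (A B : nat -> 'M[C]_p).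
Hypothesis hA : forall j, (A j)^t* = A j.
Hypothesis hB : forall j, B j \in unitmx.
Hypothesis LC : forall z : C, limit_circle_at A B z.
#[local] Opaque l2 inner cdot nn nnl nnM nsqC.
Implicit Types (u v f g : nat -> 'cV[C]_p) (z : C) (a b c : 'cV[C]_p).
Local Notation J := (@jacobi _ p A B 1).
Local Notation P := (Ppoly A B 0).
Local Notation Q := (Qpoly A B 0).
Local Notation G0 := (Gamma0 A B).
Local Notation G1 := (Gamma1 A B).

Definition Pc c : nat -> 'cV[C]_p := fun k => P k *m c.
Definition Qc c : nat -> 'cV[C]_p := fun k => Q k *m c.

Lemma Pc_l2 c : l2 (Pc c).
Proof. by have [h _] := LC 0; exact: bddM_l2. Qed.
Arguments Pc_l2 c : clear implicits.
Lemma Qc_l2 c : l2 (Qc c).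
Proof. by have [_ h] := LC 0; exact: bddM_l2. Qed.

Arguments Qc_l2 c : clear implicits.

Lemma J_Pc c : J (Pc c) = 0.
Proof. by have := J_mulP A hB 0 c; rewrite scale0r. Qed.

Lemma J_linear s u v : J (s *: u + v) = s *: J u + J v.
Proof. exact: jacobi_is_linear. Qed.
Lemma JD u v : J (u + v) = J u + J v.
Proof. by have := J_linear 1 u v; rewrite !scale1r. Qed.
Lemma J0 : J 0 = 0.
Proof. by have := J_linear (-1) 0 0; rewrite scaler0 addr0 scaleN1r addNr. Qed.
Lemma JZ s u : J (s *: u) = s *: J u.
Proof. by have := J_linear s u 0; rewrite J0 !addr0. Qed.
Lemma JN u : J (- u) = - J u.
Proof. by rewrite -scaleN1r JZ scaleN1r. Qed.
Lemma JB u v : J (u - v) = J u - J v.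
Proof. by rewrite JD JN. Qed.

Lemma l2_of_shift z u : l2 (J u - z *: u) -> l2 u.
Proof.
by move=> h; apply: (limit_circle_l2 hA hB (LC 0) (LC _) (z := z) (h := J u - z *: u)).
Qed.

(** In the limit-circle case square-summability of [u] is automatic; from here on the domain of
    [Tmax] is described by [l2 (J u)]. *)
Lemma l2_of_J u : l2 (J u) -> l2 u.
Proof. by move=> h; apply: (@l2_of_shift 0); rewrite scale0r subr0. Qed.

Lemma solve z f a : l2 f -> exists u, [/\ l2 u, u 0%N = a & J u = f + z *: u].
Proof.
move=> hf; pose u := jsol A B z f a.
have hJ : J u = f + z *: u by apply/funext => j; exact: jsolP.
exists u; split; [|by []|exact: hJ].
by apply: (@l2_of_shift z); rewrite hJ addrK.
Qed.

Lemma repr0 u n : u n = Q n *m alpha A B 0 (J u) n - P n *m (beta A B 0 (J u) n - u 0%N).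
Proof.
have := @jacobi_repr _ _ A B hA hB 0 u (J u) n; rewrite rmorph0; apply=> j.
by rewrite scale0r subr0.
Qed.

Lemma norm_bound : exists2 K, 0 <= K & forall u, l2 (J u) ->
  nnl u <= K * (nnl (J u) + nn (u 0%N)).
Proof.
have [[b1 h1] [b2 h2]] := LC 0.
have b10 : 0 <= b1 by have := h1 0%N; rewrite big_ord0.
have b20 : 0 <= b2 by have := h2 0%N; rewrite big_ord0.
pose b := b1 + b2; have b0 : 0 <= b by rewrite addr_ge0.
have hb u n : nn (u n) <= (nnM (P n) + nnM (Q n)) *
    (4 * b * (\sum_(k < n) nn (J u k)) + 4 * nn (u 0%N)).
  have := @repr_bound _ _ A B hA hB 0 b b0; rewrite rmorph0; apply.
  - by move=> m; apply: (le_trans (h1 m)); rewrite lerDl.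
  - by move=> m; apply: (le_trans (h2 m)); rewrite lerDr.
  - by move=> j; rewrite scale0r subr0.
exists (b * (4 * b + 4)); first by rewrite mulr_ge0// addr_ge0// mulr_ge0.
move=> u hu.
have [F0 u0] : 0 <= nnl (J u) /\ 0 <= nn (u 0%N) by split; [exact: nnl_ge0|exact: nn_ge0].
apply: (proj2 (nnl_le _)) => n.
apply: (@le_trans _ _ (\sum_(k < n) (nnM (P k) + nnM (Q k)) * (4 * b * nnl (J u) + 4 * nn (u 0%N)))).
  apply: ler_sum => k _; apply: (le_trans (hb u k)).
  apply: ler_wpM2l; first by rewrite addr_ge0 ?nnM_ge0.
  rewrite lerD2r; apply: ler_wpM2l; first by rewrite mulr_ge0.
  exact: nnl_sum_le.
rewrite -mulr_suml big_split/=.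
have e0 : 0 <= 4 * b * nnl (J u) by rewrite !mulr_ge0.
apply: (@le_trans _ _ (b * (4 * b * nnl (J u) + 4 * nn (u 0%N)))).
  apply: ler_wpM2r; first by rewrite addr_ge0// mulr_ge0.
  by apply: lerD; [exact: h1|exact: h2].
rewrite -[b * (4 * b + 4) * _]mulrA; apply: ler_wpM2l => //.
have := mulr_ge0 b0 u0; move: (nnl _) (nn _) F0 u0 e0 => x y *.
have -> : (4 * b + 4) * (x + y) = (4 * b * x + 4 * y) + 4 * (b * y) + 4 * x by ring.
lra.
Qed.

Lemma inner_col_cvg (M : nat -> 'M[C]_p) f : bddM M -> l2 f ->
  (fun n => \sum_(k < n) (M k)^t* *m f k) @ \oo -->
  \col_i inner f (fun k => M k *m delta_mx i 0).
Proof.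
move=> hM hf; apply/cvg_mx => i j; rewrite (ord1 j) mxE.
rewrite (_ : (fun _ => _) = series (fun k => cdot (f k) (M k *m delta_mx i 0))).
  by apply: cvg_inner; [exact: hf|exact: bddM_l2].
apply/funext => n; rewrite /series/= big_mkord summxE; apply: eq_bigr => k _.
by rewrite -cdot_delta cdotMl trmxCK.
Qed.

Lemma series_ord (f : nat -> 'cV[C]_p) :
  series f = (fun n => \sum_(k < n) f k).
Proof. by apply/funext => n; rewrite /series/= big_mkord. Qed.

Lemma G0E u : l2 (J u) -> G0 u = \col_i inner (J u) (Pc (delta_mx i 0)).
Proof.
move=> hu; apply: cvg_lim_mx; rewrite series_ord.
exact: (inner_col_cvg (proj1 (LC 0)) hu).
Qed.

Lemma G1E u : l2 (J u) -> G1 u = \col_i inner (J u) (Qc (delta_mx i 0)) - u 0%N.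
Proof.
move=> hu; congr (_ - _); apply: cvg_lim_mx; rewrite series_ord.
exact: (inner_col_cvg (proj2 (LC 0)) hu).
Qed.

#[local] Opaque Gamma0 Gamma1 Ppoly Qpoly jacobi.

Lemma G0_cvg u : l2 (J u) -> alpha A B 0 (J u) @ \oo --> G0 u.
Proof. by move=> hu; rewrite (G0E hu); exact: (inner_col_cvg (proj1 (LC 0)) hu). Qed.

Lemma G1_cvg u : l2 (J u) -> (fun n => beta A B 0 (J u) n - u 0%N) @ \oo --> G1 u.
Proof.
move=> hu; rewrite (G1E hu); apply: cvgB; last exact: cvg_cst.
exact: (inner_col_cvg (proj2 (LC 0)) hu).
Qed.

Lemma cdot_col (M : nat -> 'M[C]_p) f c : bddM M -> l2 f ->
  cdot (\col_i inner f (fun k => M k *m delta_mx i 0)) c = inner f (fun k => M k *m c).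
Proof.
move=> hM hf; apply/esym/inner_unique.
rewrite (_ : series _ = fun n => cdot (\sum_(k < n) (M k)^t* *m f k) c).
  by apply: cvg_cdot; [exact: inner_col_cvg|exact: cvg_cst].
apply/funext => n; rewrite /series/= big_mkord cdot_suml; apply: eq_bigr => k _.
by rewrite cdotMl trmxCK.
Qed.

Lemma cdotG0 u c : l2 (J u) -> cdot (G0 u) c = inner (J u) (Pc c).
Proof. by move=> hu; rewrite (G0E hu) (cdot_col _ (proj1 (LC 0)) hu). Qed.

Lemma cdotG1 u c : l2 (J u) -> cdot (G1 u) c = inner (J u) (Qc c) - cdot (u 0%N) c.
Proof. by move=> hu; rewrite (G1E hu) cdotBl (cdot_col _ (proj2 (LC 0)) hu). Qed.

Lemma G0_linear s u v : l2 (J u) -> l2 (J v) -> G0 (s *: u + v) = s *: G0 u + G0 v.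
Proof.
move=> hu hv; apply: cdot_ext => w.
have huv : l2 (J (s *: u + v)) by rewrite J_linear; exact: l2_comb.
rewrite (cdotG0 w huv) cdotDl cdotZl J_linear.
rewrite (innerDl (l2Z s hu) hv (Pc_l2 w)) (innerZl s hu (Pc_l2 w)).
by congr (_ * _ + _); apply/esym/cdotG0.
Qed.

Lemma G1_linear s u v : l2 (J u) -> l2 (J v) -> G1 (s *: u + v) = s *: G1 u + G1 v.
Proof.
move=> hu hv; apply: cdot_ext => w.
have huv : l2 (J (s *: u + v)) by rewrite J_linear; exact: l2_comb.
rewrite (cdotG1 w huv) cdotDl cdotZl J_linear.
rewrite (innerDl (l2Z s hu) hv (Qc_l2 w)) (innerZl s hu (Qc_l2 w)).
rewrite cdotDl cdotZl; have e1 := cdotG1 w hu; have e2 := cdotG1 w hv.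
move: e1 e2; gen_cdot; move: (inner _ _) (inner _ _) => ? ? -> ->; ring.
Qed.

Lemma G0B u v : l2 (J u) -> l2 (J v) -> G0 (u - v) = G0 u - G0 v.
Proof.
move=> hu hv; have := G0_linear (-1) hv hu; rewrite !scaleN1r addrC => ->.
by rewrite addrC.
Qed.
Lemma G1B u v : l2 (J u) -> l2 (J v) -> G1 (u - v) = G1 u - G1 v.
Proof.
move=> hu hv; have := G1_linear (-1) hv hu; rewrite !scaleN1r addrC => ->.
by rewrite addrC.
Qed.
Lemma G0D u v : l2 (J u) -> l2 (J v) -> G0 (u + v) = G0 u + G0 v.
Proof. by move=> hu hv; have := G0_linear 1 hu hv; rewrite !scale1r. Qed.
Lemma G1D u v : l2 (J u) -> l2 (J v) -> G1 (u + v) = G1 u + G1 v.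
Proof. by move=> hu hv; have := G1_linear 1 hu hv; rewrite !scale1r. Qed.

Lemma green u v : l2 (J u) -> l2 (J v) ->
  inner (J u) v - inner u (J v) = cdot (G1 u) (G0 v) - cdot (G0 u) (G1 v).
Proof.
move=> hu hv; have [lu lv] := (l2_of_J hu, l2_of_J hv).
have h1 := cvgB (cvg_inner hu lv) (cvg_inner lu hv).
have h2 := cvgB (cvg_cdot _ (G1_cvg hu) (G0_cvg hv)) (cvg_cdot _ (G0_cvg hu) (G1_cvg hv)).
have E : series (fun j => cdot (J u j) (v j)) - series (fun j => cdot (u j) (J v j)) =
    (fun n => cdot (beta A B 0 (J u) n - u 0%N) (alpha A B 0 (J v) n)) -
    (fun n => cdot (alpha A B 0 (J u) n) (beta A B 0 (J v) n - v 0%N)).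
  apply/funext => n.
  rewrite -[RHS]/(cdot (beta A B 0 (J u) n - u 0%N) (alpha A B 0 (J v) n) -
    cdot (alpha A B 0 (J u) n) (beta A B 0 (J v) n - v 0%N)).
  rewrite -(jacobi_green hA hB) sumrB.
  by rewrite -[LHS]/(series _ n - series _ n) /series/= !big_mkord.
have {}h1 := cvg_lim (@norm_hausdorff _ _) (h1 _).
have {}h2 := cvg_lim (@norm_hausdorff _ _) (h2 _ _ _).
by rewrite -[LHS]h1 -[RHS]h2 E.
Qed.

Lemma Jl2_Pc c : l2 (J (Pc c)). Proof. by rewrite J_Pc; exact: l2_0. Qed.
Arguments Jl2_Pc c : clear implicits.

Lemma G0_Pc c : G0 (Pc c) = 0.
Proof.
apply: cdot_ext => w; rewrite cdotG0; last exact: Jl2_Pc.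
by rewrite J_Pc inner0l cdot0l.
Qed.
Lemma G1_Pc c : G1 (Pc c) = - c.
Proof.
apply: cdot_ext => w; rewrite cdotG1; last exact: Jl2_Pc.
by rewrite J_Pc inner0l sub0r -cdotNl /Pc mul1mx.
Qed.

(** [Gamma1 u] is a functional of [J u] minus [u 0], so the free initial value prescribes it. *)
Lemma solveG1 f b : l2 f -> exists u, [/\ l2 u, J u = f & G1 u = b].
Proof.
move=> hf; pose a := \col_i inner f (Qc (delta_mx i 0)) - b.
have [u [hu u0 hJ]] := @solve 0 f a hf.
have {}hJ : J u = f by rewrite hJ scale0r addr0.
have hf' : l2 (J u) by rewrite hJ.
exists u; split; [exact: hu|exact: hJ|].
by rewrite (G1E hf') hJ u0 /a opprB addrC subrK.
Qed.

(** [Gamma0] sees only [J u], and since [P_0] is the identity the source [dlt0 a] produces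
    [Gamma0 u = a]; [Gamma1] is then adjusted independently. *)
Lemma triplet_surj a b : exists u, [/\ l2 u, l2 (J u), G0 u = a & G1 u = b].
Proof.
have hf : l2 (dlt0 a) by apply: (@l2_fin _ _ _ 1) => -[].
have [u [hu hJ h1]] := solveG1 b hf.
have hf' : l2 (J u) by rewrite hJ.
exists u; split; [exact: hu|exact: hf'| |exact: h1].
apply: cdot_ext => w; rewrite (cdotG0 w hf') hJ.
rewrite (@inner_fin _ _ _ _ 1); last by case.
by rewrite big_ord_recl big_ord0 /= addr0 /Pc mul1mx.
Qed.

Lemma col_bound (M : nat -> 'M[C]_p) : bddM M -> exists2 K, 0 <= K & forall f, l2 f ->
  nn (\col_i inner f (fun k => M k *m delta_mx i 0)) <= K * nnl f.
Proof.
move=> hM; have hl i := @bddM_l2 R p M (delta_mx i 0) hM.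
exists (\sum_i nnl (fun k => M k *m delta_mx i 0)).
  by apply: sumr_ge0 => i _; exact: nnl_ge0.
move=> f hf; rewrite nnE mulr_suml; apply: ler_sum => i _.
rewrite mxE [X in _ <= X]mulrC; exact: (inner_cs hf (hl i)).
Qed.

(** On ker Gamma_1 the initial value is a bounded functional of [J u]. Together with [solveG1]: the
    restriction of [Tmax] to ker Gamma_1 has a bounded inverse. *)
Lemma norm_bound1 : exists2 K, 0 <= K & forall u, l2 (J u) -> G1 u = 0 ->
  nnl u <= K * nnl (J u).
Proof.
have [K K0 hK] := norm_bound.
have [K' K'0 hK'] := col_bound (proj2 (LC 0)).
exists (K * (1 + K')); first by rewrite mulr_ge0// addr_ge0.
move=> u hu /eqP; rewrite (G1E hu) subr_eq0 => /eqP e.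
apply: (le_trans (hK _ hu)); rewrite -[K * _ * _]mulrA ler_wpM2l// mulrDl mul1r lerD2l -e.
exact: hK'.
Qed.

Lemma G0_bound : exists2 K, 0 <= K & forall u, l2 (J u) -> nn (G0 u) <= K * nnl (J u).
Proof.
have [K K0 hK] := col_bound (proj1 (LC 0)).
by exists K; [exact: K0|move=> u hu; rewrite (G0E hu); exact: hK].
Qed.

End BoundaryTriplet.

(** * Convergence in l^2 *)

Section L2Convergence.
Variable R : realType.
Local Notation C := (complexC R).
Variable p : nat.

Lemma cvg0_nsqC (z : nat -> C) : nsqC (z n) @[n --> \oo] --> (0 : R) ->
  z n @[n --> \oo] --> (0 : C).
Proof.
move=> h.
have hf (f : nat -> R) : (forall n, f n ^+ 2 <= nsqC (z n)) -> f n @[n --> \oo] --> (0 : R).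
  move=> hfz; apply/cvgrPdist_lt => e e0; have e20 : 0 < e ^+ 2 by rewrite exprn_gt0.
  move/cvgrPdist_lt : h => /(_ _ e20); apply: filterS => n; rewrite !sub0r !normrN.
  rewrite (ger0_norm (nsqC_ge0 _)) => hz.
  have : `|f n| ^+ 2 < e ^+ 2 by rewrite real_normK ?num_real//; apply: le_lt_trans hz.
  by rewrite ltr_pXn2r// nnegrE ?ltW.
apply: cvgC_ReIm; apply: hf => n; rewrite /nsqC ?lerDl ?lerDr sqr_ge0 //.
Qed.

#[local] Opaque l2 inner cdot nn nnl nnM nsqC.

Lemma l2norm_cvg0 (d : nat -> nat -> 'cV[C]_p) : (forall k, l2 (d k)) ->
  (l2norm (d k) @[k --> \oo] --> (0 : C)) <-> (nnl (d k) @[k --> \oo] --> (0 : R)).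
Proof.
move=> hd.
have -> : (fun k => l2norm (d k)) = (fun k => (Num.sqrt (nnl (d k)))%:C).
  by apply/funext => k; rewrite (l2normE (hd k)).
split=> [/cvgC_Re h|h].
  have h2 : (fun k => Num.sqrt (nnl (d k))) @ \oo --> (0 : R) := h.
  have := cvgM h2 h2; rewrite mulr0.
  rewrite (_ : _ \* _ = (fun k => nnl (d k))); first exact.
  by apply/funext => k; rewrite -[LHS]/(Num.sqrt _ * Num.sqrt _) -expr2 sqr_sqrtr// nnl_ge0.
apply: cvgC_ReIm; last exact: cvg_cst.
have := cvg_comp _ _ h (@sqrt_continuous R 0); rewrite sqrtr0; exact.
Qed.

Lemma inner_cvg0l (d : nat -> nat -> 'cV[C]_p) c : (forall k, l2 (d k)) -> l2 c ->
  nnl (d k) @[k --> \oo] --> (0 : R) -> inner (d k) c @[k --> \oo] --> (0 : C).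
Proof.
move=> hd hc h; apply: cvg0_nsqC.
have h2 : nnl (d k) * nnl c @[k --> \oo] --> (0 : R).
  by have := cvgM h (cvg_cst (nnl c)) ; rewrite mul0r; apply.
apply: (squeeze_cvgr _ (cvg_cst 0) h2); near=> k.
by apply/andP; split; [exact: nsqC_ge0|exact: (inner_cs (hd k) hc)].
Unshelve. all: by end_near. Qed.

Lemma inner_cvg0r (d : nat -> nat -> 'cV[C]_p) c : (forall k, l2 (d k)) -> l2 c ->
  nnl (d k) @[k --> \oo] --> (0 : R) -> inner c (d k) @[k --> \oo] --> (0 : C).
Proof.
move=> hd hc h; have h0 := inner_cvg0l hd hc h.
have E : (fun k => inner c (d k)) = (fun k => (inner (d k) c)^*%R).
  by apply/funext => k; rewrite (innerC (hd k) hc).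
have e0 : (0 : C) = (0 : C)^*%R by rewrite rmorph0.
by rewrite E e0; exact: cvg_conjC.
Qed.

Lemma inner_cvg0 (d e : nat -> nat -> 'cV[C]_p) : (forall k, l2 (d k)) -> (forall k, l2 (e k)) ->
  nnl (d k) @[k --> \oo] --> (0 : R) -> nnl (e k) @[k --> \oo] --> (0 : R) ->
  inner (d k) (e k) @[k --> \oo] --> (0 : C).
Proof.
move=> hd he h h'; apply: cvg0_nsqC.
have h2 : nnl (d k) * nnl (e k) @[k --> \oo] --> (0 : R).
  by have := cvgM h h' ; rewrite mul0r; apply.
apply: (squeeze_cvgr _ (cvg_cst 0) h2); near=> k.
by apply/andP; split; [exact: nsqC_ge0|exact: (inner_cs (hd k) (he k))].
Unshelve. all: by end_near. Qed.

Definition tail (f : nat -> 'cV[C]_p) N : nat -> 'cV[C]_p := fun j => if (j < N)%N then 0 else f j.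

Lemma tail_cvg0 (f : nat -> 'cV[C]_p) : l2 f ->
  (forall N, l2 (tail f N)) /\ nnl (tail f N) @[N --> \oo] --> (0 : R).
Proof.
move=> hf.
have hb N n : \sum_(j < n) nn (tail f N j) <= nnl f - \sum_(j < N) nn (f j).
  have [nN|/ltnW Nn] := leqP n N.
    rewrite big1 ?subr_ge0; first exact: nnl_sum_le.
    by move=> j _; rewrite /tail (leq_trans (ltn_ord j) nN) nn0.
  rewrite lerBrDr (@sum_ord_cat _ (fun j => nn (tail f N j)) _ _ Nn).
  rewrite big1 ?add0r; last by move=> j _; rewrite /tail ltn_ord nn0.
  apply: le_trans (nnl_sum_le n hf); rewrite addrC (@sum_ord_cat _ (fun j => nn (f j)) _ _ Nn).
  rewrite lerD2l; rewrite big_nat_cond [leRHS]big_nat_cond; apply: ler_sum => j.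
  by rewrite andbT => /andP[Nj _]; rewrite /tail ltnNge Nj.
have hl N := proj1 (nnl_le (hb N)).
split; first exact: hl.
have h2 : nnl f - \sum_(j < N) nn (f j) @[N --> \oo] --> (0 : R).
  by have := cvgB (cvg_cst (nnl f)) (nnl_cvg hf); rewrite subrr; apply.
apply: (squeeze_cvgr _ (cvg_cst 0) h2); apply: nearW => N.
have h0 := nnl_ge0 (hl N); have h3 := proj2 (nnl_le (hb N)).
by apply/andP; split; [exact: h0|exact: h3].
Qed.

End L2Convergence.

(** * The Krein extension *)


Section KreinExtension.
Variable R : realType.
Local Notation C := (complexC R).
Local Notation Re := (@complex.Re R).
Variables (p : nat) (A B : nat -> 'M[C]_p).
Hypothesis hA : forall j, (A j)^t* = A j.
Hypothesis hB : forall j, B j \in unitmx.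
Hypothesis LC : forall z : C, limit_circle_at A B z.
Hypothesis hT : nonneg (@inner _ _) (Tpre A B).
Implicit Types (u v w f g : nat -> 'cV[C]_p) (z : C) (a b c : 'cV[C]_p).
Local Notation J := (@jacobi _ p A B 1).
Local Notation P := (Ppoly A B 0).
Local Notation Q := (Qpoly A B 0).
Local Notation G0 := (Gamma0 A B).
Local Notation G1 := (Gamma1 A B).
Local Notation ip := (@inner C p).

Lemma fin_J w N : (forall j, (N <= j)%N -> w j = 0) -> forall j, (N.+1 <= j)%N -> J w j = 0.
Proof.
move=> hw [|j]// Nj; have Nj' : (N <= j)%N by [].
rewrite /jacobi (hw j.+2 (leqW (leqW Nj'))) (hw j.+1 (leqW Nj')) (hw j Nj').
by rewrite !mulmx0 !addr0.
Qed.

Lemma fin_green w v N : (forall j, (N <= j)%N -> w j = 0) -> ip (J w) v = ip w (J v).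
Proof.
move=> hw.
rewrite (inner_fin v (fin_J hw)).
have hw' j : (N.+1 <= j)%N -> w j = 0 by move=> Nj; apply: hw; exact: ltnW.
rewrite (inner_fin (J v) hw').
apply/eqP; rewrite -subr_eq0 -sumrB; apply/eqP.
rewrite (jacobi_lagrange B hA) (hw N (leqnn N)) (hw N.+1 (leqnSn N)).
by rewrite mulmx0 !cdot0l subrr.
Qed.

Lemma Pc_0 c : Pc A B c 0%N = c.
Proof. by rewrite /Pc mul1mx. Qed.

Lemma nn_cvg0 (a : nat -> 'cV[C]_p) : a n @[n --> \oo] --> (0 : 'cV[C]_p) ->
  nn (a n) @[n --> \oo] --> (0 : R).
Proof. by move=> ha; have := cvgC_Re _ (cvg_cdot _ ha ha); rewrite cdot0l; apply. Qed.

#[local] Opaque l2 inner cdot nn nnl nnM nsqC Gamma0 Gamma1 Ppoly Qpoly jacobi.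

Lemma TpreP w N : (forall j, (N <= j)%N -> w j = 0) -> Tpre A B (w, J w).
Proof. by move=> hw; split; [exists N|]. Qed.

Lemma Tpre_l2 x : Tpre A B x -> [/\ l2 x.1, l2 x.2 & x.2 = J x.1].
Proof.
case: x => w f [[N hw]] /= ->; split; [exact: (l2_fin hw)|exact: (l2_fin (fin_J hw))|by []].
Qed.

Definition Tpre_l21 x (h : Tpre A B x) : l2 x.1 := let: And3 a _ _ := Tpre_l2 h in a.
Definition Tpre_l22 x (h : Tpre A B x) : l2 x.2 := let: And3 _ a _ := Tpre_l2 h in a.

(** From [N] on the accumulators have reached their limits [G0 w] and [G1 w], which are zero, and
    the representation of [w n] vanishes. *)
Lemma fin_support w N : (forall j, (N <= j)%N -> J w j = 0) -> l2 (J w) ->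
  G0 w = 0 -> G1 w = 0 -> forall n, (N <= n)%N -> w n = 0.
Proof.
move=> hw hJ h0 h1 n Nn.
have hw' j : (n <= j)%N -> J w j = 0 by move=> nj; apply: hw; exact: leq_trans nj.
have ha : alpha A B 0 (J w) n = 0.
  apply: cdot_ext => c; rewrite cdot0l.
  rewrite -[RHS](cdot0l c) -h0 (cdotG0 LC c hJ) (inner_fin (Pc A B c) hw').
  by rewrite cdot_suml; apply: eq_bigr => k _; rewrite cdotMl trmxCK.
have hb : beta A B 0 (J w) n - w 0%N = 0.
  apply: cdot_ext => c; rewrite cdot0l.
  rewrite -[RHS](cdot0l c) -h1 (cdotG1 LC c hJ) (inner_fin (Qc A B c) hw') cdotBl.
  by congr (_ - _); rewrite cdot_suml; apply: eq_bigr => k _; rewrite cdotMl trmxCK.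
by rewrite (repr0 hA hB) ha hb !mulmx0 subr0.
Qed.

Lemma nnl_dlt0 a : l2 (dlt0 a) /\ nnl (dlt0 a) = nn a.
Proof.
have h : l2 (dlt0 a) by apply: (@l2_fin _ _ _ 1) => -[].
split; first exact: h.
apply: complexI; rewrite -(inner_nnl h) (@inner_fin _ _ _ _ 1); last by case.
by rewrite big_ord_recl big_ord0 /= addr0 cdot_nn.
Qed.

(** Cutting off [u] would leave an uncontrolled boundary term in [J u]. Instead [J u] is cut off and
    the equation is solved back with Gamma_1 = 0. *)
Lemma Tpre_approx u : l2 (J u) -> G0 u = 0 -> G1 u = 0 ->
  exists w : nat -> nat -> 'cV[C]_p,
  [/\ forall N, Tpre A B (w N, J (w N)),
      nnl (u - w N) @[N --> \oo] --> (0 : R) &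
      nnl (J u - J (w N)) @[N --> \oo] --> (0 : R)].
Proof.
move=> hu h0 h1; have [htl htc] := tail_cvg0 hu.
(* The cut-off of [J u] violates Gamma_0 = 0 by exactly [a N]. Subtracting [a N] at site 0, where
   [P_0] is the identity, repairs this, and [a N] tends to [G0 u = 0]. *)
pose a N := alpha A B 0 (J u) N.
pose d N := tail (J u) N + dlt0 (a N).
pose f N := J u - d N.
have hd N : l2 (d N) by apply: l2D; [exact: htl|exact: (proj1 (nnl_dlt0 _))].
have hf N : l2 (f N) by apply: l2B; [exact: hu|exact: hd].
have hw' N : exists w, [/\ l2 w, J w = f N & G1 w = 0].
  exact (@solveG1 R p A B hA hB LC (f N) 0 (hf N)).
have [w hw] := choice hw'.
have f0 N j : (N.+1 <= j)%N -> f N j = 0.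
  move=> Nj; rewrite -[LHS]/(J u j - (tail (J u) N j + dlt0 (a N) j)) /tail ltnNge (ltnW Nj)/=.
  by case: j Nj => // j _; rewrite addr0 subrr.
have hJw N : l2 (J (w N)) by have [_ -> _] := hw N; exact: hf.
have g0 N : G0 (w N) = 0.
  apply: cdot_ext => c; rewrite (cdotG0 LC c (hJw N)); have [_ -> _] := hw N.
  rewrite (inner_fin (Pc A B c) (f0 N)) cdot0l.
  have fE j : f N j = J u j - (tail (J u) N j + dlt0 (a N) j) by [].
  rewrite (eq_bigr (fun j : 'I_N.+1 =>
     (if (j < N)%N then cdot (J u j) (Pc A B c j) else 0) - cdot (dlt0 (a N) j) (Pc A B c j))); last first.
    move=> j _; rewrite fE opprD addrA cdotBl; congr (_ - _); rewrite /tail.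
    by case: ifP => _; rewrite ?subr0 ?subrr ?cdot0l.
  rewrite sumrB big_ord_recr/= ltnn addr0 big_ord_recl/= [X in _ - (_ + X)]big1 ?addr0; last first.
    by move=> j _; rewrite cdot0l.
  rewrite (eq_bigr (fun j : 'I_N => cdot (J u j) (Pc A B c j))); last by move=> j _; rewrite ltn_ord.
  rewrite Pc_0 /a /alpha cdot_suml -sumrB big1// => k _.
  by rewrite cdotMl trmxCK subrr.
have hdc : nnl (d N) @[N --> \oo] --> (0 : R).
  have h2 : 2 * nnl (tail (J u) N) + 2 * nn (a N) @[N --> \oo] --> (0 : R).
    have ha : nn (a N) @[N --> \oo] --> (0 : R).
      by apply: nn_cvg0; have := G0_cvg LC hu; rewrite h0; apply.
    have := cvgD (cvgM (cvg_cst (2 : R)) htc) (cvgM (cvg_cst (2 : R)) ha).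
    by rewrite !mulr0 addr0; apply.
  apply: (squeeze_cvgr _ (cvg_cst 0) h2); apply: nearW => N.
  have [hdl hde] := nnl_dlt0 (a N).
  have h4 := nnl_ge0 (hd N); have h3 := nnlD_le (htl N) hdl.
  by rewrite hde in h3; apply/andP; split; [exact: h4|exact: h3].
exists w; split.
- move=> N; apply: (@TpreP _ N.+1); apply: fin_support.
  + by have [_ -> _] := hw N; exact: f0.
  + exact: hJw.
  + exact: g0.
  + by have [_ _ ->] := hw N.
- have [K K0 hK] := norm_bound1 hA hB LC.
  have h2 : K * nnl (d N) @[N --> \oo] --> (0 : R).
    by have := cvgM (cvg_cst K) hdc; rewrite mulr0; apply.
  apply: (squeeze_cvgr _ (cvg_cst 0) h2); apply: nearW => N.
  have [hw0 hw1 hw2] := hw N.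
  have hJd : J (u - w N) = d N by rewrite JB hw1 /f opprB addrC subrK.
  have hl : l2 (J (u - w N)) by rewrite hJd; exact: hd.
  have h3 : nnl (u - w N) <= K * nnl (d N).
    by rewrite -hJd; apply: (hK _ hl); rewrite (G1B LC hu (hJw N)) h1 hw2 subrr.
  have h4 := nnl_ge0 (l2B (l2_of_J hA hB LC hu) hw0).
  by apply/andP; split; [exact: h4|exact: h3].
- rewrite (_ : (fun N => _) = (fun N => nnl (d N))); first exact: hdc.
  by apply/funext => N; have [_ -> _] := hw N; rewrite /f opprB addrC subrK.
Qed.

Lemma nonneg_G01 u : l2 (J u) -> G0 u = 0 -> G1 u = 0 -> 0 <= Re (ip (J u) u).
Proof.
move=> hu h0 h1; have [w [hw hwu hwJ]] := Tpre_approx hu h0 h1.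
have lu := l2_of_J hA hB LC hu.
have lw N : l2 (w N) := Tpre_l21 (hw N).
have lJw N : l2 (J (w N)) := Tpre_l22 (hw N).
have ld N : l2 (u - w N) := l2B lu (lw N).
have lJd N : l2 (J u - J (w N)) := l2B hu (lJw N).
have alg (x a y1 y2 y3 b c t : C) : y1 = a - b -> y2 = a - c -> y3 = y2 - t ->
    t = b - x -> x = a - y1 - y2 + y3 by move=> -> -> -> ->; ring.
have E N : ip (J (w N)) (w N) = ip (J u) u - ip (J u - J (w N)) u -
    ip (J u) (u - w N) + ip (J u - J (w N)) (u - w N).
  have e1 := innerBl hu (lJw N) lu; have e2 := innerBr lu (lw N) hu.
  have e3 := innerBl hu (lJw N) (ld N); have e4 := innerBr lu (lw N) (lJw N).
  exact: (alg _ _ _ _ _ _ _ _ e1 e2 e3 e4).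
have c1 := inner_cvg0l lJd lu hwJ.
have c2 := inner_cvg0r ld hu hwu.
have c3 := inner_cvg0 lJd ld hwJ hwu.
have hc : ip (J (w N)) (w N) @[N --> \oo] --> ip (J u) u.
  rewrite (_ : (fun N => _) = (fun N => ip (J u) u - ip (J u - J (w N)) u -
    ip (J u) (u - w N) + ip (J u - J (w N)) (u - w N))); last by apply/funext => N; exact: E.
  have := cvgD (cvgB (cvgB (cvg_cst (ip (J u) u)) c1) c2) c3.
  by rewrite !subr0 addr0; apply.
have {}hc : (fun N => Re (ip (J (w N)) (w N))) @ \oo --> Re (ip (J u) u).
  exact: cvgC_Re.
rewrite -(cvg_lim (@norm_hausdorff _ _) hc).
apply: limr_ge; first exact: cvgP hc.
apply: nearW => N; have := hT (hw N); rewrite lecE => /andP[_]; exact.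
Qed.


Lemma G0_orth_Pc u c : l2 (J u) -> G0 u = 0 -> ip (J u) (Pc A B c) = 0.
Proof. by move=> hu h0; rewrite -(cdotG0 LC c hu) h0 cdot0l. Qed.

Lemma shift_G1 u : l2 (J u) -> let v := u + Pc A B (G1 u) in
  [/\ J v = J u, G0 v = G0 u & G1 v = 0].
Proof.
move=> hu /=; have hP := @Jl2_Pc R p A B hB (G1 u); split.
- by rewrite JD J_Pc// addr0.
- by rewrite (G0D LC hu hP) (G0_Pc hB LC) addr0.
- by rewrite (G1D LC hu hP) (G1_Pc hB LC) subrr.
Qed.

(** [J u] is orthogonal to the sequences P(0)c when [G0 u = 0], so the form does not notice the
    shift that brings [u] into ker Gamma_1. *)
Lemma T0_nonneg u : l2 (J u) -> G0 u = 0 -> 0 <= Re (ip (J u) u).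
Proof.
move=> hu h0; have [hJ e0 e1] := shift_G1 hu.
have lu := l2_of_J hA hB LC hu.
have := @nonneg_G01 (u + Pc A B (G1 u)); rewrite hJ e0 e1 => /(_ hu h0 erefl).
by rewrite (innerDr lu (@Pc_l2 R p A B LC (G1 u)) hu) G0_orth_Pc ?addr0.
Qed.

Lemma TmaxP x : Tmax A B x <-> l2 (J x.1) /\ x.2 = J x.1.
Proof.
split=> [[h1 h2 h3]|[h1 h2]].
  by split; [rewrite -h3; exact: h2|exact: h3].
by split; [exact: (l2_of_J hA hB LC h1)|rewrite h2; exact: h1|exact: h2].
Qed.

Lemma Tpre_Tmin x : Tpre A B x -> Tmin A B x.
Proof.
move=> hx; have [h1 h2 h3] := Tpre_l2 hx; split; [exact: h1|exact: h2|].
have n0 : l2norm (0 : nat -> 'cV[C]_p) = 0.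
  by rewrite /l2norm inner0l sqrtC0.
by exists (fun=> x); split; [by []|rewrite subrr n0; exact: cvg_cst..].
Qed.

Lemma Tmax_adjoint x : Tmax A B x -> adjoint l2 ip (Tmin A B) x.
Proof.
move=> /TmaxP[hJ hx2]; have l1 := l2_of_J hA hB LC hJ.
have l22 : l2 x.2 by rewrite hx2; exact: hJ.
split; [exact: l1|exact: l22|] => y [y1 y2 [t [ht ht1 ht2]]].
have lt1 k : l2 (t k).1 := Tpre_l21 (ht k).
have lt2 k : l2 (t k).2 := Tpre_l22 (ht k).
have ld1 k : l2 (y.1 - (t k).1) := l2B y1 (lt1 k).
have ld2 k : l2 (y.2 - (t k).2) := l2B y2 (lt2 k).
have /(l2norm_cvg0 ld1) n1 := ht1; have /(l2norm_cvg0 ld2) n2 := ht2.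
have c1 := inner_cvg0l ld1 l22 n1; have c2 := inner_cvg0l ld2 l1 n2.
have alg (a b c d r s : C) : a = c - r -> b = d - s -> r = s ->
  a - b = c - d by move=> -> -> ->; ring.
have E k : ip (y.2 - (t k).2) x.1 - ip (y.1 - (t k).1) x.2 = ip y.2 x.1 - ip y.1 x.2.
  have e1 := innerBl y2 (lt2 k) l1; have e2 := innerBl y1 (lt1 k) l22.
  have e3 : ip (t k).2 x.1 = ip (t k).1 x.2.
    by have [[N hN] ->] := ht k; rewrite hx2; exact: fin_green hN.
  exact: (alg _ _ _ _ _ _ e1 e2 e3).
have hE : (fun k => ip (y.2 - (t k).2) x.1 - ip (y.1 - (t k).1) x.2) =
  cst (ip y.2 x.1 - ip y.1 x.2) by apply/funext => k; exact: E.
have h : (fun k => ip (y.2 - (t k).2) x.1 - ip (y.1 - (t k).1) x.2) @ \oo --> (0 - 0 : C).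
  exact (cvgB c2 c1).
rewrite hE subr0 in h; apply: subr0_eq.
by rewrite -(cvg_lim (@norm_hausdorff _ _) h) lim_cst.
Qed.

Lemma adjoint_Tmax x : l2 x.1 -> l2 x.2 ->
  (forall y, Tpre A B y -> ip y.2 x.1 = ip y.1 x.2) -> Tmax A B x.
Proof.
move=> l1 l22 h; split; [exact: l1|exact: l22|].
apply/funext => j; apply: cdot_ext => c.
pose w : nat -> 'cV[C]_p := fun k => if k == j then c else 0.
have hw k : (j.+1 <= k)%N -> w k = 0 by move=> jk; rewrite /w gtn_eqF.
have iw v : ip w v = cdot c (v j).
  rewrite (inner_fin v hw) big_ord_recr/= /w eqxx big1 ?add0r// => k _.
  by rewrite ltn_eqF// cdot0l.
have := h _ (TpreP hw); rewrite /= (fin_green _ hw) !iw => e.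
by rewrite -[LHS]cdotC -[RHS]cdotC e.
Qed.

Lemma G01_Tmin u : l2 (J u) -> G0 u = 0 -> G1 u = 0 -> Tmin A B (u, J u).
Proof.
move=> hu h0 h1; have [w [hw hwu hwJ]] := Tpre_approx hu h0 h1.
have lu := l2_of_J hA hB LC hu.
split; [exact: lu|exact: hu|].
exists (fun N => (w N, J (w N))); split; first exact: hw.
- apply/l2norm_cvg0; last exact: hwu.
  by move=> k; exact: (l2B lu (Tpre_l21 (hw k))).
- apply/l2norm_cvg0; last exact: hwJ.
  by move=> k; exact: (l2B hu (Tpre_l22 (hw k))).
Qed.

Lemma krein_T0 : krein (Tmin A B) = T0 A B.
Proof.
apply/seteqP; split=> x.
  move=> [[l1 l22 hadj] [y [hy hc _]]].
  have hx : Tmax A B x.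
    by apply: (adjoint_Tmax l1 l22) => t ht; apply: hadj; exact: Tpre_Tmin.
  split; first exact: hx.
  have [_ _ hx2] := hx; have hJ : l2 (J x.1) by rewrite -hx2; exact: l22.
  apply: cdot_ext => c; rewrite (cdotG0 LC c hJ) -hx2 cdot0l.
  have ly k : l2 (y k).2 by case: (hy k) => _ a _; exact: a.
  have ld k : l2 (x.2 - (y k).2) := l2B l22 (ly k).
  have /(l2norm_cvg0 ld) n2 := hc.
  have c2 := inner_cvg0l ld (@Pc_l2 R p A B LC c) n2.
  (* [Pc A B c] lies in the kernel of [Tmax], hence is orthogonal to the range of [Tmin] and to its
     limit [x.2]; for all [c] this says Gamma_0 = 0. *)
  have hPc : Tmax A B (Pc A B c, 0).
    have e : J (Pc A B c) = 0 by exact: J_Pc.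
    apply/TmaxP; split; last by rewrite /= e.
    by rewrite [X in l2 X]e; exact: l2_0.
  have E k : ip (x.2 - (y k).2) (Pc A B c) = ip x.2 (Pc A B c).
    have [_ _ /(_ _ (hy k)) /= e] := Tmax_adjoint hPc.
    have e0 : ip (y k).2 (Pc A B c) = 0 by rewrite e; exact: inner0r.
    apply: (etrans (innerBl l22 (ly k) (@Pc_l2 R p A B LC c))).
    by rewrite e0; exact: subr0.
  have hE : (fun k => ip (x.2 - (y k).2) (Pc A B c)) = cst (ip x.2 (Pc A B c)).
    by apply/funext => k; exact: E.
  rewrite hE in c2.
  by rewrite -(cvg_lim (@norm_hausdorff _ _) c2) lim_cst.
move=> [hx h0]; split; first exact: Tmax_adjoint.
have [_ _ hx2] := hx; have [_ l22 _] := hx.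
have hJ : l2 (J x.1) by rewrite -hx2; exact: l22.
have [eJ e0 e1] := shift_G1 hJ.
have hmin : Tmin A B (x.1 + Pc A B (G1 x.1), x.2).
  by rewrite hx2 -eJ; apply: G01_Tmin; rewrite ?eJ ?e0 ?e1; [exact: hJ|exact: h0|by []].
have n0 : l2norm (0 : nat -> 'cV[C]_p) = 0.
  by rewrite /l2norm inner0l sqrtC0.
exists (fun=> (x.1 + Pc A B (G1 x.1), x.2)); split; first by [].
- rewrite /= subrr n0. exact (@cvg_cst C _ _ _ _).
- rewrite /= !subrr inner0l; exact (@cvg_cst C _ _ _ _).
Qed.

Lemma dom_krein : dom (krein (Tmin A B)) =
  [set u | dom (Tmax A B) u /\ Gamma0 A B u = 0].
Proof.
rewrite krein_T0; apply/seteqP; split=> u.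
  by move=> [w [hw h0]]; split; [exists w|exact: h0].
by move=> [[w hw] h0]; exists w; split.
Qed.

End KreinExtension.

(** * The Weyl function on the negative half-axis *)

Lemma inj_unitmx (K : fieldType) n (D : 'M[K]_n) :
  (forall c : 'cV_n, D *m c = 0 -> c = 0) -> D \in unitmx.
Proof.
move=> h; rewrite -row_full_unit -cokermx_eq0; apply/eqP/matrixP => i j.
have /h : D *m col j (cokermx D) = 0 by rewrite colE mulmxA mulmx_coker mul0mx.
by move=> /matrixP/(_ i 0); rewrite !mxE.
Qed.

Lemma linear_mx (K : comNzRingType) m n (f : 'cV[K]_n -> 'cV[K]_m) :
  (forall a u v, f (a *: u + v) = a *: f u + f v) -> exists D, forall c, f c = D *m c.
Proof.
move=> fl.
have f0 : f 0 = 0 by have := fl (-1) 0 0; rewrite !scaleN1r addr0 oppr0 addNr.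
exists (\matrix_(i, j) f (delta_mx j 0) i 0) => c.
have fsum (r : seq 'I_n) :
    f (\sum_(j <- r) c j 0 *: delta_mx j 0) = \sum_(j <- r) c j 0 *: f (delta_mx j 0).
  by elim: r => [|j r IH]; rewrite ?big_nil// !big_cons fl IH.
have {1}-> : c = \sum_j c j 0 *: delta_mx j 0.
  by rewrite {1}[c]matrix_sum_delta; apply: eq_bigr => i _; rewrite big_ord1.
rewrite fsum; apply/matrixP => i k; rewrite (ord1 k) summxE mxE.
by apply: eq_bigr => j _; rewrite !mxE mulrC.
Qed.

Lemma variational_alg (K : realFieldType) (x m r a s t n N : K) : x < 0 ->
  0 <= a - t - x * s + x * n -> 0 <= N - 2 * x * t + x ^+ 2 * n ->
  x * s - t = m - r -> m <= a + r - x^-1 * N.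
Proof.
move=> x0 h1 h2 h3.
have x_neq0 : x != 0 by rewrite lt_eqF.
have h4 : (N - 2 * x * t + x ^+ 2 * n) * x^-1 <= 0 by rewrite mulr_ge0_le0// invr_le0 ltW.
have e4 : (N - 2 * x * t + x ^+ 2 * n) * x^-1 = x^-1 * N - 2 * t + x * n by field.
rewrite e4 in h4; lra.
Qed.

Section Weyl.
Variable R : realType.
Local Notation C := (complexC R).
Local Notation Re := (@complex.Re R).
Variables (p : nat) (A B : nat -> 'M[C]_p).
Hypothesis hA : forall j, (A j)^t* = A j.
Hypothesis hB : forall j, B j \in unitmx.
Hypothesis LC : forall z : C, limit_circle_at A B z.
Hypothesis hT : nonneg (@inner _ _) (Tpre A B).
Implicit Types (u v w f g : nat -> 'cV[C]_p) (z : C) (a b c : 'cV[C]_p) (x y s : R).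
Local Notation J := (@jacobi _ p A B 1).
Local Notation G0 := (Gamma0 A B).
Local Notation G1 := (Gamma1 A B).
Local Notation ip := (@inner C p).

Lemma nsqC_real x : nsqC x%:C = x ^+ 2.
Proof. by rewrite [LHS]/nsqC /= expr0n addr0. Qed.

Lemma Re_sqr_le z : Re z ^+ 2 <= nsqC z.
Proof. by rewrite [leRHS]/nsqC lerDl sqr_ge0. Qed.

#[local] Opaque l2 inner cdot nn nnl nnM nsqC Gamma0 Gamma1 Ppoly Qpoly jacobi.

Lemma Re_realM x z : Re (x%:C * z) = x * Re z.
Proof. by rewrite ReM /= mul0r subr0. Qed.

Lemma Re_inner_sym u v : l2 u -> l2 v -> Re (ip u v) = Re (ip v u).
Proof. by move=> hu hv; rewrite -(innerC hv hu) Re_conjC. Qed.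

Lemma Re_cs u v : l2 u -> l2 v -> Re (ip u v) ^+ 2 <= nnl u * nnl v.
Proof.
by move=> hu hv; exact: (le_trans (Re_sqr_le _) (inner_cs hu hv)).
Qed.

Lemma variational_Re x (y1 y2 y3 y4 y5 : C) : x%:C * y1 - y2 = y3 - y4 ->
  Re y2 = Re y5 -> x * Re y1 - Re y5 = Re y3 - Re y4.
Proof. by move=> /(congr1 Re) + <-; rewrite !ReD !ReN Re_realM. Qed.

Lemma conj_real x : (x%:C)^*%R = x%:C :> C.
Proof. by apply: complexP; rewrite ?Re_conjC ?Im_conjC //= oppr0. Qed.

Lemma T0_kernel x u : x < 0 -> l2 u -> J u = x%:C *: u -> G0 u = 0 -> u = 0.
Proof.
move=> x0 hu hJ h0; have hJl : l2 (J u) by rewrite hJ; exact: l2Z.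
have h := T0_nonneg hA hB LC hT hJl h0.
apply: (nnl_eq0 hu); apply/eqP; rewrite eq_le (nnl_ge0 hu) andbT.
have e : Re (ip (J u) u) = x * nnl u.
  by rewrite hJ (innerZl _ hu hu) (inner_nnl hu) Re_realM.
by rewrite e nmulr_rge0 in h.
Qed.

Lemma ker_shift x : exists2 K : R, 0 <= K & exists Px : 'cV[C]_p -> nat -> 'cV[C]_p,
  (forall (r : C) b c, Px (r *: b + c) = r *: Px b + Px c) /\
  (forall c, [/\ l2 (Px c), J (Px c) = x%:C *: Px c, Px c 0%N = c & nnl (Px c) <= K * nn c]).
Proof.
have [[K hK] _] := LC x%:C.
have K0 : 0 <= K by have := hK 0%N; rewrite big_ord0.
exists K; first exact: K0.
exists (fun c k => Ppoly A B x%:C k *m c); split.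
  by move=> a u v; apply/funext => k; rewrite mulmxDr -scalemxAr.
move=> c.
have hb n : \sum_(k < n) nn (Ppoly A B x%:C k *m c) <= K * nn c.
  apply: (@le_trans _ _ ((\sum_(k < n) nnM (Ppoly A B x%:C k)) * nn c)).
    by rewrite mulr_suml; apply: ler_sum => k _; exact: nn_mulmx_le.
  by apply: ler_wpM2r; [exact: nn_ge0|exact: hK].
have [h1 h2] := @nnl_le R p (fun k => Ppoly A B x%:C k *m c) _ hb.
split; [exact: h1|exact: J_mulP| |exact: h2].
exact: mul1mx.
Qed.

(** [c |-> G0 (Px c)] is a linear map of C^p. It is injective because the non-negative [T0] has no
    eigenvalue [x < 0], so it can be inverted. *)
Lemma deficiency x : x < 0 -> exists2 K : R, 0 <= K & forall a, exists u,
  [/\ l2 u, J u = x%:C *: u, G0 u = a & nnl u <= K * nn a].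
Proof.
move=> x0; have [K K0 [Px [Pl hP]]] := ker_shift x.
have hJ c : l2 (J (Px c)) by have [h e _ _] := hP c; rewrite e; exact: l2Z.
have [D hD] : exists D : 'M[C]_p, forall c, G0 (Px c) = D *m c.
  by apply: linear_mx => a u v; rewrite Pl; exact: (G0_linear LC _ (hJ u) (hJ v)).
have Du : D \in unitmx.
  apply: inj_unitmx => c Dc; have [h1 h2 h3 _] := hP c.
  have := T0_kernel x0 h1 h2; rewrite hD => /(_ Dc) e.
  by rewrite -h3 e.
exists (K * nnM (invmx D)); first by rewrite mulr_ge0// nnM_ge0.
move=> a; exists (Px (invmx D *m a)); have [h1 h2 _ h4] := hP (invmx D *m a).
split; [exact: h1|exact: h2|by rewrite hD mulKVmx|].
apply: (le_trans h4); rewrite -[K * _ * _]mulrA; apply: ler_wpM2l => //.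
exact: nn_mulmx_le.
Qed.

(** [weyl_function] determines [M] only on the resolvent set of [T0]; this lemma makes the whole
    negative half-axis available. A solution of Ju = w + xu is corrected by a solution of Jv = xv to
    satisfy Gamma_0 = 0. *)
Lemma resolvent_neg x : x < 0 -> resolvent_set (T0 A B) x%:C.
Proof.
move=> x0; split.
  move=> w hw; have [u [hu _ hJu]] := @solve R p A B hA hB LC x%:C w 0 hw.
  have hJul : l2 (J u) by rewrite hJu; apply: l2D; [exact: hw|exact: l2Z].
  have [K _ /(_ (G0 u)) [v [hv hJv hGv _]]] := deficiency x0.
  have hJvl : l2 (J v) by rewrite hJv; exact: l2Z.
  exists (u - v); split.
    split; last by rewrite /= (G0B LC hJul hJvl) hGv subrr.
    apply/(TmaxP hA hB LC); split; first by rewrite /= JB; exact: l2B.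
    by rewrite /= JB hJu hJv scalerBr addrA.
  move=> t [/(TmaxP hA hB LC)[/= hJt et] h0t].
  have lt := l2_of_J hA hB LC hJt.
  apply/esym/subr0_eq; apply: (@T0_kernel x).
  - exact: x0.
  - exact: (l2B lt (l2B hu hv)).
  - rewrite !JB -et hJu hJv !scalerBr opprB !addrA; apply/funext => k.
    rewrite !fctE; mx_abel.
  - have hJuv : l2 (J (u - v)) by rewrite JB; exact: l2B.
    have e0 : G0 (u - v) = 0 by rewrite (G0B LC hJul hJvl) hGv subrr.
    have e1 : G0 t = 0 by exact: h0t.
    by rewrite (G0B LC hJt hJuv) e0 e1 subr0.
(* Non-negativity of [T0] gives -x |u|^2 <= Re ((J - x)u, u), hence the norm bound with this
   constant. *)
exists (- x^-1)%:C => -[u f] [/(TmaxP hA hB LC)[/= hJ ef] h0].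
have hu := l2_of_J hA hB LC hJ.
have hg : l2 (f - x%:C *: u) by rewrite ef; apply: l2B; [exact: hJ|exact: l2Z].
rewrite (l2normE hu) (l2normE hg) -rmorphM lecR.
have h1 : 0 <= Re (ip f u) by rewrite ef; exact: T0_nonneg.
have hf : l2 f by rewrite ef.
have e : Re (ip (f - x%:C *: u) u) = Re (ip f u) - x * nnl u.
  rewrite (innerBl hf (l2Z _ hu) hu) (innerZl _ hu hu) (inner_nnl hu).
  by rewrite ReD ReN Re_realM.
have := Re_cs hg hu; rewrite e.
have := nnl_ge0 hu; have := nnl_ge0 hg; move: h1.
move: (Re (ip f u)) (nnl u) (nnl (f - _)) => r n g r0 g0 n0 h2.
have xi : 0 < - x^-1 by rewrite oppr_gt0 invr_lt0.
rewrite -(ger0_norm (ltW xi)) -sqrtr_sqr -sqrtrM ?sqr_ge0// ler_sqrt; last first.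
  by rewrite mulr_ge0// sqr_ge0.
rewrite sqrrN exprVn mulrC ler_pdivlMr ?exprn_even_gt0//= ?lt_eqF//.
have [->|nn0] := eqVneq n 0; first by rewrite mul0r.
have np : 0 < n by rewrite lt_neqAle eq_sym nn0.
rewrite -(ler_pM2r np); apply: le_trans h2.
have xn : 0 <= - (x * n) by rewrite oppr_ge0 mulr_le0_ge0// ltW.
rewrite (_ : n * x ^+ 2 * n = (- (x * n)) ^+ 2); last by ring.
have le1 : - (x * n) <= r - x * n by rewrite lerDr.
by rewrite ler_pXn2r// nnegrE// (le_trans xn).
Qed.

Variable M : C -> 'M[C]_p.
Hypothesis hM : weyl_function A B M.

Definition mq (X : 'M[C]_p) a : R := Re (cdot (X *m a) a).

(* [kq v] depends only on [J v] (lemma [kq_congr] below): it is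
   [(J v, v)] once [v] is normalised by [Gamma1 v = 0]. *)
Definition kq v : R := Re (ip (J v) v) + Re (cdot (G0 v) (G1 v)).

Lemma weyl_vector x : x < 0 -> exists2 K : R, 0 <= K & forall a, exists u,
  [/\ l2 u, J u = x%:C *: u, G0 u = a, G1 u = M x%:C *m a & nnl u <= K * nn a].
Proof.
move=> x0; have [K K0 h] := deficiency x0; exists K => // a.
have [u [h1 h2 h3 h4]] := h a; exists u; split; [exact: h1|exact: h2|exact: h3| |exact: h4].
rewrite -h3; apply: (hM (resolvent_neg x0)); split; [exact: h1|exact: l2Z|by rewrite h2].
Qed.

Lemma weyl_herm x a b : x < 0 -> cdot (M x%:C *m a) b = cdot a (M x%:C *m b).
Proof.
move=> x0; have [K _ h] := weyl_vector x0.
have [u [u1 u2 u3 u4 _]] := h a; have [v [v1 v2 v3 v4 _]] := h b.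
have hJu : l2 (J u) by rewrite u2; exact: l2Z.
have hJv : l2 (J v) by rewrite v2; exact: l2Z.
have := green hA hB LC hJu hJv.
rewrite u3 u4 v3 v4 u2 v2 (innerZl _ u1 v1) (innerZr _ v1 u1) conj_real.
have e0 : x%:C * ip u v - x%:C * ip u v = 0 by apply/eqP; rewrite subr_eq0.
by rewrite e0 => /esym/subr0_eq.
Qed.

(** Let d = v - u, where Ju = xu and u has the same Gamma_0 as v. By Green's formula the right side
    minus the left side is exactly (Jd, d) - x^-1 |Jd|^2, and both terms are non-negative. *)
Lemma weyl_variational x v : x < 0 -> l2 (J v) ->
  mq (M x%:C) (G0 v) <= kq v - x^-1 * nnl (J v).
Proof.
move=> x0 hJv; have [K _ h] := weyl_vector x0.
have [u [u1 u2 u3 u4 _]] := h (G0 v).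
have v1 := l2_of_J hA hB LC hJv.
have hJu : l2 (J u) by rewrite u2; exact: l2Z.
have hJd : l2 (J (v - u)) by rewrite JB; exact: l2B.
have h1 : 0 <= Re (ip (J (v - u)) (v - u)).
  by apply: (T0_nonneg hA hB LC hT hJd); rewrite (G0B LC hJv hJu) u3 subrr.
have h2 := nnl_ge0 (l2B hJv hJu).
have e1 : Re (ip (J (v - u)) (v - u)) = Re (ip (J v) v) - Re (ip (J v) u)
    - x * Re (ip u v) + x * nnl u.
  have l3 : ip (J u) v = x%:C * ip u v by rewrite u2; exact: innerZl.
  have l4 : ip (J u) u = x%:C * (nnl u)%:C.
    by rewrite u2 -(inner_nnl u1); exact: innerZl.
  have e0 : ip (J (v - u)) (v - u) =
      ip (J v) v - ip (J v) u - (x%:C * ip u v - x%:C * (nnl u)%:C).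
    apply: (etrans (congr1 (ip^~ (v - u)) (JB A B v u))).
    apply: (etrans (innerBB hJv hJu v1 u1)).
    by congr (_ - (_ - _)); [exact: l3|exact: l4].
  rewrite e0.
  move: (ip (J v) v) (ip (J v) u) (ip u v) (nnl u) => ? ? ? ?.
  by rewrite !(ReD, ReN, Re_realM) /=; ring.
have e2 : nnl (J v - J u) = nnl (J v) - 2 * x * Re (ip (J v) u) + x ^+ 2 * nnl u.
  rewrite (nnlD hJv (l2N hJu)) (nnlN hJu) u2 (nnlZ _ u1) nsqC_real.
  rewrite (innerNl (l2Z _ u1) hJv) (innerZl _ u1 hJv) ReN Re_realM.
  rewrite (Re_inner_sym u1 hJv); move: (nnl (J v)) (Re (ip (J v) u)) (nnl u) => ? ? ?; ring.
have g := green hA hB LC hJu hJv.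
have l1 : ip (J u) v = x%:C * ip u v by rewrite u2 (innerZl _ u1 v1).
rewrite l1 u3 u4 in g.
have e3 := variational_Re g (Re_inner_sym u1 hJv).
rewrite e1 in h1; rewrite e2 in h2.
exact: (variational_alg x0 h1 h2 e3).
Qed.

End Weyl.

(** * Monotonicity, continuity and blow-up of the Weyl function *)

Lemma mono_alg (K : realFieldType) (x y n m m' : K) : x <= y -> y < 0 -> 0 <= n ->
  m <= y * n + m' - x^-1 * (y ^+ 2 * n) -> m <= m'.
Proof.
move=> xy y0 n0; have x0 : x < 0 by exact: le_lt_trans y0.
have h : y <= y ^+ 2 * x^-1.
  by rewrite ler_ndivlMr// expr2 ler_wnM2l// ltW.
have h2 : y * n <= y ^+ 2 * x^-1 * n by rewrite ler_wpM2r.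
have -> : x^-1 * (y ^+ 2 * n) = y ^+ 2 * x^-1 * n by ring.
by move=> ?; lra.
Qed.

(** For solutions v, u of Jv = yv and Ju = su read [t] as Re (v, u), [ny] as |v|^2, [ns] as |u|^2;
    the quadratic hypothesis is (J(v - u), v - u) >= 0. It forces [t >= 0], and [y <= s / 2] is what
    yields [ny <= 3 * t], whence [t ^+ 2 <= 3 * t * ns]. *)
Lemma cont_alg (K : realFieldType) (s y ny ns t : K) : s < 0 -> y <= s / 2 ->
  0 <= ny -> 0 <= ns -> 0 <= y * ny - y * t - s * t + s * ns -> t ^+ 2 <= ny * ns ->
  `|t| <= 3 * ns.
Proof.
move=> s0 ys ny0 ns0 h ht.
have y0 : y < 0 by lra.
have h1 : 0 <= (- y) * ny by rewrite mulr_ge0//; lra.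
have h2 : 0 <= (- s) * ns by rewrite mulr_ge0//; lra.
have t0 : 0 <= t.
  rewrite -(pmulr_rge0 _ (_ : 0 < - y - s)); last by lra.
  have -> : (- y - s) * t = - (y * t) - s * t by ring.
  have -> : - (y * t) - s * t = (y * ny - y * t - s * t + s * ns) + (- y) * ny + (- s) * ns by ring.
  by rewrite (addr_ge0 (addr_ge0 h h1) h2).
have h3 : ny <= 3 * t.
  have yn0 : 0 < - y by lra.
  rewrite -(ler_pM2l yn0).
  have : 0 <= (- 2 * y + s) * t by rewrite mulr_ge0//; lra.
  have -> : (-2 * y + s) * t = - (2 * (y * t)) + s * t by ring.
  have -> : - y * (3 * t) = - (3 * (y * t)) by ring.
  move: h h1 h2; rewrite !mulNr.
  by move: (y * ny) (y * t) (s * t) (s * ns) => ? ? ? ?; lra.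
rewrite ger0_norm//.
have [->|tn0] := eqVneq t 0; first by rewrite mulr_ge0.
have tp : 0 < t by rewrite lt_neqAle eq_sym tn0.
rewrite -(ler_pM2l tp) -expr2; apply: (le_trans ht).
have -> : t * (3 * ns) = 3 * t * ns by ring.
by rewrite ler_wpM2r.
Qed.

Lemma lower_alg (F : realFieldType) (K r n m : F) : 0 <= K ->
  r ^+ 2 <= n * m -> m <= K * n -> 0 <= m -> 0 <= n -> - ((1 + K) * n) <= r.
Proof.
move=> K0 h1 h2 m0 n0.
have h3 : r ^+ 2 <= ((1 + K) * n) ^+ 2.
  apply: (le_trans h1); apply: (@le_trans _ _ (n * (K * n))); first by rewrite ler_wpM2l.
  have -> : n * (K * n) = K * (n * n) by ring.
  have -> : ((1 + K) * n) ^+ 2 = (1 + K) ^+ 2 * (n * n) by ring.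
  apply: ler_wpM2r; first by rewrite mulr_ge0.
  by rewrite expr2; nra.
have h4 : 0 <= (1 + K) * n by rewrite mulr_ge0// addr_ge0.
have : `|r| ^+ 2 <= ((1 + K) * n) ^+ 2 by rewrite real_normK ?num_real.
by rewrite ler_pXn2r ?nnegrE// ler_norml => /andP[].
Qed.

Lemma blowup_alg (F : realFieldType) (L t K m n b : F) :
  - (L * n) <= - ((L + t * K + 1) * n) + m -> 0 <= n -> 0 <= t -> b <= K * n ->
  t * b <= m.
Proof.
move=> h n0 t0 hb; have h1 : t * b <= t * (K * n) by rewrite ler_wpM2l.
have e : (L + t * K + 1) * n = L * n + t * (K * n) + n by ring.
rewrite e in h; move: (t * (K * n)) (L * n) (t * b) h h1 => ? ? ? *; lra.
Qed.

Section WeylMonotone.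
Variable R : realType.
Local Notation C := (complexC R).
Local Notation Re := (@complex.Re R).
Variables (p : nat) (A B : nat -> 'M[C]_p).
Hypothesis hA : forall j, (A j)^t* = A j.
Hypothesis hB : forall j, B j \in unitmx.
Hypothesis LC : forall z : C, limit_circle_at A B z.
Hypothesis hT : nonneg (@inner _ _) (Tpre A B).
Implicit Types (u v w f g : nat -> 'cV[C]_p) (z : C) (a b c : 'cV[C]_p) (x y s : R).
Local Notation J := (@jacobi _ p A B 1).
Local Notation G0 := (Gamma0 A B).
Local Notation G1 := (Gamma1 A B).
Local Notation ip := (@inner C p).
Variable M : C -> 'M[C]_p.
Hypothesis hM : weyl_function A B M.

Lemma Re_cdot_herm x a : x < 0 -> Re (cdot a (M x%:C *m a)) = mq (M x%:C) a.
Proof. by move=> x0; rewrite /mq (weyl_herm hA hB LC hT hM a a x0). Qed.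

#[local] Opaque l2 inner cdot nn nnl nnM nsqC Gamma0 Gamma1 Ppoly Qpoly jacobi.

Lemma Re_ip_real_mul x u : l2 u -> Re (ip (x%:C *: u) u) = x * nnl u.
Proof. by move=> hu; rewrite (innerZl _ hu hu) (inner_nnl hu) Re_realM. Qed.

Lemma kq_deficiency x u : x < 0 -> l2 u -> J u = x%:C *: u ->
  G1 u = M x%:C *m G0 u -> kq A B u = x * nnl u + mq (M x%:C) (G0 u).
Proof.
move=> x0 hu hJ h1; rewrite /kq h1 Re_cdot_herm//; congr (_ + _).
by rewrite hJ; exact: Re_ip_real_mul.
Qed.

Lemma weyl_mono x y a : x <= y -> y < 0 -> mq (M x%:C) a <= mq (M y%:C) a.
Proof.
move=> xy y0; have x0 : x < 0 by exact: le_lt_trans y0.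
have [K _ h] := weyl_vector hA hB LC hT hM y0.
have [u [u1 u2 u3 u4 _]] := h a.
have hJu : l2 (J u) by rewrite u2; exact: l2Z.
have := weyl_variational hA hB LC hT hM x0 hJu.
have e4 : G1 u = M y%:C *m G0 u by rewrite u3; exact: u4.
rewrite (kq_deficiency y0 u1 u2 e4) u3.
have -> : nnl (J u) = y ^+ 2 * nnl u by rewrite u2 (nnlZ _ u1) nsqC_real.
exact: (mono_alg xy y0 (nnl_ge0 u1)).
Qed.

(** By Green's formula the difference is (y - s) Re (v, u) for the two defect vectors, and Re (v, u)
    is bounded through the fixed vector u alone. The range [y <= s / 2] contains a neighbourhood of
    [s]. *)
Lemma weyl_cont s : s < 0 -> exists2 K : R, 0 <= K & forall y a, y <= s / 2 ->
  `|mq (M y%:C) a - mq (M s%:C) a| <= K * `|y - s| * nn a.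
Proof.
move=> s0; have [K K0 hs] := weyl_vector hA hB LC hT hM s0.
exists (3 * K); first by rewrite mulr_ge0.
move=> y a ys; have y0 : y < 0 by lra.
have [Ky _ hy] := weyl_vector hA hB LC hT hM y0.
have [u [u1 u2 u3 u4 u5]] := hs a; have [v [v1 v2 v3 v4 _]] := hy a.
have hJu : l2 (J u) by rewrite u2; exact: l2Z.
have hJv : l2 (J v) by rewrite v2; exact: l2Z.
have hJd : l2 (J (v - u)) by rewrite JB; exact: l2B.
have g := green hA hB LC hJv hJu.
have l1 : ip (J v) u = y%:C * ip v u by rewrite v2 (innerZl _ v1 u1).
have l2' : ip v (J u) = s%:C * ip v u by rewrite u2 (innerZr _ u1 v1) conj_real.
rewrite l1 l2' u3 u4 v3 v4 in g.
have e1 : (y - s) * Re (ip v u) = mq (M y%:C) a - mq (M s%:C) a.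
  rewrite -(Re_cdot_herm a s0) /mq; move: g => /(congr1 Re).
  move: (ip v u) (cdot _ a) (cdot a _) => ? ? ?.
  by rewrite !ReD !ReN !Re_realM => <-; ring.
rewrite -e1 normrM [3 * K * _]mulrC -mulrA ler_wpM2l//.
have h1 : 0 <= Re (ip (J (v - u)) (v - u)).
  by apply: (T0_nonneg hA hB LC hT hJd); rewrite (G0B LC hJv hJu) u3 v3 subrr.
have e2 : Re (ip (J (v - u)) (v - u)) =
    y * nnl v - y * Re (ip v u) - s * Re (ip v u) + s * nnl u.
  have l3 : ip (J u) v = s%:C * ip u v by rewrite u2; exact: innerZl.
  have l4 : ip (J u) u = s%:C * (nnl u)%:C.
    by rewrite u2 -(inner_nnl u1); exact: innerZl.
  have l5 : ip (J v) v = y%:C * (nnl v)%:C.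
    by rewrite v2 -(inner_nnl v1); exact: innerZl.
  have e0 : ip (J (v - u)) (v - u) =
      y%:C * (nnl v)%:C - y%:C * ip v u - (s%:C * ip u v - s%:C * (nnl u)%:C).
    apply: (etrans (congr1 (ip^~ (v - u)) (JB A B v u))).
    apply: (etrans (innerBB hJv hJu v1 u1)).
    by congr (_ - _ - (_ - _)); [exact: l5|exact: l1|exact: l3|exact: l4].
  rewrite e0.
  have es := Re_inner_sym u1 v1; move: es; move: (ip u v) (ip v u) (nnl u) (nnl v) => r t nu nv.
  by rewrite !(ReD, ReN, Re_realM) /= => ->; ring.
rewrite e2 in h1.
have h2 := cont_alg s0 ys (nnl_ge0 v1) (nnl_ge0 u1) h1 (Re_cs v1 u1).
by apply: (le_trans h2); rewrite -mulrA ler_wpM2l.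
Qed.

(** After the shift to Gamma_1 = 0, [kq] is (Jv', v') with v' bounded by Jv'. The constant [1 + K]
    stands in for the square root of [K]. *)
Lemma kq_lower : exists2 L : R, 0 <= L & forall v, l2 (J v) ->
  - (L * nnl (J v)) <= kq A B v.
Proof.
have [K K0 hK] := norm_bound1 hA hB LC.
exists (1 + K); first by rewrite addr_ge0.
move=> v hv; have [eJ e0 e1] := shift_G1 hB LC hv.
have lv := l2_of_J hA hB LC hv.
set v' := v + _ in eJ e0 e1.
have hv' : l2 (J v') by rewrite eJ.
have lv' := l2_of_J hA hB LC hv'.
have ek : kq A B v = Re (ip (J v') v').
  rewrite /kq eJ /v' (innerDr lv (@Pc_l2 R p A B LC _) hv) -(cdotG0 LC _ hv).
  by rewrite [RHS]ReD.
have h1 := Re_cs hv' lv'.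
have h2 := hK _ hv' e1.
rewrite ek -eJ.
exact: (lower_alg K0 h1 h2 (nnl_ge0 lv') (nnl_ge0 hv')).
Qed.

Lemma weyl_blowup (t : R) : 0 <= t -> exists2 x : R, x < 0 &
  forall a, t * nn a <= mq (M x%:C) a.
Proof.
move=> t0; have [L L0 hL] := kq_lower; have [K K0 hK] := G0_bound LC.
(* At x = -1/y a defect vector satisfies x |u|^2 = -y |Ju|^2. Hence the form of M(x) at [a] is at
   least (y - L) |Ju|^2 = (tK + 1) |Ju|^2, while [nn a] is at most K |Ju|^2. *)
pose y := L + t * K + 1; have y0 : 0 < y.
  by rewrite /y ltr_wpDl// addr_ge0// mulr_ge0.
have x0 : - y^-1 < 0 by rewrite oppr_lt0 invr_gt0.
exists (- y^-1) => // a.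
have [Kx _ h] := weyl_vector hA hB LC hT hM x0.
have [u [u1 u2 u3 u4 _]] := h a.
have hJu : l2 (J u) by rewrite u2; exact: l2Z.
have h1 := hL _ hJu; have h2 := hK _ hJu.
have e4 : G1 u = M (- y^-1)%:C *m G0 u by rewrite u3; exact: u4.
rewrite (kq_deficiency x0 u1 u2 e4) u3 in h1; rewrite u3 in h2.
have e : nnl (J u) = y^-1 ^+ 2 * nnl u by rewrite u2 (nnlZ _ u1) nsqC_real sqrrN.
have en : y^-1 * nnl u = y * nnl (J u) by rewrite e; field; rewrite gt_eqF.
rewrite mulNr en in h1.
exact: (blowup_alg h1 (nnl_ge0 hJu) t0 h2).
Qed.

Lemma weyl_attained x v : x < 0 -> exists u, [/\ l2 (J u), G0 u = G0 v &
  mq (M x%:C) (G0 v) = kq A B u - x * nnl u].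
Proof.
move=> x0; have [Kx _ h] := weyl_vector hA hB LC hT hM x0.
have [u [u1 u2 u3 u4 _]] := h (G0 v).
exists u; split; [by rewrite u2; exact: l2Z|exact: u3|].
have e4 : G1 u = M x%:C *m G0 u by rewrite u3; exact: u4.
have e := kq_deficiency x0 u1 u2 e4; rewrite u3 in e.
by move: e; move: (mq _ _) (kq _ _ _) (x * _) => m k n ->; rewrite addrC addKr.
Qed.

End WeylMonotone.

(** * Self-adjoint relations in C^p *)

Lemma nz_comb (K : fieldType) (I J : finType) (a : I -> J -> K) :
  (#|J| < #|I|)%N ->
  exists c : I -> K, (exists i, c i != 0) /\ forall j, \sum_i c i * a i j = 0.
Proof.
move=> JI; pose X : 'M[K]_(#|I|, #|J|) := \matrix_(i, j) a (enum_val i) (enum_val j).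
have : kermx X != 0.
  rewrite kermx_eq0 /row_free neq_ltn (leq_ltn_trans _ JI)//.
  exact: rank_leq_col.
move=> /rowV0Pn [r /sub_kermxP rX r0].
exists (fun i => r 0 (enum_rank i)); split.
  have [i ri] : exists i, r 0 i != 0.
    apply/existsP; apply: contraR r0 => /existsPn h.
    by apply/eqP/rowP => i; rewrite mxE; apply/eqP; move: (h i); rewrite negbK.
  by exists (enum_val i); rewrite enum_valK.
move=> j; have /matrixP/(_ 0 (enum_rank j)) := rX; rewrite !mxE => h; apply: etrans h.
rewrite (reindex (enum_val (A := I)))/=; last first.
  by apply: onW_bij; exact: enum_val_bij.
by apply: eq_bigr => i _; rewrite mxE enum_valK enum_rankK.
Qed.

Section Subspaces.
Variable R : realType.
Local Notation C := (complexC R).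
Variable p : nat.
Implicit Types (W : set 'cV[C]_p).

(** A matrix of maximal rank with row space in [W] (up to transposition) has all of [W] as row
    space; a nonzero column of its cokernel would be orthogonal to [W]. *)
Lemma subspace_full W : W 0 ->
  (forall (a : C) u v, W u -> W v -> W (a *: u + v)) ->
  (forall v, (forall w, W w -> cdot w v = 0) -> v = 0) -> forall w, W w.
Proof.
move=> W0 Wl Wo.
pose Pr (r : nat) :=
  `[< exists2 Y : 'M[C]_p, (forall v : 'rV_p, (v <= Y)%MS -> W v^T) & \rank Y = r >].
have Pr0 : exists r, Pr r.
  exists 0%N; apply/asboolP; exists 0; last exact: mxrank0.
  by move=> v; rewrite submx0 => /eqP ->; rewrite trmx0.
have Prp r : Pr r -> (r <= p)%N.
  by move=> /asboolP[Y _ <-]; exact: rank_leq_row.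
case: (ex_maxnP Pr0 Prp) => r /asboolP[Y hY rY] rmax.
have sub w : W w -> (w^T <= Y)%MS.
  move=> Ww; have leY : (Y <= Y + w^T)%MS by exact: addsmxSl.
  have : (\rank (Y + w^T)%MS <= \rank Y)%N.
    rewrite rY; apply: rmax; apply/asboolP; exists (Y + w^T)%MS => // v /sub_addsmxP[[u1 u2] ->].
    rewrite linearD /= [u2]mx11_scalar mul_scalar_mx linearZ /= trmxK addrC.
    by apply: Wl => //; apply: hY; exact: submxMl.
  rewrite (geq_leqif (mxrank_leqif_sup leY)) => h.
  by apply: submx_trans h; exact: addsmxSr.
have fY : row_full Y.
  rewrite -cokermx_eq0; apply/eqP/matrixP => i j.
  pose k := col j (cokermx Y).
  have : (map_mx (@Num.conj C) k) = 0.
    apply: Wo => w /sub /submxP[u hu].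
    have -> : cdot w (map_mx (@Num.conj C) k) = (w^T *m k) 0 0.
      rewrite cdotE !mxE; apply: eq_bigr => l _; rewrite !mxE conjCK mulrC //.
    by rewrite hu -mulmxA /k colE mulmxA -mulmxA [Y *m _]mulmxA mulmx_coker mul0mx mulmx0 mxE.
  move=> /matrixP/(_ i 0); rewrite !mxE => /eqP; rewrite conjC_eq0 => /eqP.
  by [].
by move=> w; rewrite -[w]trmxK; apply: hY; exact: submx_full.
Qed.

Lemma orth_ker_range m n (X : 'M[C]_(m, n)) (v : 'cV[C]_n) :
  (forall w, X *m w = 0 -> cdot w v = 0) -> exists k, v = X^t* *m k.
Proof.
move=> h.
have : (v^t* <= X)%MS.
  rewrite submxE; apply/eqP/matrixP => i j; rewrite (ord1 i) [RHS]mxE.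
  have e : cdot (col j (cokermx X)) v = 0.
    by apply: h; rewrite colE mulmxA mulmx_coker mul0mx.
  rewrite -[RHS]e /cdot mxE [RHS]mxE; apply: eq_bigr => k _; by rewrite [col _ _ _ _]mxE.
by move=> /submxP[D hD]; exists (D^t*); rewrite -mulmxtC -hD trmxCK.
Qed.

End Subspaces.

Section SelfAdjointRelations.
Variable R : realType.
Local Notation C := (complexC R).
Local Notation Re := (@complex.Re R).
Local Notation Im := (@complex.Im R).
Variable p : nat.
Variable S : set ('cV[C]_p * 'cV[C]_p).
Hypothesis Ssa : selfadjoint_rel S.
Implicit Types (f g u v w : 'cV[C]_p).

Lemma saP f g : S (f, g) <-> forall f' g', S (f', g') -> cdot g' f = cdot f' g.
Proof.
split=> [|h].
  by rewrite {1}Ssa => -[_ _ h] f' g' /h.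
by rewrite Ssa; split=> // -[f' g'] /h.
Qed.

Lemma sa_sym f g f' g' : S (f, g) -> S (f', g') -> cdot g' f = cdot f' g.
Proof. by move=> /saP h /h. Qed.

Lemma sa0 : S (0, 0).
Proof. by apply/saP => f g _; rewrite !cdot0r. Qed.

Lemma sa_comb (a : C) f g f' g' : S (f, g) -> S (f', g') -> S (a *: f + f', a *: g + g').
Proof.
move=> /saP h /saP h'; apply/saP => k l hkl.
by rewrite !cdotDr !cdotZr (h _ _ hkl) (h' _ _ hkl).
Qed.

Lemma saZ (a : C) f g : S (f, g) -> S (a *: f, a *: g).
Proof. by move=> h; have := sa_comb a h sa0; rewrite !addr0. Qed.

Lemma saD f g f' g' : S (f, g) -> S (f', g') -> S (f + f', g + g').
Proof. by move=> h h'; have := sa_comb 1 h h'; rewrite !scale1r. Qed.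

Lemma sa_sum (I : Type) (r : seq I) (P : pred I) (F G : I -> 'cV[C]_p) :
  (forall i, P i -> S (F i, G i)) ->
  S (\sum_(i <- r | P i) F i, \sum_(i <- r | P i) G i).
Proof.
move=> h; elim: r => [|i r IH]; first by rewrite !big_nil; exact: sa0.
by rewrite !big_cons; case: ifP => // Pi; apply: saD => //; exact: h.
Qed.

Local Notation ii := ('i%C : C).

Lemma conj_ii : ii^*%R = - ii.
Proof. by apply: complexP; rewrite ?Re_conjC ?Im_conjC ?ReN ?ImN /= ?oppr0. Qed.

Lemma conj_Nii : (- ii)^*%R = ii.
Proof. by apply: complexP; rewrite ?Re_conjC ?Im_conjC ?ReN ?ImN /= ?oppr0 ?opprK. Qed.

Lemma ii_nn (n : R) : ii * n%:C = - ii * n%:C -> n = 0.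
Proof. by move=> /(congr1 Im); rewrite !ImM ImN ReN /=; lra. Qed.

Lemma sa_def_trivial f : S (f, ii *: f) -> f = 0.
Proof.
move=> h; apply: nn_eq0; apply: ii_nn.
by have := sa_sym h h; rewrite cdotZl cdotZr cdot_nn conj_ii.
Qed.

Lemma sa_def_trivial' f : S (f, - ii *: f) -> f = 0.
Proof.
move=> h; apply: nn_eq0; apply: ii_nn.
by have := sa_sym h h; rewrite cdotZl cdotZr cdot_nn conj_Nii.
Qed.

(** A vector orthogonal to the range of S - i is an eigenvector of the adjoint, that is of [S], for
    -i, hence zero. The resolvent [Rm] at i is a matrix even when [S] has a multivalued part. *)
Lemma sa_resolvent : exists Rm : 'M[C]_p,
  forall w, S (Rm *m w, w + ii *: (Rm *m w)).
Proof.
have range : forall w, exists f, S (f, w + ii *: f).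
  apply: subspace_full.
  - by exists 0; rewrite scaler0 addr0; exact: sa0.
  - move=> a u v [f hf] [g hg]; exists (a *: f + g).
    have := sa_comb a hf hg; congr (S (_, _)).
    rewrite !scalerDr !scalerA [ii * a]mulrC; mx_abel.
  - move=> v hv; apply: sa_def_trivial'; apply/saP => f g hfg.
    have := hv (g - ii *: f); rewrite cdotBl cdotZl cdotZr conj_Nii.
    move=> h; apply/eqP; rewrite -subr_eq0; apply/eqP/h.
    by exists f; rewrite subrK.
have [F hF] := choice range.
have Fl a u v : F (a *: u + v) = a *: F u + F v.
  apply/subr0_eq; apply: sa_def_trivial.
  have h1 := sa_comb (-1) (sa_comb a (hF u) (hF v)) (hF (a *: u + v)).
  move: h1; rewrite !scaleN1r; congr (S (_, _)); first by rewrite addrC.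
  rewrite !scalerDr !scalerN !scalerDr !scalerA [ii * a]mulrC.
  move: (F _) (F u) (F v) => x y z; mx_abel.
have [Rm hRm] := linear_mx Fl.
by exists Rm => w; rewrite -hRm.
Qed.

Lemma sa_resolventP Rm : (forall w, S (Rm *m w, w + ii *: (Rm *m w))) ->
  forall f g, S (f, g) <-> exists2 w, f = Rm *m w & g = w + ii *: (Rm *m w).
Proof.
move=> h f g; split=> [hfg|[w -> ->]//].
have e : f = Rm *m (g - ii *: f).
  apply/subr0_eq; apply: sa_def_trivial.
  have h1 := saD hfg (saZ (-1) (h (g - ii *: f))).
  move: h1; rewrite !scaleN1r; congr (S (_, _)).
  rewrite scalerBr; move: (Rm *m _) => x; mx_abel.
by exists (g - ii *: f) => //; rewrite -e subrK.
Qed.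

Lemma resolvent_id Rm : (forall w, S (Rm *m w, w + ii *: (Rm *m w))) ->
  Rm - Rm^t* = (2 * ii) *: (Rm^t* *m Rm).
Proof.
move=> h.
have e w w' : cdot (Rm^t* *m w + ii *: (Rm^t* *m (Rm *m w))) w' =
    cdot (Rm *m w - ii *: (Rm^t* *m (Rm *m w))) w'.
  have := sa_sym (h w') (h w); rewrite !cdotDl cdotNl !cdotZl cdotDr cdotZr conj_ii.
  by rewrite !cdotMl !trmxCK mulNr.
apply/matrixP => i j.
have := cdot_ext (e (delta_mx j 0)).
rewrite !mulmxA -!colE => /matrixP/(_ i 0); rewrite !mxE.
move: (\sum_j0 _) => x h2.
have -> : Rm i j = (Rm j i)^*%R + ii * x + ii * x by rewrite h2; ring.
ring.
Qed.

(** [U] is the Cayley transform of [S]. The resolvent identity makes it an isometry, hence unitary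
    in finite dimension; comparing the two unitarity relations gives normality of [Rm]. *)
Lemma resolvent_normal Rm : (forall w, S (Rm *m w, w + ii *: (Rm *m w))) ->
  Rm *m Rm^t* = Rm^t* *m Rm.
Proof.
move=> /resolvent_id e.
pose U := 1%:M + (2 * ii) *: Rm.
have c2 : (2 * ii)^*%R = - (2 * ii) 
  by apply: complexP; rewrite ?Re_conjC ?Im_conjC ?ReN ?ImN !(ReM, ImM) /=; ring.
have Ut : U^t* = 1%:M - (2 * ii) *: Rm^t*.
  by rewrite tCD tC1 tCZ c2 scaleNr.
have i4 : (2 * ii) * (2 * ii) = - 4 by apply: complexP; rewrite !(ReM, ImM) /=; ring.
have UU : U^t* *m U = 1%:M.
  rewrite Ut mulmxDr mulmx1 mulmxBl mul1mx -!scalemxAl -!scalemxAr scalerA i4.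
  have : (2 * ii) *: (Rm - Rm^t*) = - 4 *: (Rm^t* *m Rm) by rewrite e scalerA i4.
  rewrite scalerBr => h; rewrite -h; move: ((2 * ii) *: _) ((2 * ii) *: _) => x y; mx_abel.
have := mulmx1C UU; rewrite Ut mulmxBr mulmx1 mulmxDl mul1mx -!scalemxAl -!scalemxAr scalerA i4.
move=> h.
have : (2 * ii) *: (Rm - Rm^t*) = - 4 *: (Rm *m Rm^t*).
  rewrite scalerBr; move: h; rewrite {1}/U.
  move: (Rm *m _) ((2 * ii) *: _) ((2 * ii) *: _) => x y z h.
  by apply: subr0_eq; rewrite -[RHS](subrr 1%:M) -{1}h; mx_abel.
rewrite e scalerA i4 => h4.
have n4 : - 4 != 0 :> C by rewrite oppr_eq0 pnatr_eq0.
by apply/esym/(scalerI n4).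
Qed.

Lemma sa_eigenvalue_real (l : C) f : f != 0 -> S (f, l *: f) -> l = (Re l)%:C.
Proof.
move=> f0 h; have := sa_sym h h; rewrite cdotZl cdotZr cdot_nn => e.
have n0 : (nn f)%:C != 0 :> C.
  by apply: contra f0 => /eqP[] /nn_eq0 ->.
have e2 := mulIf n0 e; apply: complexP => //=.
by have := congr1 Im e2; rewrite Im_conjC; lra.
Qed.

(* [mu i] marks the basis vectors of the multivalued part. *)
Lemma sa_diag : exists (U : 'M[C]_p) (mu : 'I_p -> bool) (lam : 'I_p -> R),
  [/\ U^t* *m U = 1%:M, U *m U^t* = 1%:M &
   forall i, S (if mu i then 0 else col i U, if mu i then col i U else (lam i)%:C *: col i U)].
Proof.
have [Rm hR] := sa_resolvent.
have : Rm \is normalmx by apply/normalmxP; exact: resolvent_normal.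
move=> /orthomx_spectralP; set sp := spectralmx Rm => hsp.
have spu : sp \is unitarymx by exact: spectral_unitarymx.
have iv := invmx_unitary spu; have un : sp \in unitmx by exact: unitarymx_unit.
pose U := sp^t*.
have UU : U^t* *m U = 1%:M by rewrite /U trmxCK -iv mulmxV.
have UU' : U *m U^t* = 1%:M by rewrite /U trmxCK -iv mulVmx.
have spU : sp *m U = 1%:M by rewrite /U -iv mulmxV.
have ev i : exists l : C, Rm *m col i U = l *: col i U.
  exists (spectral_diag Rm 0 i); rewrite {1}hsp iv -/U.
  rewrite colE -!mulmxA [sp *m _]mulmxA spU mul1mx.
  rewrite scalemxAr; congr (U *m _); apply/matrixP => k j; rewrite (ord1 j).
  rewrite mul_diag_mx !mxE eqxx andbT; case: eqP => [->|_]; rewrite ?mulr1 ?mulr0//.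
have col0 i : col i U != 0.
  apply/eqP => h; have := congr1 (fun X => col i X) UU.
  rewrite colE -mulmxA -colE h mulmx0 => /matrixP/(_ i 0).
  by rewrite !mxE eqxx => /eqP; rewrite eq_sym oner_eq0.
(* The eigenvalue 0 of [Rm] marks a multivalued direction; an eigenvalue [l != 0] gives the
   eigenvalue l^-1 + i of [S], which is real by symmetry. *)
have hdiag i : exists bl : bool * R,
    S (if bl.1 then 0 else col i U, if bl.1 then col i U else bl.2%:C *: col i U).
  have [l hl] := ev i; have := hR (col i U); rewrite hl.
  have [->|l0] := eqVneq l 0.
    by rewrite !scale0r scaler0 addr0 => h; exists (true, 0).
  move=> /(saZ l^-1); rewrite scalerA mulVf// scale1r scalerDr !scalerA.
  rewrite -scalerDl; move: (_ + _) => t h.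
  by exists (false, Re t); rewrite /= -(sa_eigenvalue_real (col0 i) h).
have [bl hbl] := choice hdiag.
by exists U, (fun i => (bl i).1), (fun i => (bl i).2).
Qed.

End SelfAdjointRelations.

(** * Counting positive eigenvalues of a self-adjoint relation *)

Lemma card_sumE (R : realType) (I : finType) (b : pred I) :
  ((#|[pred i | b i]|%:R : R)%:E = \sum_i (if b i then 1 else 0 : R)%:E)%E.
Proof.
by rewrite sumEFin -big_mkcond/= sumr_const.
Qed.

(** After exchanging the sums, each index [i] contributes one unit, located at [l i]. *)
Lemma esum_count (R : realType) (I : finType) (T : choiceType) (D : set T)
    (b : pred I) (l : I -> T) :
  (\esum_(z in D) (#|[pred i | b i && (l i == z)]|%:R : R)%:E =
  (#|[pred i | b i && (l i \in D)]|%:R)%:E)%E.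
Proof.
under eq_esum do rewrite card_sumE.
rewrite esum_sum; last by move=> z i _ _; case: ifP.
rewrite card_sumE; apply: eq_bigr => i _.
case: (b i) => /=; last by rewrite esum1.
rewrite (eq_esum (b := fun z => if z \in [set l i] then 1%E else 0%E)); last first.
  move=> z _; have -> : (z \in [set l i]) = (l i == z).
    by apply/idP/eqP => [/set_mem ->//|->]; exact/mem_set.
  by case: eqP.
rewrite -esum_mkcondr; have [lD|lD] := boolP (l i \in D).
  rewrite (_ : D `&` [set l i] = [set l i]); first by rewrite esum_set1.
  by apply/seteqP; split=> [z []//|z ->]; split=> //; exact: set_mem.
rewrite (_ : D `&` [set l i] = set0); first by rewrite esum_set0.
apply/seteqP; split=> // z [Dz e]; move: lD; rewrite -e.
by rewrite (mem_set Dz).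
Qed.

Section Diagonal.
Variable R : realType.
Local Notation C := (complexC R).
Local Notation Re := (@complex.Re R).
Variable p : nat.
Variable U : 'M[C]_p.
Hypothesis UU : U^t* *m U = 1%:M.
Hypothesis UU' : U *m U^t* = 1%:M.
Local Notation e i := (col i U).
Implicit Types (u v w : 'cV[C]_p).

Lemma cdot_basis i j : cdot (e j) (e i) = (i == j)%:R.
Proof.
have -> : cdot (e j) (e i) = (U^t* *m U) i j.
  by rewrite cdotE mxE; apply: eq_bigr => k _; rewrite !mxE.
by rewrite UU mxE.
Qed.

Lemma basis_expand u : u = \sum_i cdot u (e i) *: e i.
Proof.
rewrite -[LHS]mul1mx -UU' -mulmxA.
apply/matrixP => k j; rewrite (ord1 j) summxE mxE; apply: eq_bigr => i _.
rewrite !mxE mulrC; congr (_ * _); rewrite cdotE; apply: eq_bigr => l _.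
by rewrite !mxE.
Qed.

Lemma cdot_expand (I : finType) (c : I -> C) (f : I -> 'cV[C]_p) i :
  cdot (\sum_j c j *: f j) (e i) = \sum_j c j * cdot (f j) (e i).
Proof. by rewrite cdot_suml; apply: eq_bigr => j _; rewrite cdotZl. Qed.


Lemma basis_eq0 u : (forall i, cdot u (e i) = 0) -> u = 0.
Proof. by move=> h; rewrite [u]basis_expand big1// => i _; rewrite h scale0r. Qed.

Lemma dim_coord (W : set 'cV[C]_p) (I : pred 'I_p) :
  (forall u, W u <-> forall i, ~~ I i -> cdot u (e i) = 0) ->
  dimension W = (#|[pred i | I i]|%:R)%:E.
Proof.
move=> hW; apply/eqP; rewrite eq_le; apply/andP; split.
  apply: ge_ereal_sup => _ [n [v [hv iv]] <-]; rewrite lee_fin ler_nat leqNgt.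
  apply/negP => nI.
  have hJ : (#|{: {i | I i}}| < #|'I_n|)%N by rewrite card_sig card_ord.
  have [c [[j cj] hc]] := nz_comb (fun (j : 'I_n) (i : {i | I i}) => cdot (v j) (e (sval i))) hJ.
  suff : \sum_j c j *: v j = 0 by move=> /iv /(_ j) c0; rewrite c0 eqxx in cj.
  apply: basis_eq0 => i; rewrite cdot_expand.
  have [Ii|Ii] := boolP (I i); first by rewrite (hc (exist _ i Ii)).
  by rewrite big1// => k _; have /hW/(_ _ Ii) -> := hv k; rewrite mulr0.
apply: ereal_sup_ubound; exists #|[pred i | I i]| => //.
exists (fun j => e (enum_val j)); split.
  move=> j; apply/hW => i Ii; rewrite cdot_basis.
  have := enum_valP j; rewrite inE => h; case: eqP => // ei.
  by move: Ii; rewrite ei h.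
move=> c h j.
have := congr1 (fun x => cdot x (e (enum_val j))) h; rewrite cdot0l cdot_expand.
rewrite (bigD1 j)//= cdot_basis eqxx mulr1 big1 ?addr0// => k kj.
have /negbTE ne : enum_val j != enum_val k by rewrite (inj_eq enum_val_inj) eq_sym.
by rewrite cdot_basis ne mulr0.
Qed.

Variables (mu : 'I_p -> bool) (lam : 'I_p -> R).
Variable S : set ('cV[C]_p * 'cV[C]_p).
Hypothesis Ssa : selfadjoint_rel S.
Hypothesis hS : forall i,
  S (if mu i then 0 else e i, if mu i then e i else (lam i)%:C *: e i).

(* Positive spectral directions, the eigenvalue [+oo] included. *)
Definition pflag i := mu i || (0 < lam i).

Lemma sa_mul i u w : S (u, w) -> mu i -> cdot u (e i) = 0.
Proof.
move=> h mi; have := hS i; rewrite mi => hi.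
have := sa_sym Ssa h hi; rewrite cdot0l -cdotC => /(congr1 (@Num.conj C)).
by rewrite conjCK rmorph0.
Qed.

Lemma sa_eig i u w : S (u, w) -> ~~ mu i -> cdot w (e i) = (lam i)%:C * cdot u (e i).
Proof.
move=> h /negbTE mi; have := hS i; rewrite mi => hi.
have := sa_sym Ssa hi h; rewrite cdotZr => ->.
by congr (_ * _); apply: complexP; rewrite ?Re_conjC ?Im_conjC //= oppr0.
Qed.

Lemma sa_span (c : 'I_p -> C) :
  S (\sum_i c i *: (if mu i then 0 else e i),
     \sum_i c i *: (if mu i then e i else (lam i)%:C *: e i)).
Proof. by apply: sa_sum => // i _; exact: saZ. Qed.

Lemma mulpart_dim : dimension (mulpart S) = (#|[pred i | mu i]|%:R)%:E.
Proof.
apply: dim_coord => w; split=> [h i mi|h].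
  by have := sa_eig h mi; rewrite cdot0l mulr0.
have := sa_span (fun i => cdot w (e i)).
rewrite big1 => [|i _]; last by case: ifP => mi; rewrite ?scaler0// h ?mi// scale0r.
congr (S (_, _)); rewrite [RHS]basis_expand; apply: eq_bigr => i _.
by case: ifP => // mi; rewrite h ?mi// !scale0r.
Qed.

Lemma ker_sub_dim (z : C) : 0 < z ->
  dimension (ker_sub S z) = (#|[pred i | ~~ mu i && ((lam i)%:C == z)]|%:R)%:E.
Proof.
move=> z0; apply: (@dim_coord _ (fun i => ~~ mu i && ((lam i)%:C == z))) => u; split=> [h i|h].
  rewrite negb_and negbK => /orP[mi|lz]; first exact: sa_mul h mi.
  have [mi|mi] := boolP (mu i); first exact: sa_mul h mi.
  have := sa_eig h mi; rewrite cdotZl => /eqP; rewrite -subr_eq0 -mulrBl mulf_eq0.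
  by rewrite subr_eq0 eq_sym (negbTE lz) => /eqP.
have hm i : mu i -> cdot u (e i) = 0 by move=> mi; apply: h; rewrite mi.
have hz i : (lam i)%:C != z -> cdot u (e i) = 0.
  by move=> lz; apply: h; rewrite (negbTE lz) andbF.
have := sa_span (fun i => cdot u (e i)).
congr (S (_, _)); first rewrite [RHS]basis_expand;
  last rewrite [in RHS](basis_expand u) scaler_sumr.
  by apply: eq_bigr => i _; case: ifP => // mi; rewrite (hm i mi) 2!scale0r.
apply: eq_bigr => i _; case: ifP => mi; first by rewrite (hm i mi) scale0r scaler0.
have [/eqP <-|lz] := boolP ((lam i)%:C == z); first by rewrite !scalerA mulrC.
by rewrite (hz i lz) 2!scale0r scaler0.
Qed.

Lemma kappa_posE : kappa_pos S = (#|[pred i | pflag i]|%:R)%:E.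
Proof.
rewrite /kappa_pos mulpart_dim.
rewrite (eq_esum
    (b := fun z : C => (#|[pred i | ~~ mu i && ((lam i)%:C == z)]|%:R)%:E)); last first.
  by move=> z z0; exact: ker_sub_dim.
rewrite (@esum_count R _ _ _ (fun i => ~~ mu i) (fun i => (lam i)%:C)) -EFinD -natrD addnC.
have e i : ((lam i)%:C \in [set z : C | 0 < z]) = (0 < lam i).
  by apply/idP/idP => [/set_mem|h]; [|apply/mem_set]; rewrite /= ltcR.
congr (_%:R%:E); rewrite -(cardID mu [pred i | pflag i]); congr (_ + _)%N.
  by apply: eq_card => i; rewrite !inE /= /pflag -?topredE /=; case: (mu i); rewrite ?andbF ?andbT.
by apply: eq_card => i; rewrite !inE /= e /pflag -?topredE /=; case: (mu i); rewrite ?andbF ?andbT.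
Qed.

Lemma unflagged_nonpos u : (forall i, pflag i -> cdot u (e i) = 0) ->
  exists2 w, S (u, w) & Re (cdot w u) <= 0.
Proof.
move=> h; pose w := \sum_i cdot u (e i) *: (if mu i then e i else (lam i)%:C *: e i).
have hw : S (u, w).
  have := sa_span (fun i => cdot u (e i)); congr (S (_, _)).
  rewrite [RHS]basis_expand; apply: eq_bigr => i _.
  by case: ifP => // mi; rewrite h ?scale0r// /pflag mi.
exists w => //; rewrite {1}(basis_expand u) cdot_sumr Re_sum.
apply: sumr_le0 => i _; rewrite cdotZr.
have [mi|mi] := boolP (mu i); first by rewrite h ?rmorph0 ?mul0r// /pflag mi.
rewrite (sa_eig hw mi) mulrCA -nsqCE -rmorphM /=.
have [li|li] := ltP 0 (lam i); last by rewrite mulr_le0_ge0// nsqC_ge0.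
by rewrite h ?/pflag ?li ?orbT// /nsqC /= expr0n addr0 mulr0.
Qed.

(** A family larger than the set of positive directions has a nonzero combination orthogonal to all
    of them; there the form of [S] is at most 0, against [0 < h]. As [h] only has to lie below the
    form of [S], it may be the form of an approximating matrix. *)
Lemma positive_family_le (I : finType) (k : I -> 'cV[C]_p) (h : 'cV[C]_p -> R) :
  (forall u w, S (u, w) -> h u <= Re (cdot w u)) ->
  (forall c, (exists i, c i != 0) -> 0 < h (\sum_i c i *: k i)) ->
  (#|I| <= #|[pred i | pflag i]|)%N.
Proof.
move=> hle hpos; rewrite leqNgt; apply/negP => lt.
have hJ : (#|{: {i | pflag i}}| < #|I|)%N by rewrite card_sig.
have [c [cn0 hc]] := nz_comb (fun (j : I) (i : {i | pflag i}) => cdot (k j) (e (sval i))) hJ.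
have [|w hw wle] := @unflagged_nonpos (\sum_j c j *: k j).
  by move=> i fi; rewrite cdot_expand (hc (exist _ i fi)).
have := lt_le_trans (hpos c cn0) (le_trans (hle _ _ hw) wle).
by rewrite ltxx.
Qed.

End Diagonal.

(** * The limit of the Weyl function at minus infinity *)

Section MatrixForms.
Variable R : realType.
Local Notation C := (complexC R).
Local Notation Re := (@complex.Re R).
Variable p : nat.
Implicit Types (X Y Z : 'M[C]_p) (k : 'cV[C]_p).

Lemma mqB X Y k : mq (X - Y) k = mq X k - mq Y k.
Proof. by rewrite /mq mulmxBl cdotBl ReD ReN. Qed.

Lemma mqD X Y k : mq (X + Y) k = mq X k + mq Y k.
Proof. by rewrite /mq mulmxDl cdotDl ReD. Qed.

Lemma mqMl X Y k : mq (X *m Y) k = Re (cdot (X *m (Y *m k)) k).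
Proof. by rewrite /mq mulmxA. Qed.

Lemma mqMt X Y k : mq (X^t* *m Y) k = Re (cdot (Y *m k) (X *m k)).
Proof. by rewrite mqMl cdotMl trmxCK. Qed.

Lemma mq_congr X Z k : mq (Z^t* *m X *m Z) k = mq X (Z *m k).
Proof. by rewrite -mulmxA mqMt -mulmxA. Qed.

Lemma mq_sub X f g : cdot (X *m f) g = cdot f (X *m g) ->
  mq X (f - g) = mq X f - 2 * Re (cdot (X *m g) f) + Re (cdot (X *m g) g).
Proof.
move=> h; rewrite /mq mulmxBr; move: (X *m f) (X *m g) h => f' g' h.
rewrite cdotBl !cdotBr h -[cdot f g']cdotC !(ReD, ReN) Re_conjC.
move: (Re _) (Re _) (Re _) => a b c; ring.
Qed.

Lemma mq_bound Z (e : R) k : 0 <= e -> nnM Z <= e ^+ 2 -> `|mq Z k| <= e * nn k.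
Proof.
move=> e0 h; have n0 := nn_ge0 k.
rewrite -(@ler_pXn2r _ 2)// ?nnegrE ?normr_ge0 ?mulr_ge0// real_normK ?num_real//.
apply: (le_trans (Re_sqr_le _)); apply: (le_trans (cdot_cs _ _)).
rewrite exprMn [nn k ^+ 2]expr2 mulrA; apply: ler_wpM2r => //.
apply: (le_trans (nn_mulmx_le _ _)); exact: ler_wpM2r.
Qed.

Lemma nnM_trace Z : nnM Z = Re (\sum_j (Z^t* *m Z) j j).
Proof.
rewrite nnM_cols Re_sum; apply: eq_bigr => j _; congr Re.
by rewrite cdotE mxE; apply: eq_bigr => i _; rewrite !mxE mulrC.
Qed.

Lemma mq_cvg (T : Type) (F : set_system T) (FF : ProperFilter F)
    (Y : T -> 'M[C]_p) Y0 (e : R) : 0 < e -> Y @ F --> Y0 ->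
  \forall x \near F, forall k, `|mq (Y x) k - mq Y0 k| <= e * nn k.
Proof.
move=> e0 hY; have FF' : Filter F by exact: filter_filter.
have h1 : (fun x => Y x - Y0) @ F --> (0 : 'M[C]_p).
  by rewrite -(subrr Y0); apply: cvgB hY _; exact: cvg_cst.
have h2 : (fun x => nnM (Y x - Y0)) @ F --> (0 : R).
  have -> : (fun x => nnM (Y x - Y0)) =
      (fun x => Re (\sum_j ((Y x - Y0)^t* *m (Y x - Y0)) j j)).
    by apply/funext => x; exact: nnM_trace.
  have -> : 0 = Re (\sum_(j < p) (0 : C)) by rewrite big1.
  apply: cvgC_Re; apply: cvg_sumC => j.
  have /cvg_mx/(_ j j) h3 := cvg_mulmx FF' (cvg_tC FF' h1) h1.
  have e3 : ((0 : 'M[C]_p)^t* *m (0 : 'M[C]_p)) j j = 0 by rewrite mulmx0 mxE.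
  by rewrite e3 in h3; exact: h3.
have e2 : 0 < e ^+ 2 by exact: exprn_gt0.
near=> x => k; rewrite -mqB; apply: mq_bound; first exact: ltW.
near: x; have := @cvgr_lt _ _ _ FF _ _ h2 _ e2; apply: filterS => x; exact: ltW.
Unshelve. all: by end_near.
Qed.

End MatrixForms.

(** * Self-adjointness of the relation [CDN K D N] *)

Section RelationCDN.
Variable R : realType.
Local Notation C := (complexC R).
Local Notation ii := ('i%C : C).
Variable p : nat.

Lemma cdot_col_mx m n (k a : 'cV[C]_m) (w b : 'cV[C]_n) :
  cdot (col_mx k w) (col_mx a b) = cdot k a + cdot w b.
Proof.
rewrite !cdotE big_split_ord/=; congr (_ + _); apply: eq_bigr => i _.
  by rewrite !col_mxEu.
by rewrite !col_mxEd.
Qed.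

Lemma tC_row_mx m n q (X : 'M[C]_(m, n)) (Y : 'M[C]_(m, q)) :
  (row_mx X Y)^t* = col_mx (X^t*) (Y^t*).
Proof. by rewrite tr_row_mx map_col_mx. Qed.

Variables K D : 'M[C]_p.
Hypothesis KD : K *m D^t* = D *m K^t*.
Variable N : set ('cV[C]_p * 'cV[C]_p).
Hypothesis Nsa : selfadjoint_rel N.

Lemma KD_sym u v : cdot (K *m D^t* *m u) v = cdot u (K *m D^t* *m v).
Proof. by rewrite [LHS]cdotMl mulmxtC trmxCK -KD. Qed.

Lemma CDN_selfadjoint : selfadjoint_rel (CDN K D N).
Proof.
apply/seteqP; split=> [[a b] [g hg /= eb]|[a b] [_ _ /= h]].
  split=> // -[k l] [g' hg' /= ->] /=; rewrite eb cdotBl cdotBr KD_sym; congr (_ - _).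
  by rewrite cdotMl (sa_sym Nsa hg hg') cdotMl trmxCK.
have [Rm hR] := sa_resolvent Nsa.
have hk k w : D^t* *m k = Rm *m w ->
    cdot k (K *m D^t* *m a - b) = cdot w (D^t* *m a + (ii^*)%R *: (Rm^t* *m (D^t* *m a))).
  move=> e.
  have : CDN K D N (k, K *m D^t* *m k - D *m (w + ii *: (Rm *m w))).
    by exists (w + ii *: (Rm *m w)) => //=; rewrite e.
  move=> /h /= h1; rewrite cdotBr -h1 cdotBl KD_sym cdotMl cdotDl cdotZl cdotMl.
  rewrite cdotDr cdotZr conjCK; move: (cdot _ _) (cdot _ _) (_ * _) => x y z.
  by ring.
pose v := col_mx (K *m D^t* *m a - b) (- (D^t* *m a + (ii^*)%R *: (Rm^t* *m (D^t* *m a)))).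
have [w|y] := @orth_ker_range R p (p + p) (row_mx (D^t*) (- Rm)) v.
  rewrite -[w]vsubmxK mul_row_col mulNmx => /subr0_eq /hk e.
  by rewrite cdot_col_mx e cdotNr subrr.
rewrite tC_row_mx mul_col_mx trmxCK tCN mulNmx => /eq_col_mx [e1 /oppr_inj e2].
exists y => /=; last by rewrite -e1 opprB addrC subrK.
apply/(saP Nsa) => f g /(sa_resolventP Nsa hR) [w -> ->].
rewrite cdotDl cdotZl !cdotMl -e2 cdotDr cdotZr conjCK; congr (_ + _ * _).
Qed.

End RelationCDN.

(** * Comparison of the limit relation with the approximating forms *)

Section ResolventLimit.
Variable R : realType.
Local Notation C := (complexC R).
Local Notation Re := (@complex.Re R).
Local Notation ii := ('i%C : C).
Variable p : nat.
Variable X : R -> 'M[C]_p.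
Hypothesis Xherm : forall x a b, x < 0 -> cdot (X x *m a) b = cdot a (X x *m b).
Hypothesis Xmono : forall x y a, x <= y -> y < 0 -> mq (X x) a <= mq (X y) a.
Variable N : set ('cV[C]_p * 'cV[C]_p).
Hypothesis hN : strong_resolvent_limit X N.

Local Notation Rx x := (invmx (X x - ii%:M)).

Lemma resolvent_unit x : x < 0 -> X x - ii%:M \in unitmx.
Proof.
move=> x0; apply: inj_unitmx => c; rewrite mulmxBl mul_scalar_mx => /subr0_eq e.
apply: nn_eq0; apply: ii_nn; have := Xherm c c x0.
by rewrite e cdotZl cdotZr cdot_nn conj_ii.
Qed.

Lemma resolvent_mul x (w : 'cV[C]_p) : x < 0 -> X x *m (Rx x *m w) = w + ii *: (Rx x *m w).
Proof.
move=> x0; have := mulKVmx (resolvent_unit x0) w.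
rewrite mulmxBl mul_scalar_mx => h; by rewrite -{2}h subrK.
Qed.

Lemma resolvent_lim f g : N (f, g) -> (fun x => Rx x *m (g - ii *: f)) @ -oo --> f.
Proof.
move=> h; apply: (hN.2 ii) h.
by rewrite -complexIm /= oner_neq0.
Qed.

(** The vectors [Rx y *m w] tend to [f], and their images under [X y] tend to [g] by the resolvent
    equation. Monotonicity replaces [X y] by the fixed [X x] before the limit is taken. *)
Lemma limit_form_le f g x : N (f, g) -> x < 0 -> Re (cdot g f) <= mq (X x) f.
Proof.
move=> h x0; set w := g - ii *: f; have hl := resolvent_lim h.
have nF : Filter (ninfty_nbhs R) by exact: filter_filter.
have hg : (fun y => w + ii%:M *m (Rx y *m w)) @ -oo --> g.
  have -> : g = w + ii%:M *m f by rewrite mul_scalar_mx /w subrK.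
  apply: cvgD; first exact: cvg_cst.
  by apply: cvg_mulmx hl; exact: cvg_cst.
have h1 : (fun y => mq (X x) (Rx y *m w)) @ -oo --> mq (X x) f.
  apply: cvgC_Re; apply: (cvg_cdot nF _ hl).
  by apply: cvg_mulmx hl; exact: cvg_cst.
have h2 := cvgC_Re nF (cvg_cdot nF hg hl).
rewrite -subr_ge0; apply: (cvgr_to_ge (cvgB h1 h2)).
near=> y.
have yx : y <= x by near: y; exact: nbhs_ninfty_le (num_real _).
have y0 : y < 0 by exact: le_lt_trans x0.
rewrite subr_ge0 /= mul_scalar_mx -resolvent_mul//.
by have := Xmono (Rx y *m w) yx x0; apply: le_trans.
Unshelve. all: by end_near.
Qed.


Variables K D : 'M[C]_p.
Hypothesis KD : K *m D^t* = D *m K^t*.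
Variables (U : 'M[C]_p) (mu : 'I_p -> bool) (lam : 'I_p -> R).
Hypothesis UU : U^t* *m U = 1%:M.
Hypothesis UU' : U *m U^t* = 1%:M.
Local Notation e i := (col i U).
Hypothesis hS : forall i,
  CDN K D N (if mu i then 0 else e i, if mu i then e i else (lam i)%:C *: e i).

Definition hform x k := Re (cdot (K *m D^t* *m k) k) - mq (X x) (D^t* *m k).

(* A lower bound of [hform x] which, unlike [X x], converges as [x --> -oo]. *)
Local Notation Y Phi G := (K *m D^t* -
  ((D^t* - Phi)^t* *m X (-1) *m (D^t* - Phi) + (D *m G + D *m G) - Phi^t* *m G)).

Lemma mq_Y (Phi G : 'M[C]_p) k : mq (Y Phi G) k =
  Re (cdot (K *m D^t* *m k) k) - (mq (X (-1)) (D^t* *m k - Phi *m k) +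
    2 * Re (cdot (D *m (G *m k)) k) - Re (cdot (G *m k) (Phi *m k))).
Proof.
rewrite mqB; congr (_ - _).
rewrite mqB !mqD -[D^t* *m k - _]mulmxBl; move: (D^t* - Phi) => Z.
rewrite mq_congr mqMl mqMt; move: (mq _ _) (Re _) (Re _) => a b c; ring.
Qed.

Lemma quad_alg (m' a b c : R) : a - 2 * b + c <= m' -> a <= m' + 2 * b - c.
Proof. by lra. Qed.

(** Complete the square of [X x] around [ph]. Only the remaining square is estimated, by comparison
    with the reference point -1; elsewhere [X x] occurs as [X x *m ph], which the resolvent equation
    expresses by [w] and [ph]. *)
Lemma hform_ge x (w : 'M[C]_p) k : x <= -1 ->
  mq (Y (Rx x *m w) (w + ii *: (Rx x *m w))) k <= hform x k.
Proof.
move=> x1; have x0 : x < 0 by lra.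
rewrite mq_Y /hform; apply: lerB => //.
have -> : (w + ii *: (Rx x *m w)) *m k = X x *m (Rx x *m w *m k).
  by rewrite -mulmxA resolvent_mul// mulmxDl -scalemxAl -mulmxA.
set f := D^t* *m k; set ph := Rx x *m w *m k; set g := X x *m ph.
have -> : cdot (D *m g) k = cdot g f by rewrite cdotMl.
apply: quad_alg; rewrite -(mq_sub (Xherm f ph x0)).
exact: Xmono (f - ph) x1 (ltrN10 R).
Qed.

Lemma hformE x k : hform x k = mq (K *m D^t* - D *m X x *m D^t*) k.
Proof.
have -> : D *m X x *m D^t* = (D^t*)^t* *m X x *m D^t* by rewrite trmxCK.
by rewrite mqB mq_congr.
Qed.

(** [(kp, b)] plays the part of an element of the limit relation: for [k = kp] the value is its
    form. The difference [k - kp], reserved for multivalued directions, enters through the fixed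
    form [hform (-1)]. *)
Lemma mq_Y_value (Phi G : 'M[C]_p) k kp b :
  Phi *m k = D^t* *m kp -> D *m (G *m k) = K *m D^t* *m kp - b ->
  mq (Y Phi G) k = hform (-1) (k - kp) + Re (cdot b (k + (k - kp))).
Proof.
move=> hP hG; rewrite mq_Y hP -cdotMl hG -mulmxBr /hform.
have -> : Re (cdot (K *m D^t* *m (k - kp)) (k - kp)) = mq (K *m D^t*) (k - kp) by [].
rewrite (mq_sub (KD_sym KD k kp)) /mq; move: (K *m D^t* *m kp) => q.
rewrite !cdotBl !cdotDr cdotNr !(ReD, ReN).
move: (Re _) (Re _) (Re _) (Re _) (Re _) (Re _) => a1 a2 a3 a4 a5 a6; ring.
Qed.

Local Notation cols f := (\matrix_(r, i) (f i : 'cV[C]_p) r 0 : 'M[C]_p).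

Lemma cols_mul (f : 'I_p -> 'cV[C]_p) k :
  cols f *m U^t* *m k = \sum_i cdot k (e i) *: f i.
Proof.
apply/matrixP => r j; rewrite (ord1 j) summxE -mulmxA mxE; apply: eq_bigr => i _.
rewrite [LHS]mulrC !mxE; congr (_ * _); rewrite cdotE.
by apply: eq_bigr => l _; rewrite !mxE mulrC.
Qed.

Lemma cols_mulmx (T : 'M[C]_p) (f : 'I_p -> 'cV[C]_p) r i :
  (T *m cols f) r i = (T *m f i) r 0.
Proof. by rewrite !mxE; apply: eq_bigr => l _; rewrite mxE. Qed.

Lemma flag_gap : exists2 d : R, 0 < d &
  forall i, pflag mu lam i -> d <= if mu i then 1 else lam i.
Proof.
exists (\big[Order.min/1]_(i | pflag mu lam i) (if mu i then 1 else lam i)).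
  apply: lt_bigmin => // i; rewrite /pflag; case: ifP => //= _.
by move=> i hi; exact: bigmin_le_cond.
Qed.

Lemma nn_basis (k : 'cV[C]_p) : nn k = \sum_i nsqC (cdot k (e i)).
Proof.
rewrite /nn {1}(basis_expand UU' k) cdot_suml Re_sum; apply: eq_bigr => i _.
by rewrite cdotZl -[cdot (e i) k]cdotC mulrC -nsqCE.
Qed.

Lemma positive_alg (y1 y2 y3 d n : R) : 0 < d / 2 * n -> d * n <= y1 ->
  - (d / 2 * n) <= y2 - y1 -> y2 <= y3 -> 0 < y3.
Proof. by lra. Qed.

Lemma weight_alg_mul (z : C) (r : R) :
  Re (z * (r%:C * ((z + z)^*)%R)) = 2 * r * nsqC z.
Proof. by rewrite /nsqC !(ReM, ImM, Re_conjC, Im_conjC, ReD, ImD) /=; ring. Qed.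

Lemma weight_alg_eig (z : C) (r : R) :
  Re (z * (1%:C * (r%:C * (z^*)%R))) = r * nsqC z.
Proof. by rewrite /nsqC !(ReM, ImM, Re_conjC, Im_conjC, ReD, ImD) /=; ring. Qed.

(** The bound [Y], built from eigenpairs of the limit relation and their partners in [N], converges
    as a matrix, and its limit is at least [d * nn k] on the positive subspace. Matrix convergence
    is uniform in [k], so one [x0] serves all [k]. *)
Lemma eventually_positive : exists2 x0, x0 < 0 & forall k, k != 0 ->
  (forall i, ~~ pflag mu lam i -> cdot k (e i) = 0) -> 0 < hform x0 k.
Proof.
pose a i : 'cV[C]_p := if mu i then 0 else e i.
pose b i := if mu i then e i else (lam i)%:C *: e i.
have hx i : exists g, N (D^t* *m a i, g) /\ D *m g = K *m D^t* *m a i - b i.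
  have [g h1 /= h2] := hS i; exists g; split; first exact: h1.
  by rewrite /b h2 opprB addrC subrK.
have [g hg] := choice hx.
pose L : R := 1 + nnM (K *m D^t* - D *m X (-1) *m D^t*).
have nL := nnM_ge0 (K *m D^t* - D *m X (-1) *m D^t*).
have hL k : `|hform (-1) k| <= L * nn k.
  rewrite hformE; apply: mq_bound; first by rewrite addr_ge0.
  by move: nL; rewrite /L; move: (nnM _) => n n0; nra.
(* For [mu i] the pair [(0, g i)] lies in [N] and may be rescaled; the factor
   [L + 1] outweighs the contribution of [hform (-1)] in that direction. *)
pose t i : R := if mu i then L + 1 else 1.
have hta i : (t i)%:C *: a i = a i.
  by rewrite /t /a; case: ifP; rewrite ?scaler0 ?scale1r.
pose w i := (t i)%:C *: g i - ii *: (D^t* *m a i).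
have hw i : (fun x => Rx x *m w i) @ -oo --> D^t* *m a i.
  apply: resolvent_lim; have := saZ hN.1 (t i)%:C (hg i).1.
  by rewrite scalemxAr hta.
pose W := cols w *m U^t*; pose Phi := cols (fun i => D^t* *m a i) *m U^t*.
have nF : Filter (ninfty_nbhs R) by exact: filter_filter.
have hW : (fun x => Rx x *m W) @ -oo --> Phi.
  have h1 : (fun x => Rx x *m cols w) @ -oo --> cols (fun i => D^t* *m a i).
    apply/cvg_mx => r i; rewrite [X in _ --> X]mxE.
    have -> : (fun x => (Rx x *m cols w) r i) = (fun x => (Rx x *m w i) r 0).
      by apply/funext => x; rewrite cols_mulmx.
    by have /cvg_mx := hw i; apply.
  have -> : (fun x => Rx x *m W) = (fun x => Rx x *m cols w *m U^t*).
    by apply/funext => x; rewrite mulmxA.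
  by apply: (cvg_mulmx nF h1); exact: cvg_cst.
have hG : (fun x => W + ii *: (Rx x *m W)) @ -oo --> W + ii *: Phi.
  have -> : (fun x => W + ii *: (Rx x *m W)) = (fun x => W + ii%:M *m (Rx x *m W)).
    by apply/funext => x; rewrite mul_scalar_mx.
  rewrite -mul_scalar_mx; apply: cvgD; first exact: cvg_cst.
  by apply: (cvg_mulmx nF _ hW); exact: cvg_cst.
have hY : (fun x => Y (Rx x *m W) (W + ii *: (Rx x *m W))) @ -oo --> Y Phi (W + ii *: Phi).
  have c (Z : 'M[C]_p) : (fun _ : R => Z) @ -oo --> Z by exact: cvg_cst.
  have cB : (fun x => D^t* - Rx x *m W) @ -oo --> D^t* - Phi by apply: cvgB hW; exact: c.
  have cG := cvg_mulmx nF (c D) hG.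
  apply: cvgB; first exact: c.
  apply: cvgB; last exact: (cvg_mulmx nF (cvg_tC nF hW) hG).
  apply: cvgD; last by apply: cvgD.
  exact: (cvg_mulmx nF (cvg_mulmx nF (cvg_tC nF cB) (c _)) cB).
have [d d0 hd] := flag_gap; have d20 : 0 < d / 2 by lra.
(* Half of the gap [d] pays for the distance of [Y] from its limit; [x <= -1] is what [hform_ge]
   requires. *)
have [x [x1 hx1]] := filter_ex (filterI (nbhs_ninfty_le (num_real (-1 : R)))
  (mq_cvg (proper_ninfty_nbhs (R := R)) d20 hY)).
exists x => [|k k0 hk]; first by lra.
pose c i := cdot k (e i).
(* [kp] is [k] without its multivalued components, where [a i = 0]. *)
pose kp := \sum_i c i *: a i; pose be := \sum_i c i *: ((t i)%:C *: b i).
have hP : Phi *m k = D^t* *m kp.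
  by rewrite cols_mul mulmx_sumr; apply: eq_bigr => i _; rewrite scalemxAr.
have hD : D *m ((W + ii *: Phi) *m k) = K *m D^t* *m kp - be.
  rewrite mulmxDl -scalemxAl !cols_mul scaler_sumr -big_split !mulmx_sumr -sumrB.
  apply: eq_bigr => i _ /=; rewrite -/(c i) scalerA [ii * _]mulrC -scalerA -scalerDr subrK.
  rewrite -!scalemxAr (hg i).2 -scalerBr; congr (_ *: _).
  by rewrite scalerBr [in LHS]scalemxAr hta.
have hkm i : cdot (k - kp) (e i) = if mu i then c i else 0.
  rewrite cdotBl -/(c i) cdot_expand (bigD1 i)//= big1 ?addr0 => [|j ji]; last first.
    rewrite /a; case: ifP => _; first by rewrite cdot0l mulr0.
    by rewrite (cdot_basis UU) eq_sym (negbTE ji) mulr0.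
  rewrite /a; case: ifP => _; first by rewrite cdot0l mulr0 subr0.
  by rewrite (cdot_basis UU) eqxx mulr1 subrr.
have z0 : nsqC (0 : C) = 0 by rewrite /nsqC /= expr0n addr0.
have lb : d * nn k <= mq (Y Phi (W + ii *: Phi)) k.
  rewrite (mq_Y_value hP hD).
  have h1 : - (L * nn (k - kp)) <= hform (-1) (k - kp).
    by have := hL (k - kp); rewrite ler_norml => /andP[].
  apply: le_trans (lerD h1 (lexx _)).
  rewrite !nn_basis cdot_suml Re_sum !mulr_sumr -sumrN -big_split; apply: ler_sum => i _ /=.
  have -> : Re (cdot (c i *: ((t i)%:C *: b i)) (k + (k - kp))) =
      (if mu i then 2 * (L + 1) else lam i) * nsqC (c i).
    have e1 : cdot (e i) (k + (k - kp)) = ((if mu i then c i + c i else c i)^*)%R.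
      rewrite -[LHS]conjCK cdotC cdotDl hkm -/(c i); by case: ifP => _; rewrite ?addr0.
    rewrite /t /b cdotZl cdotZl; case: ifP e1 => _ e1; rewrite ?cdotZl e1.
      exact: weight_alg_mul.
    exact: weight_alg_eig.
  rewrite hkm -/(c i); have nc := nsqC_ge0 (c i).
  have [fi|fi] := boolP (pflag mu lam i); last first.
    by rewrite /c hk// if_same z0 !mulr0 oppr0 add0r.
  (* In a multivalued direction the coefficient is -L + 2(L + 1), which exceeds 1 and hence [d];
     elsewhere it is [lam i]. *)
  have := hd i fi; case: ifP => _ hdi.
    rewrite -mulNr -mulrDl; apply: ler_wpM2r => //; have : 1 <= L by rewrite /L lerDl.
    by move: hdi; lra.
  by rewrite z0 mulr0 oppr0 add0r; apply: ler_wpM2r.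
have := hx1 k; rewrite ler_norml => /andP[h1 _].
have n0 : 0 < nn k.
  by rewrite lt_def nn_ge0 andbT; apply: contra k0 => /eqP /nn_eq0 ->.
exact: positive_alg (mulr_gt0 d20 n0) lb h1 (hform_ge W k x1).
Qed.

End ResolventLimit.

(** * Crossing of eigenvalues *)

(** Rank-nullity for the matrix of conditions: the [c j] are a basis of its left kernel. *)
Lemma indep_combs (F : fieldType) (n : nat) (J : finType) (a : 'I_n -> J -> F) :
  exists q (c : 'I_q -> 'I_n -> F), [/\ (n <= q + #|J|)%N,
    forall j i, \sum_l c j l * a l i = 0 &
    forall d : 'I_q -> F, (forall l, \sum_j d j * c j l = 0) -> forall j, d j = 0].
Proof.
pose X : 'M[F]_(n, #|J|) := \matrix_(l, i) a l (enum_val i).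
exists (\rank (kermx X)), (fun j l => row_base (kermx X) j l); split.
- by rewrite mxrank_ker; have := rank_leq_col X; have := rank_leq_row X; lia.
- move=> j i.
  have /sub_kermxP e : (row_base (kermx X) <= kermx X)%MS by rewrite eq_row_base.
  have /matrixP/(_ j (enum_rank i)) := e; rewrite !mxE => h; apply: etrans h.
  by apply: eq_bigr => l _; rewrite [X l _]mxE enum_rankK.
- move=> d hd j; have /row_freeP[Y hY] := row_base_free (kermx X).
  have e : \row_j d j *m row_base (kermx X) = 0.
    by apply/rowP => l; rewrite !mxE -[RHS](hd l); apply: eq_bigr => k _; rewrite mxE.
  have := congr1 (fun Z => (Z *m Y) 0 j) e.
  by rewrite -mulmxA hY mulmx1 mul0mx !mxE.
Qed.

Lemma dimension_ge0 (R : realType) (V : lmodType R[i]) (W : set V) : (0 <= dimension W)%E.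
Proof.
apply: ereal_sup_ubound; exists 0%N => //=.
by exists (fun=> 0); split=> [[]//|c _ []//].
Qed.

Lemma le_sqr1D (K : realFieldType) (n : K) : 0 <= n -> n <= (1 + n) ^+ 2.
Proof. by move=> n0; nra. Qed.

Lemma modulus_alg (K : realFieldType) (L m t e n : K) : 0 <= L * m -> 0 <= t -> 0 <= n ->
  t * (L * m + 1) < e -> L * t * (m * n) <= e * n.
Proof.
move=> h1 h2 h3 h4; rewrite mulrA; apply: ler_wpM2r => //.
rewrite mulrAC; nra.
Qed.

Lemma nsqC0 (R : realType) :
  nsqC (0 : complexC R) = 0.
Proof. by rewrite /nsqC /= expr0n addr0. Qed.

Section Crossing.
Variable R : realType.
Local Notation C := (complexC R).
Local Notation Re := (@complex.Re R).
Variable p : nat.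
Variable X : R -> 'M[C]_p.
Hypothesis Xherm : forall x a b, x < 0 -> cdot (X x *m a) b = cdot a (X x *m b).
Hypothesis Xmono : forall x y a, x <= y -> y < 0 -> mq (X x) a <= mq (X y) a.
Hypothesis Xcont : forall s, s < 0 -> exists2 L : R, 0 <= L & forall y a, y <= s / 2 ->
  `|mq (X y) a - mq (X s) a| <= L * `|y - s| * nn a.
Hypothesis Xblow : forall t : R, 0 <= t -> exists2 x : R, x < 0 &
  forall a, t * nn a <= mq (X x) a.
Variables K D : 'M[C]_p.
Hypothesis KD : K *m D^t* = D *m K^t*.
Local Notation H x := (K *m D^t* - D *m X x *m D^t*).
Local Notation h := (hform X K D).
Implicit Types (x y s : R) (k u v : 'cV[C]_p).

Lemma Hherm x u v : x < 0 -> cdot (H x *m u) v = cdot u (H x *m v).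
Proof.
move=> x0; rewrite !mulmxBl cdotBl cdotBr (KD_sym KD); congr (_ - _).
by rewrite -!mulmxA cdotMl (Xherm _ _ x0) cdotMl trmxCK.
Qed.

Lemma graph_selfadjoint (Z : 'M[C]_p) : (forall u v, cdot (Z *m u) v = cdot u (Z *m v)) ->
  selfadjoint_rel [set x : 'cV[C]_p * 'cV[C]_p | x.2 = Z *m x.1].
Proof.
move=> hZ; apply/seteqP; split=> [[a b] /= ->|[a b] [_ _ /= hab]].
  by split=> // -[k l] /= ->; exact: hZ.
by apply: cdot_ext => w; rewrite hZ -cdotC -[RHS]cdotC; congr (_^*)%R; rewrite -(hab (w, Z *m w)).
Qed.

Lemma herm_diag (Z : 'M[C]_p) : (forall u v, cdot (Z *m u) v = cdot u (Z *m v)) ->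
  exists (U : 'M[C]_p) (lam : 'I_p -> R), [/\ U^t* *m U = 1%:M, U *m U^t* = 1%:M &
   forall i, Z *m col i U = (lam i)%:C *: col i U].
Proof.
move=> /graph_selfadjoint/sa_diag [U [mu [lam [h1 h2 h3]]]].
exists U, lam; split=> // i; have := h3 i; rewrite /=; case: ifP => // _ e.
by rewrite e !mulmx0 scaler0.
Qed.

Lemma form_diag (Z U : 'M[C]_p) (lam : 'I_p -> R) v : U *m U^t* = 1%:M ->
  (forall u v, cdot (Z *m u) v = cdot u (Z *m v)) ->
  (forall i, Z *m col i U = (lam i)%:C *: col i U) ->
  mq Z v = \sum_i lam i * nsqC (cdot v (col i U)).
Proof.
move=> UU' hZ hd; rewrite /mq {2}(basis_expand UU' v) cdot_sumr Re_sum.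
apply: eq_bigr => i _; rewrite cdotZr hZ hd cdotZr conj_real mulrCA.
by rewrite -nsqCE -rmorphM.
Qed.

Lemma spec_gap (lam : 'I_p -> R) : exists2 d : R, 0 < d &
  forall i, lam i != 0 -> d <= `|lam i|.
Proof.
exists (\big[Order.min/1]_(i | lam i != 0) `|lam i|).
  by apply: lt_bigmin => // i; rewrite normr_gt0.
by move=> i hi; exact: bigmin_le_cond.
Qed.

Lemma h_mono x y k : x <= y -> y < 0 -> h y k <= h x k.
Proof. by move=> xy y0; rewrite /hform; apply: lerB => //; exact: Xmono. Qed.

Lemma h_cont s (e : R) : s < 0 -> 0 < e -> exists2 dl : R, 0 < dl &
  forall y, `|y - s| < dl -> y < 0 /\ forall k, `|h y k - h s k| <= e * nn k.
Proof.
move=> s0 e0; have [L L0 hL] := Xcont s0.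
pose G := L * nnM (D^t*); have G0 : 0 <= G by rewrite mulr_ge0// nnM_ge0.
exists (Order.min (- s / 2) (e / (G + 1))).
  by rewrite lt_min divr_gt0 ?divr_gt0 ?oppr_gt0// ?ltr_wpDl.
move=> y; rewrite lt_min => /andP[y1 y2].
have ys : y <= s / 2 by move: y1; rewrite ltr_norml => /andP[]; lra.
split=> [|k]; first by lra.
rewrite /hform.
have -> (a b c : R) : a - b - (a - c) = - (b - c) by ring.
rewrite normrN; apply: (le_trans (hL _ _ ys)).
apply: (@le_trans _ _ (L * `|y - s| * (nnM (D^t*) * nn k))).
  by apply: ler_wpM2l; [rewrite mulr_ge0|exact: nn_mulmx_le].
move: y2; rewrite ltr_pdivlMr ?ltr_wpDl// => y2.
exact: (modulus_alg G0 (normr_ge0 _) (nn_ge0 k) y2).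
Qed.

(** Expresses that H(x) has at least [n] positive eigenvalues, in a form that survives small changes
    of [x] without reference to eigenvectors. *)
Definition positive_family x n := exists k : 'I_n -> 'cV[C]_p,
  forall c, (exists i, c i != 0) -> 0 < h x (\sum_i c i *: k i).

Lemma family_le x n : x < 0 -> forall (U : 'M[C]_p) (lam : 'I_p -> R),
  U^t* *m U = 1%:M -> U *m U^t* = 1%:M ->
  (forall i, H x *m col i U = (lam i)%:C *: col i U) ->
  positive_family x n -> (n <= #|[pred i | (0 < lam i)%R]|)%N.
Proof.
move=> x0 U lam UU UU' hd [k hk].
pose S := [set z : 'cV[C]_p * 'cV[C]_p | z.2 = H x *m z.1].
have Ssa : selfadjoint_rel S by apply: graph_selfadjoint => u v; exact: Hherm.
have hS i : S (if false then 0 else col i U, if false then col i U else (lam i)%:C *: col i U).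
  by rewrite /S /= hd.
have hle u w : S (u, w) -> h x u <= Re (cdot w u).
  by rewrite /S /= => ->; rewrite hformE.
have := positive_family_le UU' Ssa (mu := fun=> false) hS hle hk.
by rewrite card_ord.
Qed.

Lemma family_intro x n (U : 'M[C]_p) (lam : 'I_p -> R) (d : R) y :
  U^t* *m U = 1%:M -> U *m U^t* = 1%:M -> x < 0 ->
  (forall i, H x *m col i U = (lam i)%:C *: col i U) ->
  (forall i, 0 < lam i -> d < lam i) -> (forall k, `|h y k - h x k| <= d * nn k) ->
  (n <= #|[pred i | (0 < lam i)%R]|)%N -> positive_family y n.
Proof.
move=> UU UU' x0 hd hgap hc nle.
pose f (j : 'I_n) : 'I_p := enum_val (widen_ord nle j).
have fi : injective f by move=> i j /enum_val_inj [e]; exact: val_inj.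
have fpos j : 0 < lam (f j) by have := enum_valP (widen_ord nle j); rewrite inE.
exists (fun j => col (f j) U) => c [j0 cj0].
pose k := \sum_j c j *: col (f j) U.
have hck j : cdot k (col (f j) U) = c j.
  rewrite cdot_expand (bigD1 j)//= big1 => [|i ij]; last first.
    by rewrite (cdot_basis UU) (inj_eq fi) eq_sym (negbTE ij) mulr0.
  by rewrite (cdot_basis UU) eqxx mulr1 addr0.
have hck0 i : ~~ (0 < lam i) -> cdot k (col i U) = 0.
  move=> li; rewrite cdot_expand big1// => j _; rewrite (cdot_basis UU).
  by case: eqP => [e|_]; [move: li; rewrite e fpos|rewrite mulr0].
have hx : d * nn k < h x k.
  rewrite hformE (form_diag k UU' (fun u v => Hherm u v x0) hd) (nn_basis UU') mulr_sumr.
  rewrite (bigD1 (f j0))//= [ltRHS](bigD1 (f j0))//=; apply: ltr_leD.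
    rewrite hck ltr_pM2r ?hgap// lt_def nsqC_ge0 andbT.
    by apply: contra cj0 => /eqP/nsqC_eq0 ->.
  apply: ler_sum => i _; have [li|li] := boolP (0 < lam i); last by rewrite hck0// nsqC0 !mulr0.
  by apply: ler_wpM2r; [exact: nsqC_ge0|exact/ltW/hgap].
by have := hc k; rewrite ler_norml => /andP[]; move: hx; move: (h y k) (h x k) (d * nn k) => *; lra.
Qed.

(** By [KD] the form of [K *m D^t*] depends on [k] only through [D^t* *m k], so [k] may be replaced
    by a pseudo-inverse image [k'] controlled by that vector. The blow-up of [X] near 0 then
    outweighs it. *)
Lemma h_nonpos : exists2 x, x < 0 & forall k, h x k <= 0.
Proof.
pose L := 1 + nnM (K *m D^t*); pose G : 'M[C]_p := pinvmx (D^t*).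
have nL := nnM_ge0 (K *m D^t*); have nG := nnM_ge0 G.
have L0 : 0 <= L by rewrite addr_ge0.
have [x x0 hx] := Xblow (mulr_ge0 L0 nG); exists x => // k.
have [k' e1 hk'] : exists2 k', D^t* *m k' = D^t* *m k & nn k' <= nnM G * nn (D^t* *m k).
  exists (G *m (D^t* *m k)); last exact: nn_mulmx_le.
  have e0 : D^t* *m G *m D^t* = D^t* by exact: (mulmxKpV (submx_refl _)).
  by have := congr1 (fun Z : 'M[C]_p => Z *m k) e0; rewrite /= -!mulmxA.
have e2 : Re (cdot (K *m D^t* *m k) k) = mq (K *m D^t*) k'.
  have e : K *m D^t* *m k = K *m D^t* *m k' by rewrite -!mulmxA e1.
  by rewrite /mq e (KD_sym KD) e -(KD_sym KD).
rewrite /hform subr_le0 e2; apply: le_trans (hx _).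
apply: (le_trans (ler_norm _)).
apply: (@le_trans _ _ (L * nn k')).
  by apply: mq_bound => //; exact: le_sqr1D.
by rewrite -mulrA; exact: ler_wpM2l.
Qed.

(** [dimf z] stands for the dimension of the eigenspace of T_(C,D) at [z]. Independence is asked of
    the vectors [D^t* *m v j] because these are the values Gamma_0 of the eigenvectors built from
    [v j]. *)
Variable dimf : C -> \bar R.
Hypothesis dimf_ge0 : forall z, (0 <= dimf z)%E.
Hypothesis dimf_lower : forall s q (v : 'I_q -> 'cV[C]_p), s < 0 ->
  (forall j, H s *m v j = 0) ->
  (forall d : 'I_q -> C, \sum_j d j *: (D^t* *m v j) = 0 -> forall j, d j = 0) ->
  (q%:R%:E <= dimf s%:C)%E.

(** The combinations of the family orthogonal to the positive eigenvectors of H(s) are projected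
    onto ker H(s). This stays injective after [D^t*]: a combination [u] killed there has the same
    form at [y] as its negative part [w], where [h s w <= - d * nn w] and hence [h y w <= 0]. *)
Lemma crossing_step s y n (U : 'M[C]_p) (lam : 'I_p -> R) (d : R) :
  U^t* *m U = 1%:M -> U *m U^t* = 1%:M -> s < 0 ->
  (forall i, H s *m col i U = (lam i)%:C *: col i U) -> 0 < d ->
  (forall i, lam i < 0 -> lam i <= - d) -> (forall k, `|h y k - h s k| <= d * nn k) ->
  positive_family y n ->
  (n%:R%:E <= dimf s%:C + (#|[pred i | (0 < lam i)%R]|%:R)%:E)%E.
Proof.
move=> UU UU' s0 hd d0 hgap hc [k hk].
have [q [c [nq hca hci]]] := indep_combs
  (fun (l : 'I_n) (i : {i | 0 < lam i}) => cdot (k l) (col (sval i) U)).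
rewrite card_sig in nq.
pose v j := \sum_l c j l *: k l.
pose f i := if lam i == 0 then col i U else 0.
pose P0 : 'M[C]_p := (\matrix_(r, i) f i r 0) *m U^t*.
have P0E u : P0 *m u = \sum_i cdot u (col i U) *: f i by exact: cols_mul.
have P0c u i : cdot (P0 *m u) (col i U) = if lam i == 0 then cdot u (col i U) else 0.
  rewrite P0E cdot_expand (bigD1 i)//= big1 => [|j ji].
    rewrite addr0 /f; case: ifP => _; last by rewrite cdot0l mulr0.
    by rewrite (cdot_basis UU) eqxx mulr1.
  rewrite /f; case: ifP => _; last by rewrite cdot0l mulr0.
  by rewrite (cdot_basis UU) eq_sym (negbTE ji) mulr0.
have P0H u : H s *m (P0 *m u) = 0.
  rewrite P0E mulmx_sumr big1// => i _; rewrite -scalemxAr /f.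
  by case: eqP => [e|_]; rewrite ?mulmx0 ?scaler0// hd e scale0r scaler0.
suff : (q%:R%:E <= dimf s%:C)%E.
  move=> h1; apply: (@le_trans _ _ (q%:R%:E + (#|[pred i | (0 < lam i)%R]|%:R)%:E)%E).
    by rewrite -EFinD -natrD lee_fin ler_nat.
  exact: leeD.
apply: (@dimf_lower s q (fun j => P0 *m v j) s0) => [j|dd hdd]; first exact: P0H.
apply: hci; pose c' l := \sum_j dd j * c j l; rewrite -/c'.
pose u := \sum_l c' l *: k l.
have uE : u = \sum_j dd j *: v j.
  rewrite /u /v; under [RHS]eq_bigr do rewrite scaler_sumr.
  rewrite exchange_big; apply: eq_bigr => l _; rewrite scaler_suml.
  by apply: eq_bigr => j _; rewrite scalerA.
have DP : D^t* *m (P0 *m u) = 0.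
  by rewrite uE !mulmx_sumr -[RHS]hdd; apply: eq_bigr => j _; rewrite -!scalemxAr.
have upos i : 0 < lam i -> cdot u (col i U) = 0.
  move=> li; rewrite cdot_expand /c'; under eq_bigr do rewrite mulr_suml.
  rewrite exchange_big big1// => j _; under eq_bigr do rewrite -mulrA.
  by rewrite -mulr_sumr (hca j (exist _ i li)) mulr0.
apply: contrapT => /existsNP[l cl].
have c0 : exists i, c' i != 0 by exists l; exact/eqP.
have hu := hk c' c0; suff : h y u <= 0 by rewrite leNgt hu.
pose w := u - P0 *m u.
have Du : D^t* *m u = D^t* *m w by rewrite mulmxBr DP subr0.
(* By [KD], both terms of [h y] depend on the vector only through its image under [D^t*]. *)
have -> : h y u = h y w.
  rewrite /hform Du; congr (_ - _).
  have e : K *m D^t* *m u = K *m D^t* *m w by rewrite -!mulmxA Du.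
  by rewrite e (KD_sym KD) e -(KD_sym KD).
have wneg i : cdot w (col i U) != 0 -> lam i < 0.
  rewrite cdotBl P0c; case: (ltgtP (lam i) 0) => // [li|_]; last by rewrite subrr eqxx.
  by rewrite upos// subr0 eqxx.
have hsw : h s w <= - d * nn w.
  rewrite hformE (form_diag w UU' (fun u v => Hherm u v s0) hd) (nn_basis UU') mulr_sumr.
  apply: ler_sum => i _.
  have [->|/wneg li] := eqVneq (cdot w (col i U)) 0; first by rewrite nsqC0 !mulr0.
  by apply: ler_wpM2r; [exact: nsqC_ge0|exact: hgap].
have := hc w; rewrite ler_norml => /andP[_]; move: hsw.
move: (h s w) (h y w) (nn w) => a b t; lra.
Qed.

Local Notation gap x := [set z : C | x%:C < z < 0].

Lemma esum_gap x s : x < s -> s < 0 ->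
  (dimf s%:C + \esum_(z in gap s) dimf z <= \esum_(z in gap x) dimf z)%E.
Proof.
move=> xs s0; rewrite [leRHS](esumID [set (s%:C : C)])//.
have -> : gap x `&` [set (s%:C : C)] = [set (s%:C : C)].
  by apply/seteqP; split=> [z []//|z ->]; split=> //=; rewrite !ltcR xs s0.
rewrite esum_set1//; apply: leeD => //.
rewrite esum_mkcond [leRHS]esum_mkcond; apply: le_esum => z _.
have [zs|_] := boolP (z \in gap s); last by case: ifP.
rewrite ifT//; move: zs => /set_mem /= /andP[sz z0]; apply/mem_set; split=> /=.
  by rewrite z0 andbT; apply: lt_trans sz; rewrite ltcR.
by move=> e; rewrite e ltxx in sz.
Qed.

(* [s] is the last point at which an [n]-dimensional positive family exists;
   the directions lost there are accounted for by the kernel at [s]. *)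
Lemma crossing_count n x : x < 0 -> positive_family x n ->
  (n%:R%:E <= \esum_(z in gap x) dimf z)%E.
Proof.
elim/ltn_ind: n x => -[|n] IH x x0 hx; first by apply: esum_ge0 => z _.
pose E := [set y | x <= y /\ y < 0 /\ positive_family y n.+1].
have [x1 x10 hx1] := h_nonpos.
have ubE : ubound E x1.
  move=> y [_ [y0 [k hk]]]; rewrite leNgt; apply/negP => x1y.
  have c0 : exists i : 'I_n.+1, (fun=> 1 : C) i != 0 by exists ord0; rewrite oner_neq0.
  have := hk _ c0; apply/negP; rewrite -leNgt.
  exact: le_trans (h_mono _ (ltW x1y) y0) (hx1 _).
have Ex : E x by split.
have hsup : has_sup E by split; [exists x|exists x1].
pose s := sup E.
have s0 : s < 0 by apply: le_lt_trans x10; apply: ge_sup => //; exists x.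
have xs : x <= s by apply: ub_le_sup => //; exists x1.
have [U [lam [UU UU' hd]]] := herm_diag (fun u v => Hherm u v s0).
have [d d0 hgap] := spec_gap lam.
have d20 : 0 < d / 2 by rewrite divr_gt0.
have [dl dl0 hdl] := h_cont s0 d20.
have gp i : 0 < lam i -> d / 2 < lam i.
  by move=> li; have := hgap i (lt0r_neq0 li); rewrite gtr0_norm//; lra.
have gn i : lam i < 0 -> lam i <= - (d / 2).
  by move=> li; have := hgap i (ltr0_neq0 li); rewrite ltr0_norm//; lra.
pose r := #|[pred i | (0 < lam i)%R]|.
(* With [n.+1] positive eigenvalues at [s], a positive family would persist beyond [s], against the
   choice of [s] as supremum. *)
have rn : (r < n.+1)%N.
  rewrite ltnNge; apply/negP => nr; pose y := s + dl / 2.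
  have ys : `|y - s| < dl by rewrite /y addrAC subrr add0r gtr0_norm ?divr_gt0//; lra.
  have [y0 hy] := hdl y ys.
  have Ey : E y.
    split; first by rewrite /y; move: xs; lra.
    by split; [exact: y0|exact: (family_intro UU UU' s0 hd gp hy nr)].
  have : y <= s by apply: ub_le_sup => //; exists x1.
  by rewrite /y; lra.
have [y Ey ys] := sup_adherent dl0 hsup.
have yles : y <= s by apply: ub_le_sup => //; exists x1.
have [y0 hy] : y < 0 /\ forall k, `|h y k - h s k| <= d / 2 * nn k.
  by apply: hdl; rewrite ler0_norm ?subr_le0//; move: ys; rewrite -/s; lra.
have step := crossing_step UU UU' s0 hd d20 gn hy Ey.2.2.
(* A family at [s] itself would contradict [rn]. Strictness places [s] inside the open interval over
   which the sum runs. *)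
have xlts : x < s.
  rewrite lt_neqAle xs andbT; apply/eqP => e.
  have hs : positive_family s n.+1 by rewrite -e.
  by have := family_le s0 UU UU' hd hs; rewrite leqNgt rn.
apply: (le_trans step); apply: le_trans (esum_gap xlts s0); apply: leeD => //.
apply: IH => //; apply: (family_intro (y := s) UU UU' s0 hd gp _ (leqnn _)) => k.
by rewrite subrr normr0 mulr_ge0// ?nn_ge0// ltW.
Qed.

End Crossing.

(** * Extensions of the minimal operator *)

Section Extensions.
Variable R : realType.
Local Notation C := (complexC R).
Local Notation Re := (@complex.Re R).
Variables (p : nat) (A B : nat -> 'M[C]_p).
Hypothesis hA : forall j, (A j)^t* = A j.
Hypothesis hB : forall j, B j \in unitmx.
Hypothesis LC : forall z : C, limit_circle_at A B z.
Hypothesis hT : nonneg (@inner _ _) (Tpre A B).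
Implicit Types (u v w f g : nat -> 'cV[C]_p) (z : C) (a b c k : 'cV[C]_p) (x y s : R).
Local Notation J := (@jacobi _ p A B 1).
Local Notation G0 := (Gamma0 A B).
Local Notation G1 := (Gamma1 A B).
Local Notation ip := (@inner C p).

Lemma G0_congr u v : J u = J v -> G0 u = G0 v.
Proof. by rewrite /Gamma0 => ->. Qed.

#[local] Opaque l2 inner cdot nn nnl nnM nsqC Gamma0 Gamma1 Ppoly Qpoly jacobi.

Lemma TThetaP (Th : set ('cV[C]_p * 'cV[C]_p)) q :
  TTheta A B Th q <-> [/\ l2 (J q.1), q.2 = J q.1 & Th (G0 q.1, G1 q.1)].
Proof.
split=> [[/(TmaxP hA hB LC) [h1 h2] h3]|[h1 h2 h3]].
  by split; [exact: h1|exact: h2|exact: h3].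
by split; [apply/(TmaxP hA hB LC); split; [exact: h1|exact: h2]|exact: h3].
Qed.

(** Green's formula translates adjointness of T_Theta into adjointness of Theta, because every pair
    of boundary values is realised by [triplet_surj]. *)
Lemma Theta_selfadjoint (Th : set ('cV[C]_p * 'cV[C]_p)) :
  selfadjoint_ext A B (TTheta A B Th) -> selfadjoint_rel Th.
Proof.
move=> [_ sa]; apply/seteqP; split=> [[a b] hab|[a b] [_ _ /= hab]].
  split=> // -[a' b'] hab' /=.
  have [u [lu lJu u0 u1]] := triplet_surj hA hB LC a b.
  have [v [lv lJv v0 v1]] := triplet_surj hA hB LC a' b'.
  have hu : TTheta A B Th (u, J u).
    by apply/TThetaP; split; [exact: lJu|reflexivity|rewrite /= u0 u1; exact: hab].
  have hv : TTheta A B Th (v, J v).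
    by apply/TThetaP; split; [exact: lJv|reflexivity|rewrite /= v0 v1; exact: hab'].
  move: hu; rewrite sa => -[_ _ /(_ _ hv) /= e].
  have := green hA hB LC lJv lJu; rewrite e subrr u0 u1 v0 v1 => /esym/subr0_eq; exact.
have [u [lu lJu u0 u1]] := triplet_surj hA hB LC a b.
suff /TThetaP [_ _] : TTheta A B Th (u, J u) by rewrite /= u0 u1; exact.
rewrite sa; split; [exact: lu|exact: lJu|] => -[v w] /TThetaP /= [lJv -> hv].
have e : cdot (G1 v) (G0 u) - cdot (G0 v) (G1 u) = 0.
  by rewrite u0 u1 (hab _ hv) subrr.
exact: (subr0_eq (etrans (green hA hB LC lJv lJu) e)).
Qed.

Section ThetaCD.
Variables K D : 'M[C]_p.
Local Notation Th := [set x : 'cV[C]_p * 'cV[C]_p | D *m x.2 - K *m x.1 = 0].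

Lemma TCDE : TCD A B K D = TTheta A B Th.
Proof. by []. Qed.

Hypothesis Thsa : selfadjoint_rel Th.

(** Passage from the kernel description of the relation to a range description: for [(a, b)] in it,
    symmetry makes [col_mx (- b) a] orthogonal to the kernel of [row_mx (- K) D]. *)
Lemma ThetaCD_param a b : Th (a, b) -> exists k, a = D^t* *m k /\ b = K^t* *m k.
Proof.
move=> /(saP Thsa) h.
have [w|k] := @orth_ker_range R p (p + p) (row_mx (- K) D) (col_mx (- b) a).
  rewrite -[w]vsubmxK mul_row_col mulNmx addrC => /h e.
  by rewrite cdot_col_mx e cdotNr addNr.
rewrite tC_row_mx mul_col_mx tCN mulNmx => /eq_col_mx [/oppr_inj e1 e2].
by exists k; split.
Qed.

Lemma ThetaCD_mem k : Th (D^t* *m k, K^t* *m k).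
Proof.
apply/(saP Thsa) => a b /= /subr0_eq h.
by rewrite !cdotMr !trmxCK h.
Qed.

Lemma ThetaCD_comm : K *m D^t* = D *m K^t*.
Proof.
apply/matrixP => i j; have /subr0_eq := ThetaCD_mem (delta_mx j 0).
by rewrite /= !mulmxA -!colE => /matrixP/(_ i 0); rewrite !mxE.
Qed.

End ThetaCD.

Lemma kq_alg (a b c d a1 a2 d1 d2 : C) : a - b = c - d -> b = 0 -> a = a1 - a2 ->
  c = 0 -> d = d1 - d2 -> Re a1 + Re d1 = Re a2 + Re d2.
Proof.
move=> e eb ea ec ed; move: e; rewrite eb ea ec ed subr0 sub0r => /(congr1 Re).
by rewrite !(ReD, ReN); lra.
Qed.

(** Green's formula for [u] and [u - v], the latter annihilated by J: the change of (Ju, u) is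
    compensated by that of Gamma_1. *)
Lemma kq_congr u v : l2 (J u) -> J u = J v -> kq A B u = kq A B v.
Proof.
move=> lJu e; have lJv : l2 (J v) by rewrite -e; exact: lJu.
have lu := l2_of_J hA hB LC lJu; have lv := l2_of_J hA hB LC lJv.
have Jw : J (u - v) = 0 by rewrite JB e subrr.
have lJ0 : l2 (J (u - v)) by rewrite Jw; exact: l2_0.
have e0 := G0_congr e.
have e1 : ip u (J (u - v)) = 0 by rewrite Jw; exact: inner0r.
have e2 := innerBr lu lv lJu.
have e3 : cdot (G1 u) (G0 (u - v)) = 0 by rewrite (G0B LC lJu lJv) e0 subrr; exact: cdot0r.
have e4 : cdot (G0 u) (G1 (u - v)) = cdot (G0 u) (G1 u) - cdot (G0 u) (G1 v).
  by rewrite (G1B LC lJu lJv); exact: cdotBr.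
rewrite /kq -e -e0; exact: (kq_alg (green hA hB LC lJu lJ0) e1 e2 e3 e4).
Qed.

End Extensions.

(** * Non-negative extensions *)

Section Nonnegative.
Variable R : realType.
Local Notation C := (complexC R).
Local Notation Re := (@complex.Re R).
Local Notation Im := (@complex.Im R).
Variables (p : nat) (A B : nat -> 'M[C]_p).
Hypothesis hA : forall j, (A j)^t* = A j.
Hypothesis hB : forall j, B j \in unitmx.
Hypothesis LC : forall z : C, limit_circle_at A B z.
Hypothesis hT : nonneg (@inner _ _) (Tpre A B).
Variable M : C -> 'M[C]_p.
Hypothesis hM : weyl_function A B M.
Variable Minf : set ('cV[C]_p * 'cV[C]_p).
Hypothesis hMinf : strong_resolvent_limit (fun x : R => M x%:C) Minf.
Implicit Types (u v w f g : nat -> 'cV[C]_p) (z : C) (a b c k : 'cV[C]_p) (x y s : R).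
Local Notation J := (@jacobi _ p A B 1).
Local Notation G0 := (Gamma0 A B).
Local Notation G1 := (Gamma1 A B).
Local Notation ip := (@inner C p).
Local Notation X := (fun x : R => M x%:C).
Local Notation Th K D := [set x : 'cV[C]_p * 'cV[C]_p | D *m x.2 - K *m x.1 = 0].

#[local] Opaque l2 inner cdot nn nnl nnM nsqC Gamma0 Gamma1 Ppoly Qpoly jacobi.

Let Xherm x a b : x < 0 -> cdot (X x *m a) b = cdot a (X x *m b) := weyl_herm hA hB LC hT hM a b.
Let Xmono x y a : x <= y -> y < 0 -> mq (X x) a <= mq (X y) a := weyl_mono hA hB LC hT hM a.

(** The variational inequality at [v = u], read with the boundary values of [u]; as [y] tends to -oo
    the term in |Ju|^2 disappears. *)
Lemma form_domination (K D : 'M[C]_p) u k y :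
  K *m D^t* = D *m K^t* -> l2 (J u) -> G0 u = D^t* *m k -> G1 u = K^t* *m k ->
  y < 0 -> y^-1 * nnl (J u) - hform X K D y k <= Re (ip (J u) u).
Proof.
move=> KD hJ u0 u1 y0; have := weyl_variational hA hB LC hT hM y0 hJ.
rewrite /kq /hform u0 u1.
have -> : cdot (K *m D^t* *m k) k = cdot (D^t* *m k) (K^t* *m k).
  by rewrite -[in LHS]mulmxA cdotMl.
move: (mq _ _) (Re _) (Re _) (_ * _) => *; lra.
Qed.

Lemma limit_eps (a n : R) : 0 <= n -> (forall y, y < 0 -> y^-1 * n <= a) -> 0 <= a.
Proof.
move=> n0 h; rewrite leNgt; apply/negP => a0.
have y0 : (n + 1) / a < 0 by rewrite nmulr_llt0 ?invr_lt0// ltr_wpDl.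
have := h _ y0; rewrite invf_div => h1.
have n1 : n + 1 != 0 by rewrite gt_eqF// ltr_wpDl.
have e : a / (n + 1) * (n + 1) = a by rewrite divfK.
have : a / (n + 1) < 0 by rewrite nmulr_rlt0// invr_gt0 ltr_wpDl.
move: (a / (n + 1)) e h1 => t e h1 t0; nra.
Qed.

Lemma CDN_form_le (K D : 'M[C]_p) k h y : CDN K D Minf (k, h) -> y < 0 ->
  hform X K D y k <= Re (cdot h k).
Proof.
move=> [g hg /= ->] y0; rewrite /hform cdotBl ReD ReN [cdot (D *m g) k]cdotMl.
apply: lerB => //; exact: (limit_form_le Xherm Xmono hMinf hg y0).
Qed.

Lemma nonneg_of_nonpos_rel (K D : 'M[C]_p) : selfadjoint_ext A B (TCD A B K D) ->
  nonpos_rel (CDN K D Minf) -> nonneg (@inner _ _) (TCD A B K D).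
Proof.
move=> sa [hdom hle].
have Thsa : selfadjoint_rel (Th K D) := Theta_selfadjoint hA hB LC sa.
have KD := ThetaCD_comm Thsa.
move=> [u w] h; have [_ saE] := sa.
have sym : ip w u = (ip w u)^*%R.
  have hh := h; rewrite saE in hh; have [lu lw /(_ _ h) /= e] := hh.
  by rewrite {1}e -(innerC lw lu).
have [/= hJ ew hTh] := (TThetaP hA hB LC (Th K D) (u, w)).1 h.
have [k [u0 u1]] := ThetaCD_param Thsa hTh.
have hk y : y < 0 -> hform X K D y k <= 0.
  move=> y0; have : dom (CDN K D Minf) k by rewrite hdom.
  move=> [g hg]; apply: (le_trans (CDN_form_le hg y0)).
  by have := hle _ hg; rewrite lecE => /andP[].
rewrite /= lecE; apply/andP; split.
  by have := congr1 Im sym; rewrite Im_conjC => e; apply/eqP; rewrite /=; move: e; lra.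
rewrite ew; apply: (limit_eps (nnl_ge0 hJ)) => y y0.
have := form_domination KD hJ u0 u1 y0; have := hk y y0.
move: (hform _ _ _ _ _) (_ * _) (Re _) => *; lra.
Qed.

(** The adjoints of [K] and [D] are 1 + i Rm and [Rm], so the resolvent parametrisation of [S] takes
    the required shape. If both kill [c], then c = (1 + i Rm)c - i Rm c = 0, whence the
    invertibility. *)
Lemma sa_rel_matrices (S : set ('cV[C]_p * 'cV[C]_p)) : selfadjoint_rel S ->
  exists K D : 'M[C]_p, [/\ S = Th K D, K *m D^t* = D *m K^t*,
    K *m K^t* + D *m D^t* \in unitmx & forall k, S (D^t* *m k, K^t* *m k)].
Proof.
move=> Ssa; have [Rm hR] := sa_resolvent Ssa.
pose K : 'M[C]_p := (1%:M + 'i%C *: Rm)^t*; pose D := Rm^t*.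
have hS k : S (D^t* *m k, K^t* *m k).
  by rewrite /D /K !trmxCK mulmxDl mul1mx -scalemxAl; exact: hR.
have e : S = Th K D.
  apply/seteqP; split=> [[a b] hab|[a b] /= /subr0_eq hab].
    apply/eqP; rewrite /= subr_eq0; apply/eqP/cdot_ext => k; rewrite 2!cdotMl.
    rewrite -cdotC -[RHS]cdotC; congr (_^*)%R; exact/esym/(sa_sym Ssa hab (hS k)).
  apply/(saP Ssa) => f g /(sa_resolventP Ssa hR) [k -> ->].
  have -> : k + 'i%C *: (Rm *m k) = K^t* *m k.
    by rewrite /K trmxCK mulmxDl mul1mx -scalemxAl.
  by rewrite cdotMl trmxCK -hab cdotMr /D trmxCK.
exists K, D; split=> //.
  apply: (@ThetaCD_comm R p K D).
  by rewrite -e.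
apply: inj_unitmx => c hc.
have : cdot ((K *m K^t* + D *m D^t*) *m c) c = 0 by rewrite hc cdot0l.
rewrite mulmxDl cdotDl -!mulmxA 2![cdot (_ *m (_ *m _)) _]cdotMl !cdot_nn -rmorphD.
move=> /(congr1 Re) /= h0.
have := nn_ge0 (K^t* *m c); have := nn_ge0 (D^t* *m c) => d0 k0.
have nD : D^t* *m c = 0 by apply: nn_eq0; move: h0 d0 k0; move: (nn _) (nn _) => *; lra.
have nK : K^t* *m c = 0 by apply: nn_eq0; move: h0 d0 k0; move: (nn _) (nn _) => *; lra.
move: nK; rewrite /K trmxCK mulmxDl mul1mx -scalemxAl.
by move: nD; rewrite /D trmxCK => ->; rewrite scaler0 addr0.
Qed.

Lemma attained_alg (q a t : R) : 0 <= a -> t <= 0 -> q - (a + q - t) <= 0.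
Proof. by lra. Qed.

(** Equality in the variational description is attained at some u with Gamma_0 u = [D^t* *m k].
    Resetting Gamma_1 to [K^t* *m k] keeps Ju, hence Gamma_0 and [kq], and gives v in T_(C,D); then
    [hform] equals x |u|^2 - Re (Jv, v). *)
Lemma hform_nonpos (K D : 'M[C]_p) x k : nonneg (@inner _ _) (TCD A B K D) ->
  K *m D^t* = D *m K^t* -> x < 0 -> hform X K D x k <= 0.
Proof.
move=> hn KD x0.
have [v0 [_ _ e0 _]] := triplet_surj hA hB LC (D^t* *m k) 0.
have [u [hJu u0 mE]] := weyl_attained hA hB LC hT hM v0 x0.
have [v [lv hJ v1]] := solveG1 hA hB LC (K^t* *m k) hJu.
have v2 : G0 v = D^t* *m k by rewrite (G0_congr hJ) u0.
have lJv : l2 (J v) by rewrite hJ; exact: hJu.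
have ekq := kq_congr hA hB LC lJv hJ.
have hv : TCD A B K D (v, J v).
  apply/(TThetaP hA hB LC (Th K D)); split; [exact: lJv|reflexivity|].
  by rewrite /= v1 v2 !mulmxA KD subrr.
have /= := hn _ hv; rewrite lecE => /andP[_] hpos.
have hu := nnl_ge0 (l2_of_J hA hB LC hJu).
rewrite /hform -e0 mE -ekq /kq v1 v2.
have -> : cdot (K *m D^t* *m k) k = cdot (D^t* *m k) (K^t* *m k).
  by rewrite -[in LHS]mulmxA cdotMl.
have xu : x * nnl u <= 0 by rewrite nmulr_rle0.
exact: (attained_alg _ hpos xu).
Qed.

(** A positive direction of the limit relation, +oo included, would make some [hform] positive by
    [eventually_positive]. Without positive directions the relation has full domain and non-positive
    form. *)
Lemma nonpos_rel_of_hform (K D : 'M[C]_p) : K *m D^t* = D *m K^t* ->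
  (forall x k, x < 0 -> hform X K D x k <= 0) -> nonpos_rel (CDN K D Minf).
Proof.
move=> KD hle; have Ssa := CDN_selfadjoint KD hMinf.1.
have [U [mu [lam [UU UU' hS]]]] := sa_diag Ssa.
have [x0 x00 hx0] := eventually_positive Xherm Xmono hMinf KD UU UU' hS.
have nf i : ~~ pflag mu lam i.
  apply/negP => fi; have /hx0 : col i U != 0.
    apply/eqP => h; have := cdot_basis UU i i; rewrite h cdot0l eqxx => /esym/eqP.
    by rewrite oner_eq0.
  have h0 j : ~~ pflag mu lam j -> cdot (col i U) (col j U) = 0.
    move=> fj; rewrite (cdot_basis UU); case: eqP => // e.
    by move: fj; rewrite e fi.
  by move=> /(_ h0); rewrite ltNge hle.
have ex k : exists2 w : 'cV[C]_p, CDN K D Minf (k, w) & Re (cdot w k) <= 0.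
  by apply: (unflagged_nonpos UU' Ssa hS) => i fi; move: (nf i); rewrite fi.
split; first by apply/seteqP; split=> // u _; have [w hw _] := ex u; exists w.
move=> [u w] h /=; have [w' hw' le] := ex u.
have e : cdot w u = cdot w' u by rewrite (sa_sym Ssa hw' h) -(sa_sym Ssa hw' hw').
rewrite lecE; apply/andP; split; last by rewrite e.
have := sa_sym Ssa h h; rewrite -[X in _ = X]cdotC => /(congr1 Im); rewrite Im_conjC => e2.
by apply/eqP; rewrite /=; move: e2; lra.
Qed.

End Nonnegative.

(** * Negative eigenvalues of extensions *)

Lemma dimension_attained (R : realType) (V : lmodType R[i]) (W : set V) (m : nat) :
  (forall n (v : 'I_n -> V), (forall i, W (v i)) -> lin_indep v -> (n <= m)%N) ->
  exists n (v : 'I_n -> V), [/\ forall i, W (v i), lin_indep v & dimension W = n%:R%:E].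
Proof.
move=> hm.
pose Pr n := `[< exists v : 'I_n -> V, (forall i, W (v i)) /\ lin_indep v >].
have Pr0 : exists n, Pr n.
  by exists 0%N; apply/asboolP; exists (fun=> 0); split=> [[]//|c _ []//].
have Prm n : Pr n -> (n <= m)%N by move=> /asboolP[v [h1 h2]]; exact: hm h1 h2.
case: (ex_maxnP Pr0 Prm) => n /asboolP[v [h1 h2]] nmax.
exists n, v; split=> //; apply/eqP; rewrite eq_le; apply/andP; split.
  apply: ge_ereal_sup => _ [k hk <-]; rewrite lee_fin ler_nat.
  by apply: nmax; apply/asboolP.
by apply: ereal_sup_ubound; exists n => //; exists v.
Qed.

Section Negative.
Variable R : realType.
Local Notation C := (complexC R).
Local Notation Re := (@complex.Re R).
Variables (p : nat) (A B : nat -> 'M[C]_p).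
Hypothesis hA : forall j, (A j)^t* = A j.
Hypothesis hB : forall j, B j \in unitmx.
Hypothesis LC : forall z : C, limit_circle_at A B z.
Hypothesis hT : nonneg (@inner _ _) (Tpre A B).
Variable M : C -> 'M[C]_p.
Hypothesis hM : weyl_function A B M.
Variable Minf : set ('cV[C]_p * 'cV[C]_p).
Hypothesis hMinf : strong_resolvent_limit (fun x : R => M x%:C) Minf.
Implicit Types (u v w f g : nat -> 'cV[C]_p) (z : C) (a b c k : 'cV[C]_p) (x y s : R).
Local Notation J := (@jacobi _ p A B 1).
Local Notation G0 := (Gamma0 A B).
Local Notation G1 := (Gamma1 A B).
Local Notation ip := (@inner C p).
Local Notation X := (fun x : R => M x%:C).
Local Notation Th K D := [set x : 'cV[C]_p * 'cV[C]_p | D *m x.2 - K *m x.1 = 0].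
Variables K D : 'M[C]_p.
Hypothesis sa : selfadjoint_ext A B (TCD A B K D).

#[local] Opaque l2 inner cdot nn nnl nnM nsqC Gamma0 Gamma1 Ppoly Qpoly jacobi.

Let Xherm x a b : x < 0 -> cdot (X x *m a) b = cdot a (X x *m b) := weyl_herm hA hB LC hT hM a b.
Let Xmono x y a : x <= y -> y < 0 -> mq (X x) a <= mq (X y) a := weyl_mono hA hB LC hT hM a.
Let Thsa : selfadjoint_rel (Th K D) := Theta_selfadjoint hA hB LC sa.
Let KD : K *m D^t* = D *m K^t* := ThetaCD_comm Thsa.

Lemma comb_sum (I : Type) (r : seq I) (c : I -> C) (u : I -> nat -> 'cV[C]_p) :
  (forall i, l2 (J (u i))) ->
  [/\ l2 (J (\sum_(i <- r) c i *: u i)),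
      G0 (\sum_(i <- r) c i *: u i) = \sum_(i <- r) c i *: G0 (u i),
      G1 (\sum_(i <- r) c i *: u i) = \sum_(i <- r) c i *: G1 (u i) &
      J (\sum_(i <- r) c i *: u i) = \sum_(i <- r) c i *: J (u i)].
Proof.
move=> hu; elim: r => [|i r [h1 h2 h3 h4]].
  have l0 : l2 (J 0) by rewrite J0; exact: l2_0.
  rewrite !big_nil; split; [exact: l0| | |exact: J0].
    by have := G0B LC l0 l0; rewrite !subrr.
  by have := G1B LC l0 l0; rewrite !subrr.
rewrite !big_cons; split.
- rewrite JD JZ; apply: l2_comb; [exact: hu|exact: h1].
- by rewrite (G0_linear LC (c i) (hu i) h1) h2.
- by rewrite (G1_linear LC (c i) (hu i) h1) h3.
- by rewrite JD JZ h4.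
Qed.

(** The defect vector at [s] with Gamma_0 u = [D^t* *m v j] satisfies D Gamma_1 u - K Gamma_0 u =
    -H(s) v_j = 0. *)
Lemma kernel_lower s q (v : 'I_q -> 'cV[C]_p) : s < 0 ->
  (forall j, (K *m D^t* - D *m X s *m D^t*) *m v j = 0) ->
  (forall d : 'I_q -> C, \sum_j d j *: (D^t* *m v j) = 0 -> forall j, d j = 0) ->
  (q%:R%:E <= dimension (ker_sub (TCD A B K D) s%:C))%E.
Proof.
move=> s0 hv hi; have [L _ hL] := weyl_vector hA hB LC hT hM s0.
have [u hu] := choice (fun j => hL (D^t* *m v j)).
have lJ j : l2 (J (u j)) by have [h1 -> _ _ _] := hu j; exact: l2Z.
apply: ereal_sup_ubound; exists q => //; exists u; split=> [j|c hc].
  have [h1 h2 h3 h4 _] := hu j.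
  apply/(TThetaP hA hB LC (Th K D)); split; [exact: lJ|by rewrite /= h2|].
  rewrite /= h3 h4 -[RHS]oppr0 -(hv j) mulmxBl -!mulmxA.
  by rewrite opprB.
apply: hi; have [_ e _ _] := comb_sum (index_enum 'I_q) c lJ.
have l0 : l2 (J 0) by rewrite J0; exact: l2_0.
have G00 : G0 0 = 0 by have := G0B LC l0 l0; rewrite !subrr.
rewrite hc G00 in e; rewrite [RHS]e; apply: eq_bigr => j _.
by have [_ _ -> _ _] := hu j.
Qed.

Lemma inner_suml (I : Type) (r : seq I) (P : pred I) (c : I -> C) (u : I -> nat -> 'cV[C]_p) v :
  (forall i, l2 (u i)) -> l2 v -> l2 (\sum_(i <- r | P i) c i *: u i) /\
  ip (\sum_(i <- r | P i) c i *: u i) v = \sum_(i <- r | P i) c i * ip (u i) v.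
Proof.
move=> hu hv; elim: r => [|i r [h1 h2]].
  by rewrite !big_nil inner0l; split; [exact: l2_0|].
rewrite !big_cons; case: ifP => _; split; [|  |exact: h1|exact: h2].
  by apply: l2_comb; [exact: hu|exact: h1].
by rewrite (innerDl (@l2Z _ _ (c i) _ (hu i)) h1 hv) (innerZl _ (hu i) hv) h2.
Qed.

Lemma inner_sum2 (I : finType) (P Q : pred I) (c d : I -> C) (u : I -> nat -> 'cV[C]_p) :
  (forall i, l2 (u i)) ->
  ip (\sum_(i | P i) c i *: u i) (\sum_(j | Q j) d j *: u j) =
  \sum_(i | P i) \sum_(j | Q j) c i * (d j)^*%R * ip (u i) (u j).
Proof.
move=> hu; have [l1 _] := inner_suml (index_enum I) Q d hu (@l2_0 R p).
rewrite (inner_suml _ P c hu l1).2; apply: eq_bigr => i _.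
have [_ e] := inner_suml (index_enum I) Q d hu (hu i).
rewrite -(innerC l1 (hu i)) e rmorph_sum mulr_sumr; apply: eq_bigr => j _.
by rewrite rmorphM /= (innerC (hu j) (hu i)) mulrA.
Qed.

Lemma ker_sub_orth x y u v : ker_sub (TCD A B K D) x%:C u -> ker_sub (TCD A B K D) y%:C v ->
  x != y -> ip u v = 0.
Proof.
move=> hu hv xy; have [_ saE] := sa.
have hu' := hu; have hv' := hv; rewrite /ker_sub /= saE in hu' hv'.
have [/= lu _ _] := hu'; have [/= lv _ /(_ _ hu) /= e] := hv'.
move: e; rewrite (innerZl _ lu lv) (innerZr _ lv lu) conj_real => /eqP.
rewrite -subr_eq0 -mulrBl mulf_eq0 => /orP[|/eqP//].
by rewrite -rmorphB /= => /eqP/(congr1 Re)/eqP; rewrite /= subr_eq0 (negbTE xy).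
Qed.

(** With this weight, y^-1 |Ju|^2 - (Ju, u) for a combination of eigenvectors becomes the squared
    norm of a reweighted combination. *)
Lemma gram_term (c d g : C) (l y s : R) : s ^+ 2 = y^-1 * l ^+ 2 - l ->
  c * s%:C * ((d * s%:C)^*)%R * g =
  (y^-1)%:C * (c * l%:C * ((d * l%:C)^*)%R * g) - c * l%:C * (d^*)%R * g.
Proof.
move=> e; have e2 : s%:C * s%:C = (y^-1)%:C * l%:C * l%:C - l%:C :> C.
  by rewrite -!rmorphM -rmorphB /= -expr2 e expr2 mulrA.
have hc (r : R) : ((d * r%:C)^*)%R = (d^*)%R * r%:C by rewrite rmorphM /= conj_real.
rewrite !hc; move: (d^*)%R => d'.
transitivity (c * d' * g * (s%:C * s%:C)); first by ring.
by rewrite e2; ring.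
Qed.

(** The weight is -l(1 - l/y), positive once y lies below all [l i]; -1 plus the sum of these
    negative numbers does. *)
Lemma weight_exists (I : finType) (l : I -> R) : (forall i, l i < 0) ->
  exists2 y, y < 0 & exists sg : R -> R, forall i,
    0 < sg (l i) /\ sg (l i) ^+ 2 = y^-1 * l i ^+ 2 - l i.
Proof.
move=> hl; pose y := - 1 + \sum_i l i.
have yl i : y < l i.
  rewrite /y (bigD1 i)//=; have : \sum_(j | j != i) l j <= 0.
    by apply: sumr_le0 => j _; exact: ltW.
  by have := hl i; lra.
have y0 : y < 0.
  have : \sum_i l i <= 0 by apply: sumr_le0 => j _; exact: ltW.
  by rewrite /y; lra.
exists y => //; exists (fun x => Num.sqrt (y^-1 * x ^+ 2 - x)) => i.
have w0 : 0 < y^-1 * l i ^+ 2 - l i.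
  have -> : y^-1 * l i ^+ 2 - l i = (- l i) * (1 - l i / y) by rewrite expr2; ring.
  rewrite mulr_gt0 ?oppr_gt0// subr_gt0 ltr_ndivrMr// mul1r.
  exact: yl.
by split; [rewrite sqrtr_gt0|rewrite sqr_sqrtr// ltW].
Qed.

(** The boundary parameters [k i] of the eigenvectors form a positive family for [hform] at [y], by
    [form_domination]. Independence is assumed within each eigenvalue only; orthogonality supplies
    the rest. *)
Lemma negative_family_le (I : finType) (l : I -> R) (u : I -> nat -> 'cV[C]_p)
    (U : 'M[C]_p) (mu : 'I_p -> bool) (lam : 'I_p -> R) :
  U *m U^t* = 1%:M ->
  (forall i, CDN K D Minf
    (if mu i then 0 else col i U, if mu i then col i U else (lam i)%:C *: col i U)) ->
  (forall i, l i < 0) -> (forall i, ker_sub (TCD A B K D) (l i)%:C (u i)) ->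
  (forall c : I -> C, (forall x, \sum_(i | l i == x) c i *: u i = 0) -> forall i, c i = 0) ->
  (#|I| <= #|[pred i | pflag mu lam i]|)%N.
Proof.
move=> UU' hS hl hu hi.
have hTu i := (TThetaP hA hB LC (Th K D) (u i, (l i)%:C *: u i)).1 (hu i).
have lJ i : l2 (J (u i)) by have [h _ _] := hTu i.
have lu i : l2 (u i) := l2_of_J hA hB LC (lJ i).
have Ju i : J (u i) = (l i)%:C *: u i by have [_ /= -> _] := hTu i.
have hk i : exists k, G0 (u i) = D^t* *m k /\ G1 (u i) = K^t* *m k.
  by have [_ _ h] := hTu i; exact: (ThetaCD_param Thsa h).
have [k hkk] := choice hk.
have [y y0 [sg hsg]] := weight_exists hl.
apply: (positive_family_le UU' (CDN_selfadjoint KD hMinf.1) hS (k := k) (h := hform X K D y)).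
  by move=> a b h; exact: (CDN_form_le hA hB LC hT hM hMinf h y0).
move=> c c0; pose uc := \sum_i c i *: u i.
have [lJuc g0 g1 JE] := comb_sum (index_enum I) c lJ.
have e0 : G0 uc = D^t* *m (\sum_i c i *: k i).
  by rewrite g0 mulmx_sumr; apply: eq_bigr => i _; rewrite (hkk i).1 scalemxAr.
have e1 : G1 uc = K^t* *m (\sum_i c i *: k i).
  by rewrite g1 mulmx_sumr; apply: eq_bigr => i _; rewrite (hkk i).2 scalemxAr.
have key := form_domination hA hB LC hT hM KD lJuc e0 e1 y0.
(* By orthogonality of the eigenspaces, |F|^2 = y^-1 |J uc|^2 - (J uc, uc). *)
pose F := \sum_i (c i * (sg (l i))%:C) *: u i.
have lF : l2 F.
  by have [] := inner_suml (index_enum I) predT (fun i => c i * (sg (l i))%:C) lu (@l2_0 R p).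
have JE' : J uc = \sum_i (c i * (l i)%:C) *: u i.
  by rewrite JE; apply: eq_bigr => i _; rewrite Ju scalerA.
have eF : ip F F = (y^-1)%:C * ip (J uc) (J uc) - ip (J uc) uc.
  rewrite JE' !(inner_sum2 _ _ _ _ lu) mulr_sumr -sumrB; apply: eq_bigr => i _.
  rewrite mulr_sumr -sumrB; apply: eq_bigr => j _.
  have [eij|nij] := eqVneq (l i) (l j); last first.
    by rewrite (ker_sub_orth (hu i) (hu j) nij) !mulr0 subrr.
  by rewrite -eij; apply: gram_term; exact: (hsg i).2.
have nF : nnl F <= hform X K D y (\sum_i c i *: k i).
  have : nnl F = y^-1 * nnl (J uc) - Re (ip (J uc) uc).
    have h := congr1 Re eF; rewrite (inner_nnl lF) (inner_nnl lJuc) ReD ReN Re_realM in h.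
    exact: h.
  move: key; rewrite -/uc; move: (nnl F) (_ * _) (Re _) (hform _ _ _ _ _) => *; lra.
(* If [F = 0], pairing it with the component [v] of [uc] at the eigenvalue [x] leaves sg(x) |v|^2 =
   0, so every component vanishes. *)
apply: lt_le_trans nF; rewrite lt_def (nnl_ge0 lF) andbT; apply/eqP => /(nnl_eq0 lF) F0.
have [i0 /eqP] := c0; apply; apply: hi => x.
set v := \sum_(i | _) _.
have lv : l2 v by have [] := inner_suml (index_enum I) (fun i => l i == x) c lu (@l2_0 R p).
have e2 : ip F v = (sg x)%:C * ip v v.
  rewrite /F /v !(inner_sum2 _ _ _ _ lu) (bigID (fun i => l i == x)) /=.
  rewrite [X in _ + X]big1 ?addr0 => [|i ix]; last first.
    apply: big1 => j /eqP jx; rewrite (ker_sub_orth (hu i) (hu j)) ?mulr0// jx.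
    exact: ix.
  rewrite mulr_sumr; apply: eq_bigr => i /eqP ix; rewrite mulr_sumr.
  by apply: eq_bigr => j _; rewrite ix; ring.
case: (pickP (fun i => l i == x)) => [i /eqP ix|nx]; last by rewrite /v big_pred0.
apply: (nnl_eq0 lv); move: e2; rewrite F0 inner0l => /esym/eqP.
have sx : 0 < sg x by rewrite -ix; exact: (hsg i).1.
rewrite mulf_eq0 => /orP[/eqP/(congr1 Re)/= s0|/eqP vv]; first by rewrite s0 ltxx in sx.
by rewrite (inner_nnl lv) in vv; exact: (congr1 Re vv).
Qed.

End Negative.

Section KappaNeg.
Variable R : realType.
Local Notation C := (complexC R).
Local Notation Re := (@complex.Re R).
Variables (p : nat) (A B : nat -> 'M[C]_p).
Hypothesis hA : forall j, (A j)^t* = A j.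
Hypothesis hB : forall j, B j \in unitmx.
Hypothesis LC : forall z : C, limit_circle_at A B z.
Hypothesis hT : nonneg (@inner _ _) (Tpre A B).
Variable M : C -> 'M[C]_p.
Hypothesis hM : weyl_function A B M.
Variable Minf : set ('cV[C]_p * 'cV[C]_p).
Hypothesis hMinf : strong_resolvent_limit (fun x : R => M x%:C) Minf.
Local Notation X := (fun x : R => M x%:C).
Variables K D : 'M[C]_p.
Hypothesis sa : selfadjoint_ext A B (TCD A B K D).

#[local] Opaque l2 inner cdot nn nnl nnM nsqC Gamma0 Gamma1 Ppoly Qpoly jacobi.

Let Xherm x a b : x < 0 -> cdot (X x *m a) b = cdot a (X x *m b) := weyl_herm hA hB LC hT hM a b.
Let Xmono x y a : x <= y -> y < 0 -> mq (X x) a <= mq (X y) a := weyl_mono hA hB LC hT hM a.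
Let KD : K *m D^t* = D *m K^t* := ThetaCD_comm (Theta_selfadjoint hA hB LC sa).

Variables (U : 'M[C]_p) (mu : 'I_p -> bool) (lam : 'I_p -> R).
Hypothesis UU : U^t* *m U = 1%:M.
Hypothesis UU' : U *m U^t* = 1%:M.
Hypothesis hS : forall i, CDN K D Minf
    (if mu i then 0 else col i U, if mu i then col i U else (lam i)%:C *: col i U).
Local Notation m := #|[pred i | pflag mu lam i]|.
Local Notation T := (TCD A B K D).

Lemma neg_real (z : C) : z < 0 -> z = (Re z)%:C /\ Re z < 0.
Proof.
rewrite ltcE => /andP[/eqP h1 h2]; split=> //.
by apply: complexP => //=; rewrite -h1.
Qed.

Lemma kernel_attained (z : C) : z < 0 -> exists n (v : 'I_n -> nat -> 'cV[C]_p),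
  [/\ forall i, ker_sub T z (v i), lin_indep v & dimension (ker_sub T z) = n%:R%:E].
Proof.
move=> z0; apply: (@dimension_attained R _ _ m) => n v hv iv; have [ez rz0] := neg_real z0.
rewrite -[n]card_ord.
apply: (negative_family_le hA hB LC hT hM hMinf sa UU' hS (l := fun=> Re z) (u := v)) => [_|i|c hc].
- exact: rz0.
- by rewrite -ez.
- by apply: iv; have := hc (Re z); rewrite eqxx.
Qed.

(** Bases of finitely many eigenspaces are joined over a sum type that records the eigenvalue of
    each vector, as [negative_family_le] requires. *)
Lemma graded_family (r : seq C) : uniq r -> (forall z, z \in r -> z < 0) ->
  exists (I : finType) (l : I -> R) (u : I -> nat -> 'cV[C]_p),
  [/\ forall i, (l i)%:C \in r, forall i, ker_sub T (l i)%:C (u i),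
      forall c : I -> C, (forall x, \sum_(i | l i == x) c i *: u i = 0) -> forall i, c i = 0 &
      (\sum_(z <- r) dimension (ker_sub T z) = #|I|%:R%:E)%E].
Proof.
elim: r => [_ _|z r IH /= /andP[zr ur] hr].
  exists void, (fun=> 0), (fun=> 0); split=> [[]|[]|c _ []|].
  by rewrite big_nil card_void.
have [|I [l [u [h1 h2 h3 h4]]]] := IH ur.
  by move=> w wr; apply: hr; rewrite in_cons wr orbT.
have z0 : z < 0 by apply: hr; exact: mem_head.
have [ez rz0] := neg_real z0; have [n [v [v1 v2 v3]]] := kernel_attained z0.
have lz i : l i != Re z.
  by apply: contra zr => /eqP e; rewrite ez -e.
exists ('I_n + I)%type, (fun t => match t with inl _ => Re z | inr i => l i end),
  (fun t => match t with inl j => v j | inr i => u i end).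
split=> [[j|i]|[j|i]|c hc|].
- by rewrite -ez mem_head.
- by rewrite in_cons h1 orbT.
- by rewrite -ez.
- exact: h2.
- have hl j : c (inl j) = 0.
    apply: (v2 (fun j => c (inl j))); have := hc (Re z); rewrite big_sumType /= eqxx.
    rewrite [X in _ + X]big_pred0 ?addr0 // => i; exact: negbTE.
  have hrr i : c (inr i) = 0.
    apply: (h3 (fun i => c (inr i))) => x; have := hc x; rewrite big_sumType /=.
    by rewrite [X in X + _]big1 ?add0r// => j _; rewrite hl scale0r.
  by case.
- by rewrite big_cons v3 h4 -EFinD -natrD card_sum card_ord.
Qed.

(** The sum over all eigenvalues is a supremum over finite sets, and the bound does not depend on
    the set. *)
Lemma kappa_neg_le : (kappa_neg T <= m%:R%:E)%E.
Proof.
apply: ge_ereal_sup => _ [Z [finZ ZS] <-]; rewrite fsbig_finite//.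
have memZ z : (z \in finmap.enum_fset (fset_set Z)) = (z \in Z) := in_fset_set finZ z.
have [||I [l [u [h1 h2 h3 ->]]]] := @graded_family (finmap.enum_fset (fset_set Z)).
- exact: finmap.fset_uniq.
- by move=> z; rewrite memZ => /set_mem /ZS.
rewrite lee_fin ler_nat.
apply: (negative_family_le hA hB LC hT hM hMinf sa UU' hS (l := l) (u := u)) => // i.
have := h1 i; rewrite memZ => /set_mem /ZS /=.
by rewrite ltcR.
Qed.

(** The basis vectors of the positive directions form a positive family at [x0]; the crossing count
    from there yields eigenvalues between [x0] and 0, a part of the full sum. *)
Lemma kappa_neg_ge : (m%:R%:E <= kappa_neg T)%E.
Proof.
have [x0 x00 hx0] := eventually_positive Xherm Xmono hMinf KD UU UU' hS.
have fam : positive_family X K D x0 m.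
  exists (fun j => col (enum_val j) U) => c [j0 cj0].
  set k := \sum_i _.
  have hck j : cdot k (col (enum_val j) U) = c j.
    rewrite cdot_expand (bigD1 j)//= big1 => [|i ij]; last first.
      by rewrite (cdot_basis UU) (inj_eq enum_val_inj) eq_sym (negbTE ij) mulr0.
    by rewrite (cdot_basis UU) eqxx mulr1 addr0.
  apply: hx0 => [|i fi].
    by apply: contra cj0 => /eqP k0; rewrite -hck k0 cdot0l.
  rewrite cdot_expand big1// => j _; rewrite (cdot_basis UU).
  case: eqP => [e|_]; last by rewrite mulr0.
  by have := enum_valP j; rewrite inE -e (negbTE fi).
have := crossing_count Xherm Xmono (fun s => @weyl_cont R p A B hA hB LC hT M hM s)
  (fun t => @weyl_blowup R p A B hA hB LC hT M hM t) KD
  (fun z => dimension_ge0 (ker_sub T z)) 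
  (fun s q v => @kernel_lower R p A B hA hB LC hT M hM K D s q v) x00 fam.
move=> /le_trans; apply; rewrite /kappa_neg esum_mkcond [leRHS]esum_mkcond.
apply: le_esum => z _; case: ifP => [/set_mem /= /andP[_ z0]|_].
  by rewrite ifT//; exact/mem_set.
by case: ifP => // _; exact: dimension_ge0.
Qed.

End KappaNeg.

Theorem theorem1 (R : realType) (p : nat) (hp : (0 < p)%N)
    (A B : nat -> 'M[R[i]]_p)
    (hA : forall j, (A j)^t* = A j)
    (hB : forall j, B j \in unitmx)
    (hT : nonneg (@inner _ _) (Tpre A B))
    (hplus : dimension (ker_sub (Tmax A B) (- 'i)) = (p%:R)%:E)
    (hminus : dimension (ker_sub (Tmax A B) 'i) = (p%:R)%:E)
    (M : R[i] -> 'M[R[i]]_p) (hM : weyl_function A B M)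
    (Minf : set ('cV[R[i]]_p * 'cV[R[i]]_p))
    (hMinf : strong_resolvent_limit (fun x : R => M x%:C) Minf) :
  (* (i) *)
  (krein (Tmin A B) = T0 A B /\
   dom (krein (Tmin A B)) =
     [set u | dom (Tmax A B) u /\
       limn (series (fun j => (Ppoly A B 0 j)^t* *m jacobi A B u j)) = 0]) /\
  (* (ii) *)
  (forall Theta : set ('cV[R[i]]_p * 'cV[R[i]]_p),
     linear_relation Theta -> selfadjoint_ext A B (TTheta A B Theta) ->
     (nonneg (@inner _ _) (TTheta A B Theta) <->
      exists C D : 'M[R[i]]_p,
        [/\ TTheta A B Theta = TCD A B C D,
            C *m D^t* = D *m C^t*,
            C *m C^t* + D *m D^t* \in unitmx &
            nonpos_rel (CDN C D Minf)])) /\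
  (* (iii) *)
  (forall C D : 'M[R[i]]_p,
     selfadjoint_ext A B (TCD A B C D) ->
     kappa_neg (TCD A B C D) = kappa_pos (CDN C D Minf)).
Proof.
have LCp : limit_circle_at A B (- 'i : R[i]).
  by apply: (limit_circle_of_P hp hA hB _ _ hplus) => /=; rewrite ?oppr0 ?sqrrN ?expr1n.
have LCm : limit_circle_at A B ('i : R[i]).
  by apply: (limit_circle_of_P hp hA hB _ _ hminus) => /=; rewrite ?expr1n.
(* The comparison argument needs the bounds at i and at its conjugate -i; each deficiency index
   supplies one of them. *)
have LC z : limit_circle_at A B z.
  apply: (limit_circle hA hB LCm).
  by have -> : (('i : R[i])^*)%R = - 'i :> R[i] by exact: conj_ii.
split; first by split; [exact: krein_T0|exact: dom_krein].
split => [S _ sa|K D sa].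
  split => [hn|[K [D [e _ _ hnp]]]].
    have [K [D [e KD unitKD _]]] := sa_rel_matrices (Theta_selfadjoint hA hB LC sa).
    have e' : TTheta A B S = TCD A B K D by rewrite e TCDE.
    exists K, D; split=> //; rewrite e' in hn.
    apply: (nonpos_rel_of_hform hA hB LC hT hM hMinf KD) => x k x0.
    exact: (hform_nonpos hA hB LC hT hM).
  rewrite e in sa *; exact: (nonneg_of_nonpos_rel hA hB LC hT hM hMinf sa hnp).
have Ssa := CDN_selfadjoint (ThetaCD_comm (Theta_selfadjoint hA hB LC sa)) hMinf.1.
have [U [mu [lam [UU UU' hS]]]] := sa_diag Ssa.
rewrite (kappa_posE UU UU' Ssa hS); apply/eqP; rewrite eq_le; apply/andP; split.
  exact: (kappa_neg_le hA hB LC hT hM hMinf sa UU' hS).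
exact: (kappa_neg_ge hA hB LC hT hM hMinf sa UU UU' hS).
Qed.
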